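(* Let $(M,\mathcal T,\varepsilon,\eta)$ be a weighted triangulated connected closed surface with weights $\varepsilon:V\to\{0,1\}$ and $\eta:E\to\mathbb R$ satisfying the structure condition. Work in either the Euclidean or the hyperbolic background geometry. Suppose there exists a (nondegenerate) discrete conformal structure $\overline u$ with combinatorial curvature $\overline K$. Then for any $s\in\mathbb R$ there exists a constant $\delta>0$ such that if $\|u(0)-\overline u\|<\delta$ (and additionally $\sum_{i\in V}u_i(0)=\sum_{i\in V}\overline u_i$ in the Euclidean background geometry), then the solution $u(t)$ of the fractional combinatorial Calabi flow $$\frac{du_i}{dt}=\Delta^s(K-\overline K)_i,\qquad i\in V,$$ with initial value $u(0)$ exists for all time $t\ge 0$ and converges exponentially fast to $\overline u$, i.e. there are constants $C,c>0$ with $\|u(t)-\overline u\|\le Ce^{-ct}$ for all $t\ge0$.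
   Context: $\mathcal T=\{V,E,F\}$ is a triangulation of the connected closed surface $M$ with vertex set $V$, edge set $E$ and face set $F$; $N=|V|$; vertices, edges and faces are denoted $i$, $\{ij\}$, $\triangle ijk$. Structure condition: $\varepsilon_p\varepsilon_q+\eta_{pq}>0$ for every edge $\{pq\}\in E$, and $\varepsilon_p\eta_{qr}+\eta_{pq}\eta_{pr}\ge 0$ for every face $\triangle pqr\in F$ and every labelling $p,q,r$ of its vertices. Discrete conformal structure: a map $f:V\to\mathbb R$ determining edge lengths $l:E\to(0,+\infty)$ by $l_{ij}=\sqrt{\varepsilon_ie^{2f_i}+\varepsilon_je^{2f_j}+2\eta_{ij}e^{f_i+f_j}}$ in the Euclidean background geometry and $l_{ij}=\cosh^{-1}\big(\sqrt{(1+\varepsilon_ie^{2f_i})(1+\varepsilon_je^{2f_j})}+\eta_{ij}e^{f_i+f_j}\big)$ in the hyperbolic background geometry. It is nondegenerate if the strict triangle inequalities hold for every face, so that each face is realized as a Euclidean (resp. hyperbolic) triangle with the given edge lengths. Coordinates $u$: in the Euclidean case $u_i=f_i$; in the hyperbolic case $u_i=f_i$ if $\varepsilon_i=0$ and $u_i=\frac12\log\left|\frac{\sqrt{1+e^{2f_i}}-1}{\sqrt{1+e^{2f_i}}+1}\right|$ if $\varepsilon_i=1$. The vector $u$ is also called a discrete conformal structure, and everything is regarded as a function of $u$ on the open set of nondegenerate $u$. Combinatorial curvature: $K_i=2\pi-\sum_{\triangle ijk\in F}\theta_i^{jk}$, where $\theta_i^{jk}$ is the inner angle at $i$ in $\triangle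 ijk$ and the sum is over the faces at $i$. Let $L=\left(\frac{\partial K_i}{\partial u_j}\right)_{i,j\in V}$. Under the structure condition $L$ is known to be symmetric positive semi-definite at every nondegenerate $u$. Write $L=P^T\mathrm{diag}\{\lambda_1,\dots,\lambda_N\}P$ with $P\in O(N)$ and $\lambda_i\ge0$. For $s\in\mathbb R$, $L^s=P^T\mathrm{diag}\{\lambda_1^s,\dots,\lambda_N^s\}P$ with the convention $0^s=0$ for every $s\in\mathbb R$ (including $s\le 0$), and $\Delta^s=-L^s$. In the flow, $K$ and $\Delta^s$ are evaluated at $u(t)$ and $\overline K$ is fixed. *)

(* Defs.v *)
From HB Require Import structures.
From mathcomp Require Import all_boot all_order all_algebra.
From mathcomp Require Import all_classical all_reals all_analysis.
From mathcomp Require Import ring.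
Import Order.TTheory GRing.Theory Num.Theory.
Import numFieldNormedType.Exports.

Set Implicit Arguments.
Unset Strict Implicit.
Unset Printing Implicit Defensive.

Local Open Scope ring_scope.
Local Open Scope classical_set_scope.

(* A triangulation is an abstract simplicial complex on the vertex set 'I_N,
   given by its set [F] of faces (triangles).  The edges are the 2-subsets of
   the faces. *)
Definition edges (N : nat) (F : {set {set 'I_N}}) : {set {set 'I_N}} :=
  [set e : {set 'I_N} | (#|e| == 2)%N && [exists f in F, e \subset f]].

(* [surf_edge] makes every vertex link a disjoint union of circles and
   [surf_link] makes it a single circle, so that the realization of the complex
   is a closed surface; it is connected by [surf_connected]. *)
Record connected_closed_surface (N : nat) (F : {set {set 'I_N}}) : Prop := {
  surf_nonempty : F != finset.set0;
  surf_face : forall f, f \in F -> #|f| = 3;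
  surf_vertex : forall i : 'I_N, exists2 f, f \in F & i \in f;
  surf_edge : forall e, e \in edges F -> #|[set f in F | e \subset f]%SET| = 2;
  surf_link : forall i j k : 'I_N,
    [set i; j]%SET \in edges F -> [set i; k]%SET \in edges F ->
    connect [rel a b | [set i; a; b]%SET \in F] j k;
  surf_connected : forall i j : 'I_N,
    connect [rel a b | [set a; b]%SET \in edges F] i j }.

Inductive background := Euclidean | Hyperbolic.

Section HyperbolicFunctions.
Context {R : realType}.
Implicit Types x : R.

Definition cosh x : R := (expR x + expR (- x)) / 2.
Definition sinh x : R := (expR x - expR (- x)) / 2.
Definition arcosh x : R := ln (x + Num.sqrt (x ^+ 2 - 1)).

Lemma arcosh_ge0 x : 1 <= x -> 0 <= arcosh x.
Proof.
move=> x1; apply: ln_ge0; rewrite -[leLHS]addr0 lerD // sqrtr_ge0.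
Qed.

Lemma arcoshK x : 1 <= x -> cosh (arcosh x) = x.
Proof.
move=> x1.
have y0 : 0 < x + Num.sqrt (x ^+ 2 - 1).
  by rewrite ltr_pwDl // ?sqrtr_ge0 // (lt_le_trans ltr01).
have sq : Num.sqrt (x ^+ 2 - 1) ^+ 2 = x ^+ 2 - 1.
  by rewrite sqr_sqrtr // subr_ge0 exprn_ege1.
rewrite /cosh /arcosh expRN lnK ?posrE //.
have -> : (x + Num.sqrt (x ^+ 2 - 1))^-1 = x - Num.sqrt (x ^+ 2 - 1).
  apply: (mulfI (lt0r_neq0 y0)); rewrite divff ?lt0r_neq0 //.
  by rewrite mulrC -subr_sqr sq opprB addrC subrK.
by rewrite addrACA subrr addr0 -mulr2n -(mulr_natr x) mulfK // pnatr_eq0.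
Qed.

End HyperbolicFunctions.

Section ConformalStructures.
Context {R : realType} (N : nat).
(* [eta] is only ever used on edges; as a function of the unordered pair of
   vertices it is symmetric.  The weights in {0, 1} are booleans. *)
Variables (g : background) (F : {set {set 'I_N}}).
Variables (eps : 'I_N -> bool) (eta : {set 'I_N} -> R).
Implicit Types (f u : 'cV[R]_N) (i j k : 'I_N).

Definition structure_condition : Prop :=
  (forall p q : 'I_N, [set p; q]%SET \in edges F ->
     0 < (eps p)%:R * (eps q)%:R + eta [set p; q]%SET) /\
  (forall p q r : 'I_N, [set p; q; r]%SET \in F ->
     0 <= (eps p)%:R * eta [set q; r]%SET
          + eta [set p; q]%SET * eta [set p; r]%SET).

Definition edge_length f i j : R :=
  let e_ k := (eps k)%:R * expR (2 * f k 0) in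
  let eta_ij := eta [set i; j]%SET * expR (f i 0 + f j 0) in
  match g with
  | Euclidean => Num.sqrt (e_ i + e_ j + 2 * eta_ij)
  | Hyperbolic => arcosh (Num.sqrt ((1 + e_ i) * (1 + e_ j)) + eta_ij)
  end.

Definition triangle_inequalities f : Prop :=
  forall i j k, [set i; j; k]%SET \in F ->
    edge_length f i j < edge_length f i k + edge_length f k j.

Definition u_of_f f : 'cV[R]_N := \col_i
  match g with
  | Hyperbolic =>
      if eps i then
        let c := Num.sqrt (1 + expR (2 * f i 0)) in
        2^-1 * ln `|(c - 1) / (c + 1)|
      else f i 0
  | Euclidean => f i 0
  end.

(* The inverse of [u_of_f] (see [u_of_fK]); in the hyperbolic case with weight 1
   it is meaningful only for [u i 0 < 0]. *)
Definition f_of_u u : 'cV[R]_N := \col_i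
  match g with
  | Hyperbolic =>
      if eps i then ln (2 * expR (u i 0) / (1 - expR (2 * u i 0))) else u i 0
  | Euclidean => u i 0
  end.

Lemma u_of_fK : cancel u_of_f f_of_u.
Proof.
move=> f; apply/colP => i; rewrite !mxE; case: g => //; case: (eps i) => //.
set c := Num.sqrt _.
have c2 : c ^+ 2 = 1 + expR (2 * f i 0).
  by rewrite sqr_sqrtr // addr_ge0 // expR_ge0.
have E2 : expR (2 * f i 0) = expR (f i 0) ^+ 2 by rewrite expr2 -expRD mulr2n mulrDl mul1r.
have c1 : 1 < c.
  by rewrite -[ltLHS]sqrtr1 ltr_sqrt // ?ltrDl ?expR_gt0 // addr_gt0 ?expR_gt0.
have cm : 0 < c - 1 by rewrite subr_gt0.
have cp : 0 < c + 1 by rewrite addr_gt0 // (lt_trans _ c1).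
have q0 : 0 < (c - 1) / (c + 1) by rewrite divr_gt0.
rewrite /= ger0_norm ?ltW //.
set v := 2^-1 * _.
have v2 : expR (2 * v) = (c - 1) / (c + 1).
  by rewrite /v mulrA divff ?pnatr_eq0 // mul1r lnK.
have vE : expR v = expR (f i 0) / (c + 1).
  have p0 : 0 <= expR (f i 0) / (c + 1) by rewrite divr_ge0 ?expR_ge0 ?ltW.
  have sE : expR v ^+ 2 = (expR (f i 0) / (c + 1)) ^+ 2.
    rewrite expr_div_n -E2 expr2 -expRD -mulr2n -(mulr_natl v) v2.
    have -> : expR (2 * f i 0) = (c - 1) * (c + 1).
      by rewrite -subr_sqr c2 expr1n [1 + _]addrC addrK.
    by rewrite expr2 invfM mulrA mulfK // lt0r_neq0.
  by apply/eqP; rewrite -(eqrXn2 (isT : (0 < 2)%N)) ?expR_ge0 // sE eqxx.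
rewrite vE v2 -[RHS]expRK; congr ln.
by field; rewrite (lt0r_neq0 cp) /= opprB addrC addrA subrK -mulr2n pnatr_eq0.
Qed.

Definition nondegenerate_structure u : Prop :=
  exists f, u = u_of_f f /\ triangle_inequalities f.

(* Cosine law: the angle between the sides [a] and [b], opposite to [c]. *)
Definition angle (a b c : R) : R :=
  match g with
  | Euclidean => acos ((a ^+ 2 + b ^+ 2 - c ^+ 2) / (2 * a * b))
  | Hyperbolic => acos ((cosh a * cosh b - cosh c) / (sinh a * sinh b))
  end.

Definition inner_angle u i j k : R :=
  let l := edge_length (f_of_u u) in angle (l i j) (l i k) (l j k).

(* The condition [j < k] counts each face at [i] once. *)
Definition curvature u : 'cV[R]_N := \col_i
  (2 * pi - \sum_(j < N) \sum_(k < N | (j < k)%N && ([set i; j; k]%SET \in F))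
              inner_angle u i j k).

Definition laplacian u : 'M[R]_N :=
  \matrix_(i, j) 'D_(delta_mx j 0) (fun v => curvature v i 0) u.

End ConformalStructures.

Section FractionalPower.
Context {R : realType} (N : nat).
Implicit Types (A B P : 'M[R]_N) (lam : 'rV[R]_N) (s : R).

(* In the library 0 `^ 0 = 1, whereas here 0 to any power is 0. *)
Definition pow0 s (x : R) : R := if x == 0 then 0 else x `^ s.

Definition is_frac_pow s A B : Prop :=
  exists P lam, [/\ P *m P^T = 1%:M, forall i, 0 <= lam 0 i,
    A = P^T *m diag_mx lam *m P &
    B = P^T *m diag_mx (map_mx (pow0 s) lam) *m P].

Lemma is_frac_pow_uniq s A B B' :
  is_frac_pow s A B -> is_frac_pow s A B' -> B = B'.
Proof.
move=> [P [a [PP _ AP ->]]] [Q [b [QQ _ AQ ->]]].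
have PP' := mulmx1C PP; have QQ' := mulmx1C QQ.
pose S := P *m Q^T.
have DS : diag_mx a *m S = S *m diag_mx b.
  have : P *m A *m Q^T = P *m A *m Q^T by [].
  rewrite {1}AP AQ !mulmxA PP mul1mx -!mulmxA QQ mulmx1.
  by rewrite /S !mulmxA.
have DS' : diag_mx (map_mx (pow0 s) a) *m S = S *m diag_mx (map_mx (pow0 s) b).
  apply/matrixP => i j; move/matrixP/(_ i j): DS.
  rewrite !mul_diag_mx !mul_mx_diag !mxE => E.
  have [->|S0] := eqVneq (\sum_j0 P i j0 * Q^T j0 j) 0; first by rewrite mulr0 mul0r.
  by rewrite mulrC; congr (_ * pow0 s _); apply: (mulfI S0); rewrite -E mulrC.
have QS : Q = S^T *m P by rewrite /S trmx_mul trmxK -mulmxA PP' mulmx1.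
have SS : S *m S^T = 1%:M.
  by rewrite /S trmx_mul trmxK mulmxA -(mulmxA P) QQ' mulmx1 PP.
clearbody S; rewrite QS trmx_mul trmxK !mulmxA -(mulmxA P^T S) -DS' !mulmxA.
by rewrite -(mulmxA _ S) SS mulmx1.
Qed.

(* The value is 0 if [A] is not symmetric positive semi-definite. *)
Definition frac_pow s A : 'M[R]_N := xget 0 [set B | is_frac_pow s A B].

Definition l2norm (v : 'cV[R]_N) : R := Num.sqrt (\sum_i v i 0 ^+ 2).

End FractionalPower.

Definition frac_laplacian {R : realType} (N : nat) (g : background)
    (F : {set {set 'I_N}}) (eps : 'I_N -> bool) (eta : {set 'I_N} -> R)
    (s : R) (u : 'cV[R]_N) : 'M[R]_N :=
  - frac_pow s (laplacian g F eps eta u).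

(* Solutions on an interval [J]; derivatives are relative to [J], hence
   one-sided at an end point of [J]. *)
Definition calabi_flow_on {R : realType} (N : nat) (g : background)
    (F : {set {set 'I_N}}) (eps : 'I_N -> bool) (eta : {set 'I_N} -> R)
    (s : R) (Kbar : 'cV[R]_N) (J : set R) (u : R -> 'cV[R]_N) : Prop :=
  forall t, J t -> nondegenerate_structure g F eps eta (u t) /\
    forall i : 'I_N,
      (fun r => (u r i 0 - u t i 0) / (r - t)) @ within J t^' -->
      (frac_laplacian g F eps eta s (u t)
         *m (curvature g F eps eta (u t) - Kbar)) i 0.

(* Main.v *)
(* Diagonalizing symmetric matrices, taking fractional powers is Lipschitz on the
   symmetric matrices with a fixed kernel and a uniform spectral gap on its
   complement, so the flow is given by a locally Lipschitz vector field near the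
   equilibrium.  This rests on explicit formulas for the derivatives of the angles
   of a face: they give a symmetric bilinear form per face which, under the
   structure condition, is negative definite (hyperbolic case) or negative
   semi-definite with only the constants in its kernel (Euclidean case).  At every
   nondegenerate u the kernel of the Laplacian L is therefore 0, respectively, since
   the surface is connected, the constants.  Near the equilibrium K(u) - K(ubar) = L(ubar) w +
   O(|w|^2) with w = u - ubar, so |w|^2 / 2 decreases along the flow at a rate at
   least w^T L^(s+1) w - O(|w|^3) >= c |w|^2, which gives global existence and
   exponential convergence. *)
Require Import Defs.
From mathcomp Require Import all_boot all_order all_algebra.
From mathcomp Require Import complex.
From mathcomp Require Import all_classical all_reals all_analysis.
From mathcomp Require Import ring lra.
Import Order.TTheory GRing.Theory Num.Theory.
Import numFieldNormedType.Exports.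
Set Implicit Arguments.
Unset Strict Implicit.
Unset Printing Implicit Defensive.
Local Open Scope ring_scope.
Local Open Scope classical_set_scope.

(** * Quadratic forms attached to a weighted triangle *)

(** The obstacle is the definiteness of the form of one face: the coefficient of an edge has the
    sign of the height on that edge, and a height is negative when the geometric center lies beyond
    the edge. Sylvester's criterion is checked by hand. The determinant factors as the Jacobian of
    the angles by the lengths times that of the lengths by the coordinates, hence is a square times
    a polynomial that the structure condition makes positive. The structure condition also allows at
    most one negative height, so the 1x1 minor is taken at a vertex whose two edges have nonnegative
    heights. The remaining 2x2 minor has no visible sign when the third height is negative; it is
    reached by a deformation along which it cannot vanish. For s <= 0 the map x -> x^s with 0^s = 0
    is not continuous at 0, so the estimates depend on the kernel of the Laplacian being the same at
    all nearby u. The field is controlled only in a small ball around the equilibrium; it is cut off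
    outside, and the energy shows that the solution never meets the cutoff. *)

(* Throughout, e_p is the weight of vertex p, n_p that of the edge opposite to p, and
   k_p = sqrt (e_p + e^(-2 f_p)) in the hyperbolic case, e^(-f_p) in the Euclidean case.
   The height of p is a multiple of the signed distance from the edge
   opposite to p to the geometric center of the triangle. *)
Definition height (R : comNzRingType) (e1 e2 e3 n1 n2 n3 k1 k2 k3 : R) : R :=
  (e2 * e3 - n1 ^+ 2) * k1 + (e3 * n3 + n1 * n2) * k2 + (e2 * n2 + n1 * n3) * k3.

Record triangle_weights (R : rcfType) (e1 e2 e3 n1 n2 n3 : R) : Prop := {
  tw_e1 : e1 = 0 \/ e1 = 1; tw_e2 : e2 = 0 \/ e2 = 1; tw_e3 : e3 = 0 \/ e3 = 1;
  tw_n1 : 0 < e2 * e3 + n1; tw_n2 : 0 < e3 * e1 + n2; tw_n3 : 0 < e1 * e2 + n3;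
  tw_g1 : 0 <= e1 * n1 + n2 * n3; tw_g2 : 0 <= e2 * n2 + n1 * n3;
  tw_g3 : 0 <= e3 * n3 + n1 * n2 }.

Section Algebra.
Variable R : rcfType.

Lemma triangle_weights_rot (e1 e2 e3 n1 n2 n3 : R) :
  triangle_weights e1 e2 e3 n1 n2 n3 -> triangle_weights e2 e3 e1 n2 n3 n1.
Proof. by case=> *; split=> //; lra. Qed.

Lemma triangle_weights_swap (e1 e2 e3 n1 n2 n3 : R) :
  triangle_weights e1 e2 e3 n1 n2 n3 -> triangle_weights e2 e1 e3 n2 n1 n3.
Proof. by case=> *; split=> //; lra. Qed.

Lemma sum_gt0_sqr_gt0 (a b n : R) : a = 0 \/ a = 1 -> b = 0 \/ b = 1 ->
  0 < a * b + n -> 0 < n ^+ 2 - a * b -> 0 < n.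
Proof.
move=> [] -> [] ->; rewrite ?(mul0r, mulr0, mul1r) ?add0r ?subr0 // => h1 h2.
rewrite ltNge; apply/negP => n0; suff : n ^+ 2 <= 1 by lra.
by rewrite expr2; nra.
Qed.

(** With q2 = n2^2 - e3 e1 and q3 = n3^2 - e1 e2, the two sign conditions multiply to g1^2 < q2 q3.
    But g1^2 - q2 q3 = - e1 det A, where A is symmetric with diagonal entries e and off-diagonal
    entries - n. Once n2, n3 > 0 the structure condition makes this nonnegative. *)
Lemma two_heights_le0 (e1 e2 e3 n1 n2 n3 k1 k2 k3 : R) :
  triangle_weights e1 e2 e3 n1 n2 n3 -> 0 < k1 -> 0 < k2 -> 0 < k3 ->
  0 < n3 ^+ 2 - e1 * e2 ->
  height e2 e3 e1 n2 n3 n1 k2 k3 k1 < 0 ->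
  height e3 e1 e2 n3 n1 n2 k3 k1 k2 <= 0 -> False.
Proof.
case=> H1 H2 H3 N1 N2 N3 G1 G2 G3 k1p k2p k3p q3 h2 h3.
set g1 := e1 * n1 + n2 * n3; set g2 := e2 * n2 + n1 * n3.
set g3 := e3 * n3 + n1 * n2.
have a1 : g1 * k3 < (n2 ^+ 2 - e3 * e1) * k2.
  have : 0 <= g3 * k1 by rewrite mulr_ge0 // ltW.
  by move: h2; rewrite /height /g1 /g3; lra.
have a2 : g1 * k2 <= (n3 ^+ 2 - e1 * e2) * k3.
  have : 0 <= g2 * k1 by rewrite mulr_ge0 // ltW.
  by move: h3; rewrite /height /g1 /g2; lra.
have q2 : 0 < n2 ^+ 2 - e3 * e1.
  rewrite -(pmulr_lgt0 _ k2p); apply: le_lt_trans a1.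
  by rewrite mulr_ge0 // ltW.
have n2p : 0 < n2 by apply: sum_gt0_sqr_gt0 q2.
have n3p : 0 < n3 by apply: sum_gt0_sqr_gt0 q3.
have lt : g1 ^+ 2 < (n2 ^+ 2 - e3 * e1) * (n3 ^+ 2 - e1 * e2).
  rewrite -(ltr_pM2r (mulr_gt0 k2p k3p)).
  apply: (@le_lt_trans _ _ (g1 * k3 * ((n3 ^+ 2 - e1 * e2) * k3))).
    have -> : g1 ^+ 2 * (k2 * k3) = g1 * k3 * (g1 * k2) by ring.
    by rewrite ler_wpM2l // mulr_ge0 // ltW.
  have -> : (n2 ^+ 2 - e3 * e1) * (n3 ^+ 2 - e1 * e2) * (k2 * k3) =
    (n2 ^+ 2 - e3 * e1) * k2 * ((n3 ^+ 2 - e1 * e2) * k3) by ring.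
  by rewrite ltr_pM2r // mulr_gt0.
suff : 0 <= g1 ^+ 2 - (n2 ^+ 2 - e3 * e1) * (n3 ^+ 2 - e1 * e2) by lra.
rewrite /g1; case: H1 q2 q3 N2 N3 => -> q2 q3 N2 N3.
  by have -> : (0 * n1 + n2 * n3) ^+ 2 - (n2 ^+ 2 - e3 * 0) * (n3 ^+ 2 - 0 * e2) = 0 by ring.
have n23 : 0 < n2 * n3 by rewrite mulr_gt0.
case: H2 N1 q3 N3 => -> N1 q3 N3; case: H3 N1 q2 N2 => -> N1 q2 N2; last first.
  have n1' : 0 < n1 + 1 by lra.
  have n2' : 1 < n2 by rewrite ltNge; apply/negP => ?; nra.
  have n3' : 1 < n3 by rewrite ltNge; apply/negP => ?; nra.
  have n23' : 1 < n2 * n3 by nra.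
  have -> : (1 * n1 + n2 * n3) ^+ 2 - (n2 ^+ 2 - 1 * 1) * (n3 ^+ 2 - 1 * 1) =
     (n1 + 1) * (n1 - 1 + 2 * (n2 * n3)) + (n2 - n3) ^+ 2 by ring.
  by rewrite addr_ge0 ?sqr_ge0 // mulr_ge0 ?ltW //; lra.
all: have n1p : 0 < n1 by lra.
all: have n12 : 0 < n1 * n2 * n3 by rewrite !mulr_gt0.
all: have n11 : 0 <= n1 ^+ 2 by rewrite sqr_ge0.
all: have n22 : 0 <= n2 ^+ 2 by rewrite sqr_ge0.
all: have n33 : 0 <= n3 ^+ 2 by rewrite sqr_ge0.
all: by lra.
Qed.

(** Determinant of a zero-diagonal 3x3 matrix, the rescaled derivatives of the sides by the
    coordinates: [e1 * k2 + n3 * k1] is proportional to the hyperbolic [dside] of edge 12 at vertex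
    1. *)
Definition link_prod (e1 e2 e3 n1 n2 n3 k1 k2 k3 : R) : R :=
  (e1 * k2 + n3 * k1) * (e2 * k3 + n1 * k2) * (e3 * k1 + n2 * k3) +
  (e2 * k1 + n3 * k2) * (e3 * k2 + n1 * k3) * (e1 * k3 + n2 * k1).

(** If at most one vertex weight is 1, all edge weights are positive and so is every term. Otherwise
    an edge weight may lie in ]-1, 0], and the sum is regrouped into factors 1 + n, squares of
    differences of the k, and the nonnegative combinations of the structure condition. *)
Lemma link_prod_gt0 (e1 e2 e3 n1 n2 n3 k1 k2 k3 : R) :
  triangle_weights e1 e2 e3 n1 n2 n3 -> 0 < k1 -> 0 < k2 -> 0 < k3 ->
  0 < link_prod e1 e2 e3 n1 n2 n3 k1 k2 k3.
Proof.
case=> H1 H2 H3 N1 N2 N3 G1 G2 G3 k1p k2p k3p; rewrite /link_prod.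
case: H1 N2 N3 G1 => -> N2 N3 G1; case: H2 N1 N3 G2 => -> N1 N3 G2;
  case: H3 N1 N2 G3 => -> N1 N2 G3;
  rewrite ?(mul0r, mul1r, add0r) in N1 N2 N3 G1 G2 G3 *.
- by do ![apply: addr_gt0|apply: mulr_gt0|by []].
- by do ![apply: addr_gt0|apply: mulr_gt0|by []].
- by do ![apply: addr_gt0|apply: mulr_gt0|by []].
- have -> : n3 * k1 * (k3 + n1 * k2) * (k1 + n2 * k3) +
      (k1 + n3 * k2) * (k2 + n1 * k3) * (n2 * k1) =
    (n2 + n1 * n3) * k1 ^+ 2 * k2 + (n3 + n1 * n2) * k1 ^+ 2 * k3 +
    n2 * n3 * k1 * (2 * (n1 + 1) * k2 * k3 + (k2 - k3) ^+ 2) by ring.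
  rewrite ltr_wpDl //.
    by rewrite addr_ge0 // !mulr_ge0 // ?sqr_ge0 // ltW.
  have n23 : 0 < n2 * n3 * k1 by rewrite !mulr_gt0.
  by rewrite pmulr_rgt0 // ltr_pwDl ?sqr_ge0 // !mulr_gt0 //; lra.
- by do ![apply: addr_gt0|apply: mulr_gt0|by []].
- have -> : (k2 + n3 * k1) * (n1 * k2) * (k1 + n2 * k3) +
      n3 * k2 * (k2 + n1 * k3) * (k3 + n2 * k1) =
    (n1 + n2 * n3) * k2 ^+ 2 * k1 + (n3 + n1 * n2) * k2 ^+ 2 * k3 +
    n1 * n3 * k2 * (2 * (n2 + 1) * k1 * k3 + (k1 - k3) ^+ 2) by ring.
  rewrite ltr_wpDl //.
    by rewrite addr_ge0 // !mulr_ge0 // ?sqr_ge0 // ltW.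
  have n23 : 0 < n1 * n3 * k2 by rewrite !mulr_gt0.
  by rewrite pmulr_rgt0 // ltr_pwDl ?sqr_ge0 // !mulr_gt0 //; lra.
- have -> : (k2 + n3 * k1) * (k3 + n1 * k2) * (n2 * k3) +
      (k1 + n3 * k2) * (n1 * k3) * (k3 + n2 * k1) =
    (n1 + n2 * n3) * k3 ^+ 2 * k1 + (n2 + n1 * n3) * k3 ^+ 2 * k2 +
    n1 * n2 * k3 * (2 * (n3 + 1) * k1 * k2 + (k1 - k2) ^+ 2) by ring.
  rewrite ltr_wpDl //.
    by rewrite addr_ge0 // !mulr_ge0 // ?sqr_ge0 // ltW.
  have n23 : 0 < n1 * n2 * k3 by rewrite !mulr_gt0.
  by rewrite pmulr_rgt0 // ltr_pwDl ?sqr_ge0 // !mulr_gt0 //; lra.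
- have -> : (k2 + n3 * k1) * (k3 + n1 * k2) * (k1 + n2 * k3) +
      (k1 + n3 * k2) * (k2 + n1 * k3) * (k3 + n2 * k1) =
    2 * (1 + n1) * (1 + n2) * (1 + n3) * k1 * k2 * k3 +
    ((n1 + n2 * n3) * k1 * (k2 - k3) ^+ 2 + (n2 + n1 * n3) * k2 * (k1 - k3) ^+ 2
     + (n3 + n1 * n2) * k3 * (k1 - k2) ^+ 2) by ring.
  rewrite ltr_pwDl //; first by rewrite !mulr_gt0.
  by apply: addr_ge0; [apply: addr_ge0|]; rewrite mulr_ge0 ?sqr_ge0 // mulr_ge0 // ltW.
Qed.

End Algebra.

(** Sylvester's criterion, with the principal minors in the order z, then x and z, then all; the
    squares are completed after multiplication by [c * m]. *)
Lemma ternary_form_gt0 (R : rcfType) (a b c d e f x y z : R) :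
  0 < c -> 0 < c * a - e ^+ 2 ->
  0 < a * b * c + 2 * d * e * f - a * f ^+ 2 - b * e ^+ 2 - c * d ^+ 2 ->
  (x != 0) || (y != 0) || (z != 0) ->
  0 < a * x ^+ 2 + b * y ^+ 2 + c * z ^+ 2
      + 2 * (d * x * y + e * x * z + f * y * z).
Proof.
move=> c0; set m := c * a - _ => m0; set D := (X in 0 < X -> _) => D0 xyz.
have cm0 : 0 < c * m by rewrite mulr_gt0.
rewrite -(pmulr_rgt0 _ cm0).
have -> : c * m * (a * x ^+ 2 + b * y ^+ 2 + c * z ^+ 2
      + 2 * (d * x * y + e * x * z + f * y * z)) =
   m * (c * z + e * x + f * y) ^+ 2 + (m * x + (c * d - e * f) * y) ^+ 2
   + c * D * y ^+ 2 by rewrite /m /D; ring.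
have t1 : 0 <= m * (c * z + e * x + f * y) ^+ 2 by rewrite mulr_ge0 ?sqr_ge0 ?ltW.
have t2 : 0 <= (m * x + (c * d - e * f) * y) ^+ 2 by rewrite sqr_ge0.
have cD : 0 < c * D by rewrite mulr_gt0.
have [y0|y0] := eqVneq y 0; last first.
  by apply: ltr_wpDl; [exact: addr_ge0|rewrite mulr_gt0 // exprn_even_gt0].
rewrite y0 !mulr0 !addr0 expr0n /= mulr0 addr0 {t1 t2}.
have [x0|x0] := eqVneq x 0; last first.
  apply: ltr_wpDl; first by rewrite mulr_ge0 ?sqr_ge0 ?ltW.
  by rewrite exprn_even_gt0 //= mulf_neq0 // lt0r_neq0.
have z0 : z != 0 by move: xyz; rewrite x0 y0 eqxx.
rewrite x0 !mulr0 addr0 expr0n addr0 mulr_gt0 // exprn_even_gt0 //=.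
by rewrite mulf_neq0 // lt0r_neq0.
Qed.

(* Factorization behind [form_det]: the matrix x is a product of two 3x3 matrices
   with unit diagonal and zero diagonal respectively. *)
Lemma det3_link (R : rcfType) (a12 a13 a21 a23 a31 a32 b12 b13 b21 b23 b31 b32 : R) :
  let x11 := a12 * b21 + a13 * b31 in
  let x12 := b12 + a13 * b32 in
  let x13 := b13 + a12 * b23 in
  let x21 := b21 + a23 * b31 in
  let x22 := a21 * b12 + a23 * b32 in
  let x23 := b23 + a21 * b13 in
  let x31 := b31 + a32 * b21 in
  let x32 := b32 + a31 * b12 in
  let x33 := a31 * b13 + a32 * b23 in
  x11 * x22 * x33 + x12 * x23 * x31 + x13 * x21 * x32
  - x13 * x22 * x31 - x12 * x21 * x33 - x11 * x23 * x32 =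
  (1 + a12 * a23 * a31 + a13 * a21 * a32 - a13 * a31 - a12 * a21 - a23 * a32) *
  (b12 * b23 * b31 + b13 * b21 * b32).
Proof. by rewrite /=; ring. Qed.

Definition minor_poly (R : comNzRingType) (r1 r2 r3 p1 p2 p3 h1 h2 h3 : R) : R :=
  (p1 ^+ 2 - r2 * r3) * (p3 ^+ 2 - r1 * r2) * h2 ^+ 2
  + (p3 ^+ 2 - r1 * r2) * p1 * p2 * h1 * h2
  + (p1 ^+ 2 - r2 * r3) * p2 * p3 * h2 * h3
  + (p2 ^+ 2 - r3 * r1) * p1 * p3 * h1 * h3.

(** The principal minor of [hyp_form] at vertices 1 and 3, cleared of denominators (see
    [form_minorE]). As a polynomial expression over any commutative ring it can also be evaluated at
    polynomials, as the intermediate value argument below requires. *)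
Definition form_minor (R : comNzRingType) (e1 e2 e3 n1 n2 n3 k1 k2 k3 : R) : R :=
  minor_poly (k1 ^+ 2 - e1) (k2 ^+ 2 - e2) (k3 ^+ 2 - e3)
    (k2 * k3 + n1) (k3 * k1 + n2) (k1 * k2 + n3)
    (height e1 e2 e3 n1 n2 n3 k1 k2 k3) (height e2 e3 e1 n2 n3 n1 k2 k3 k1)
    (height e3 e1 e2 n3 n1 n2 k3 k1 k2).

(** * Determinant and 2x2 minor of the hyperbolic form *)

Section HyperbolicTriangle.
Variables (R : rcfType) (e1 e2 e3 n1 n2 n3 k1 k2 k3 : R).

Local Notation r1 := (k1 ^+ 2 - e1).
Local Notation r2 := (k2 ^+ 2 - e2).
Local Notation r3 := (k3 ^+ 2 - e3).
Local Notation p1 := (k2 * k3 + n1).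
Local Notation p2 := (k3 * k1 + n2).
Local Notation p3 := (k1 * k2 + n3).
Local Notation s1 := (p1 ^+ 2 - r2 * r3).
Local Notation s2 := (p2 ^+ 2 - r3 * r1).
Local Notation s3 := (p3 ^+ 2 - r1 * r2).
Local Notation h1 := (height e1 e2 e3 n1 n2 n3 k1 k2 k3).
Local Notation h2 := (height e2 e3 e1 n2 n3 n1 k2 k3 k1).
Local Notation h3 := (height e3 e1 e2 n3 n1 n2 k3 k1 k2).

(* Positive exactly when the three lengths bound a triangle. *)
Definition gram_det : R :=
  r1 * r2 * r3 + 2 * (p1 * p2 * p3) - r1 * p1 ^+ 2 - r2 * p2 ^+ 2 - r3 * p3 ^+ 2.

Hypotheses (r1_neq0 : r1 != 0) (r2_neq0 : r2 != 0) (r3_neq0 : r3 != 0).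
Hypotheses (s1_neq0 : s1 != 0) (s2_neq0 : s2 != 0) (s3_neq0 : s3 != 0).
Let w1 := h1 / s1.
Let w2 := h2 / s2.
Let w3 := h3 / s3.

Lemma form_det :
  r1 * r2 * r3 * (s1 * s2 * s3) *
  ((w2 * p2 + w3 * p3) / r1 * ((w3 * p3 + w1 * p1) / r2) * ((w1 * p1 + w2 * p2) / r3)
   + 2 * - w3 * - w2 * - w1 - (w2 * p2 + w3 * p3) / r1 * (- w1) ^+ 2
   - (w3 * p3 + w1 * p1) / r2 * (- w2) ^+ 2 - (w1 * p1 + w2 * p2) / r3 * (- w3) ^+ 2) =
  gram_det ^+ 2 * link_prod e1 e2 e3 n1 n2 n3 k1 k2 k3.
Proof.
(* Up to scaling, [m1], [m2], [m3] are the cosines of the angles and the [d12], ... the derivatives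
   of the sides. The matrices multiplied in [E] are thus the Jacobians of the angles by the lengths
   and of the lengths by the coordinates. *)
pose m1 := p2 * p3 - r1 * p1; pose m2 := p3 * p1 - r2 * p2; pose m3 := p1 * p2 - r3 * p3.
pose d12 := e1 * k2 + n3 * k1; pose d21 := e2 * k1 + n3 * k2.
pose d23 := e2 * k3 + n1 * k2; pose d32 := e3 * k2 + n1 * k3.
pose d31 := e3 * k1 + n2 * k3; pose d13 := e1 * k3 + n2 * k1.
have E := det3_link (- m3 / s2) (- m2 / s3) (- m3 / s1) (- m1 / s3) (- m2 / s1) (- m1 / s2)
  d23 d32 d13 d31 d12 d21.
rewrite /= in E.
(* The twelve identities that follow evaluate the entries of the product. On the diagonal the
   differences such as [k3 * p3 - k2 * p2] cancel between the two terms. *)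
have c12 : m2 * d12 = p3 * h3 + s3 * (k3 * p3 - k2 * p2) by rewrite /m2 /d12 /height; ring.
have c13 : m3 * d13 = p2 * h2 + s2 * (k2 * p2 - k3 * p3) by rewrite /m3 /d13 /height; ring.
have c23 : m3 * d23 = p1 * h1 + s1 * (k1 * p1 - k3 * p3) by rewrite /m3 /d23 /height; ring.
have c21 : m1 * d21 = p3 * h3 + s3 * (k3 * p3 - k1 * p1) by rewrite /m1 /d21 /height; ring.
have c31 : m1 * d31 = p2 * h2 + s2 * (k2 * p2 - k1 * p1) by rewrite /m1 /d31 /height; ring.
have c32 : m2 * d32 = p1 * h1 + s1 * (k1 * p1 - k2 * p2) by rewrite /m2 /d32 /height; ring.
have b12 : m2 * d21 = s3 * d23 - r2 * h3 by rewrite /m2 /d21 /d23 /height; ring.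
have b13 : m3 * d31 = s2 * d32 - r3 * h2 by rewrite /m3 /d31 /d32 /height; ring.
have b21 : m1 * d12 = s3 * d13 - r1 * h3 by rewrite /m1 /d12 /d13 /height; ring.
have b23 : m3 * d32 = s1 * d31 - r3 * h1 by rewrite /m3 /d32 /d31 /height; ring.
have b31 : m1 * d13 = s2 * d12 - r1 * h2 by rewrite /m1 /d13 /d12 /height; ring.
have b32 : m2 * d23 = s1 * d21 - r2 * h1 by rewrite /m2 /d23 /d21 /height; ring.
(* The Gram determinant of the angles in terms of that of the lengths. *)
have detM : s1 * s2 * s3 - 2 * (m1 * m2 * m3) - m1 ^+ 2 * s1 - m2 ^+ 2 * s2 - m3 ^+ 2 * s3
  = - gram_det ^+ 2 by rewrite /gram_det /m1 /m2 /m3; ring.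
rewrite /link_prod -/d12 -/d21 -/d23 -/d32 -/d31 -/d13.
move: E detM b12 b13 b21 b23 b31 b32 c12 c13 c23 c21 c31 c32.
rewrite /w1 /w2 /w3; move: r1_neq0 r2_neq0 r3_neq0 s1_neq0 s2_neq0 s3_neq0.
clearbody m1 m2 m3 d12 d21 d23 d32 d31 d13; clear w1 w2 w3.
move: h1 h2 h3 gram_det p1 p2 p3 r1 r2 r3 s1 s2 s3.
move=> H1 H2 H3 Q P1 P2 P3 R1 R2 R3 S1 S2 S3 nR1 nR2 nR3 nS1 nS2 nS3 E detM.
move=> b12 b13 b21 b23 b31 b32 c12 c13 c23 c21 c31 c32.
have x11 : - m3 / S2 * d13 + - m2 / S3 * d12 = - (H2 / S2 * P2 + H3 / S3 * P3).
  have -> : - m3 / S2 * d13 + - m2 / S3 * d12 = - ((m3 * d13) / S2 + (m2 * d12) / S3) by field; rewrite ?nS1 ?nS2 ?nS3.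
  by rewrite c13 c12; field; rewrite ?nS1 ?nS2 ?nS3.
have x22 : - m3 / S1 * d23 + - m1 / S3 * d21 = - (H3 / S3 * P3 + H1 / S1 * P1).
  have -> : - m3 / S1 * d23 + - m1 / S3 * d21 = - ((m3 * d23) / S1 + (m1 * d21) / S3) by field; rewrite ?nS1 ?nS2 ?nS3.
  by rewrite c23 c21; field; rewrite ?nS1 ?nS2 ?nS3.
have x33 : - m2 / S1 * d32 + - m1 / S2 * d31 = - (H1 / S1 * P1 + H2 / S2 * P2).
  have -> : - m2 / S1 * d32 + - m1 / S2 * d31 = - ((m2 * d32) / S1 + (m1 * d31) / S2) by field; rewrite ?nS1 ?nS2 ?nS3.
  by rewrite c32 c31; field; rewrite ?nS1 ?nS2 ?nS3.
have x12 : d23 + - m2 / S3 * d21 = R2 * (H3 / S3).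
  by have -> : - m2 / S3 * d21 = - ((m2 * d21) / S3); [field | rewrite b12; field].
have x13 : d32 + - m3 / S2 * d31 = R3 * (H2 / S2).
  by have -> : - m3 / S2 * d31 = - ((m3 * d31) / S2); [field | rewrite b13; field].
have x21 : d13 + - m1 / S3 * d12 = R1 * (H3 / S3).
  by have -> : - m1 / S3 * d12 = - ((m1 * d12) / S3); [field | rewrite b21; field].
have x23 : d31 + - m3 / S1 * d32 = R3 * (H1 / S1).
  by have -> : - m3 / S1 * d32 = - ((m3 * d32) / S1); [field | rewrite b23; field].
have x31 : d12 + - m1 / S2 * d13 = R1 * (H2 / S2).
  by have -> : - m1 / S2 * d13 = - ((m1 * d13) / S2); [field | rewrite b31; field].
have x32 : d21 + - m2 / S1 * d23 = R2 * (H1 / S1).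
  by have -> : - m2 / S1 * d23 = - ((m2 * d23) / S1); [field | rewrite b32; field].
rewrite x11 x22 x33 x12 x13 x21 x23 x31 x32 in E.
have detM' : (1 + - m3 / S2 * (- m1 / S3) * (- m2 / S1) + - m2 / S3 * (- m3 / S1) * (- m1 / S2) -
   - m2 / S3 * (- m2 / S1) - - m3 / S2 * (- m3 / S1) - - m1 / S3 * (- m1 / S2))
  = - Q ^+ 2 / (S1 * S2 * S3) by rewrite -detM; field; rewrite ?nS1 ?nS2 ?nS3.
rewrite detM' in E.
have -> : d12 * d23 * d31 + d21 * d32 * d13 = d23 * d31 * d12 + d32 * d13 * d21 by ring.
have -> : Q ^+ 2 * (d23 * d31 * d12 + d32 * d13 * d21) = - (S1 * S2 * S3) *
   (- Q ^+ 2 / (S1 * S2 * S3) * (d23 * d31 * d12 + d32 * d13 * d21)) by field; rewrite ?nS1 ?nS2 ?nS3.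
by rewrite -E; field; rewrite nR1 nR2 nR3 ?nS1 ?nS2 ?nS3.
Qed.

Lemma form_minorE :
  s1 * s2 * s3 * ((w1 * p1 + w2 * p2) * (w2 * p2 + w3 * p3) - r1 * r3 * w2 ^+ 2) =
  form_minor e1 e2 e3 n1 n2 n3 k1 k2 k3.
Proof.
rewrite /form_minor /minor_poly /w1 /w2 /w3.
have -> : r1 * r3 = p2 ^+ 2 - s2 by ring.
move: s1_neq0 s2_neq0 s3_neq0; move: h1 h2 h3 p1 p2 p3 s1 s2 s3.
move=> H1 H2 H3 P1 P2 P3 S1 S2 S3 nS1 nS2 nS3.
by field; rewrite nS1 nS2 nS3.
Qed.

End HyperbolicTriangle.

(** The two quantities are rescaled cosh and sinh^2 of an edge length. A nonpositive n forces a = b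
    = 1 and n > -1, and then k, l > 1. *)
Lemma edge_cosh_sinh_gt0 (R : rcfType) (a b n k l : R) :
  a = 0 \/ a = 1 -> b = 0 \/ b = 1 -> 0 < a * b + n ->
  0 < k -> 0 < l -> 0 < k ^+ 2 - a -> 0 < l ^+ 2 - b ->
  0 < k * l + n /\ 0 < (k * l + n) ^+ 2 - (k ^+ 2 - a) * (l ^+ 2 - b).
Proof.
move=> Ha Hb; rewrite !expr2 => H k0 l0 ka lb; have kl : 0 < k * l by rewrite mulr_gt0.
have [n0|n0] := ltP 0 n.
  split; first by rewrite addr_gt0.
  have -> : (k * l + n) * (k * l + n) - (k * k - a) * (l * l - b) =
    (2 * (k * l) * n) + (b * (k * k - a) + a * (l * l)) + n * n by ring.
  have nn : 0 < n * n by rewrite mulr_gt0.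
  have kln : 0 < 2 * (k * l) * n by rewrite !mulr_gt0.
  by case: Ha ka H => -> ka H; case: Hb lb H => -> lb H; nra.
case: Ha ka H => -> ka H; case: Hb lb H => -> lb H; rewrite ?(mul0r, mulr0, mul1r) in H *; try lra.
have k1 : 1 < k by nra.
have l1 : 1 < l by nra.
have kl1 : 1 < k * l by nra.
split; first lra.
have -> : (k * l + n) * (k * l + n) - (k * k - 1) * (l * l - 1) =
  (1 + n) * (2 * (k * l) + n - 1) + (k - l) ^+ 2 by ring.
by rewrite ltr_pwDl ?sqr_ge0 // mulr_gt0 //; lra.
Qed.

(** Up to a positive factor, the derivative of the angle at vertex 2 in the direction of vertex 3
    (see [face_off_diag]). *)
Definition edge_weight (R : rcfType) (e1 e2 e3 n1 n2 n3 k1 k2 k3 : R) : R :=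
  height e1 e2 e3 n1 n2 n3 k1 k2 k3 /
  ((k2 * k3 + n1) ^+ 2 - (k2 ^+ 2 - e2) * (k3 ^+ 2 - e3)).

Definition edge_form (R : rcfType) (e2 e3 n1 k2 k3 y z : R) : R :=
  (k2 * k3 + n1) * (y ^+ 2 / (k2 ^+ 2 - e2) + z ^+ 2 / (k3 ^+ 2 - e3)) - 2 * y * z.

Definition hyp_form (R : rcfType) (e1 e2 e3 n1 n2 n3 k1 k2 k3 x y z : R) : R :=
  edge_weight e1 e2 e3 n1 n2 n3 k1 k2 k3 * edge_form e2 e3 n1 k2 k3 y z +
  edge_weight e2 e3 e1 n2 n3 n1 k2 k3 k1 * edge_form e3 e1 n2 k3 k1 z x +
  edge_weight e3 e1 e2 n3 n1 n2 k3 k1 k2 * edge_form e1 e2 n3 k1 k2 x y.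

(** * Positivity of the hyperbolic form *)

Section Nondegenerate.
Variables (R : rcfType) (e1 e2 e3 n1 n2 n3 k1 k2 k3 : R).
Hypothesis W : triangle_weights e1 e2 e3 n1 n2 n3.
Hypotheses (k1_gt0 : 0 < k1) (k2_gt0 : 0 < k2) (k3_gt0 : 0 < k3).
Hypotheses (r1_gt0 : 0 < k1 ^+ 2 - e1) (r2_gt0 : 0 < k2 ^+ 2 - e2)
  (r3_gt0 : 0 < k3 ^+ 2 - e3).
Hypothesis q_gt0 : 0 < gram_det e1 e2 e3 n1 n2 n3 k1 k2 k3.
Let h1 := height e1 e2 e3 n1 n2 n3 k1 k2 k3.
Let h2 := height e2 e3 e1 n2 n3 n1 k2 k3 k1.
Hypotheses (h1_ge0 : 0 <= h1) (h2_ge0 : 0 <= h2).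
Let r1 := (k1 ^+ 2 - e1).
Let r2 := (k2 ^+ 2 - e2).
Let r3 := (k3 ^+ 2 - e3).
Let p1 := (k2 * k3 + n1).
Let p2 := (k3 * k1 + n2).
Let p3 := (k1 * k2 + n3).
Let s1 := (p1 ^+ 2 - r2 * r3).
Let s2 := (p2 ^+ 2 - r3 * r1).
Let s3 := (p3 ^+ 2 - r1 * r2).

Let ps1 : 0 < p1 /\ 0 < s1.
Proof. by case: W => *; apply: edge_cosh_sinh_gt0. Qed.
Let ps2 : 0 < p2 /\ 0 < s2.
Proof. by case: W => *; apply: edge_cosh_sinh_gt0. Qed.
Let ps3 : 0 < p3 /\ 0 < s3.
Proof. by case: W => *; apply: edge_cosh_sinh_gt0. Qed.

Let w1 := edge_weight e1 e2 e3 n1 n2 n3 k1 k2 k3.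
Let w2 := edge_weight e2 e3 e1 n2 n3 n1 k2 k3 k1.
Let w3 := edge_weight e3 e1 e2 n3 n1 n2 k3 k1 k2.

Let form_det_gt0 :
  0 < (w2 * p2 + w3 * p3) / r1 * ((w3 * p3 + w1 * p1) / r2) * ((w1 * p1 + w2 * p2) / r3)
   + 2 * - w3 * - w2 * - w1 - (w2 * p2 + w3 * p3) / r1 * (- w1) ^+ 2
   - (w3 * p3 + w1 * p1) / r2 * (- w2) ^+ 2 - (w1 * p1 + w2 * p2) / r3 * (- w3) ^+ 2.
Proof.
case: ps1 ps2 ps3 => P1 S1 [P2 S2] [P3 S3].
have rs : 0 < r1 * r2 * r3 * (s1 * s2 * s3) by rewrite !mulr_gt0.
rewrite -(pmulr_rgt0 _ rs).
rewrite [X in 0 < X](form_det (lt0r_neq0 r1_gt0) (lt0r_neq0 r2_gt0) (lt0r_neq0 r3_gt0)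
  (lt0r_neq0 S1) (lt0r_neq0 S2) (lt0r_neq0 S3)).
by rewrite mulr_gt0 ?exprn_gt0 // link_prod_gt0.
Qed.

Let minorE : s1 * s2 * s3 * ((w1 * p1 + w2 * p2) * (w2 * p2 + w3 * p3) - r1 * r3 * w2 ^+ 2) =
  form_minor e1 e2 e3 n1 n2 n3 k1 k2 k3.
Proof.
case: ps1 ps2 ps3 => P1 S1 [P2 S2] [P3 S3].
exact: form_minorE (lt0r_neq0 S1) (lt0r_neq0 S2) (lt0r_neq0 S3).
Qed.

(** Both terms are nonnegative, and if both vanished the determinant would vanish too. *)
Lemma form_corner_gt0 : 0 < w1 * p1 + w2 * p2.
Proof.
case: ps1 ps2 ps3 => P1 S1 [P2 S2] [P3 S3].
have w1_ge0 : 0 <= w1 * p1 by rewrite mulr_ge0 // ?divr_ge0 // ltW.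
have w2_ge0 : 0 <= w2 * p2 by rewrite mulr_ge0 // ?divr_ge0 // ltW.
rewrite lt_def addr_ge0 // andbT paddr_eq0 //.
apply/andP => -[/eqP wp1 /eqP wp2].
have a : w1 = 0 by apply: (mulIf (lt0r_neq0 P1)); rewrite wp1 mul0r.
have b : w2 = 0 by apply: (mulIf (lt0r_neq0 P2)); rewrite wp2 mul0r.
move: form_det_gt0; rewrite a b; set D := (X in 0 < X).
have -> : D = 0 by rewrite /D; ring.
by rewrite ltxx.
Qed.

Lemma form_minor_neq0 : form_minor e1 e2 e3 n1 n2 n3 k1 k2 k3 != 0.
Proof.
case: ps1 ps2 ps3 => P1 S1 [P2 S2] [P3 S3].
rewrite -minorE mulf_neq0 //; first by rewrite lt0r_neq0 // !mulr_gt0.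
apply/eqP => m0; have := mulr_gt0 form_corner_gt0 form_det_gt0; apply/negP; rewrite -leNgt.
set C := w1 * p1 + w2 * p2 in m0 *; set A := w2 * p2 + w3 * p3 in m0 *.
set B := w3 * p3 + w1 * p1.
have R1 : r1 != 0 by rewrite lt0r_neq0.
have R2 : r2 != 0 by rewrite lt0r_neq0.
have R3 : r3 != 0 by rewrite lt0r_neq0.
(* Desnanot-Jacobi identity: the corner times the determinant is a product of two minors minus a
   square, so it would be nonpositive if the first minor vanished. *)
have -> : C * (A / r1 * (B / r2) * (C / r3) + 2 * - w3 * - w2 * - w1 - A / r1 * (- w1) ^+ 2
     - B / r2 * (- w2) ^+ 2 - C / r3 * (- w3) ^+ 2) =
  (C * A - r1 * r3 * w2 ^+ 2) / r1 * (B * C / r2 / r3 - w1 ^+ 2) - r3 * (C / r3 * w3 + w1 * w2) ^+ 2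
  by field; rewrite R1 R2 R3.
by rewrite m0 !mul0r sub0r oppr_le0 mulr_ge0 ?sqr_ge0 // ltW.
Qed.

Lemma hyp_form_gt0_minor (x y z : R) :
  0 < form_minor e1 e2 e3 n1 n2 n3 k1 k2 k3 ->
  (x != 0) || (y != 0) || (z != 0) ->
  0 < hyp_form e1 e2 e3 n1 n2 n3 k1 k2 k3 x y z.
Proof.
case: ps1 ps2 ps3 => P1 S1 [P2 S2] [P3 S3] m0 xyz.
have C0 := form_corner_gt0.
have := @ternary_form_gt0 _ ((w2 * p2 + w3 * p3) / r1) ((w3 * p3 + w1 * p1) / r2)
  ((w1 * p1 + w2 * p2) / r3) (- w3) (- w2) (- w1) x y z _ _ form_det_gt0 xyz.
rewrite divr_gt0 // => /(_ isT); rewrite -minorE in m0.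
have ss : 0 < s1 * s2 * s3 by rewrite !mulr_gt0.
rewrite (pmulr_rgt0 _ ss) in m0.
have R1 : r1 != 0 by rewrite lt0r_neq0.
have R2 : r2 != 0 by rewrite lt0r_neq0.
have R3 : r3 != 0 by rewrite lt0r_neq0.
have -> : (w1 * p1 + w2 * p2) / r3 * ((w2 * p2 + w3 * p3) / r1) - (- w2) ^+ 2 =
  ((w1 * p1 + w2 * p2) * (w2 * p2 + w3 * p3) - r1 * r3 * w2 ^+ 2) / (r1 * r3)
  by field; rewrite R1 R3.
rewrite divr_gt0 ?mulr_gt0 // => /(_ isT).
congr (0 < _); rewrite /hyp_form /edge_form -/w1 -/w2 -/w3 -/r1 -/r2 -/r3 -/p1 -/p2 -/p3.
by field; rewrite R1 R2 R3.
Qed.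

End Nondegenerate.

Section Path.
Variables (R : rcfType) (e1 e2 e3 n1 n2 n3 k1 k2 k3 : R).
Hypothesis W : triangle_weights e1 e2 e3 n1 n2 n3.
Hypotheses (k1_gt0 : 0 < k1) (k2_gt0 : 0 < k2) (k3_gt0 : 0 < k3).
Hypotheses (r1_gt0 : 0 < k1 ^+ 2 - e1) (r2_gt0 : 0 < k2 ^+ 2 - e2)
  (r3_gt0 : 0 < k3 ^+ 2 - e3).
Hypothesis q_gt0 : 0 < gram_det e1 e2 e3 n1 n2 n3 k1 k2 k3.
Let H1 t := height e1 e2 e3 n1 n2 n3 (t * k1) (t * k2) k3.
Let H2 t := height e2 e3 e1 n2 n3 n1 (t * k2) k3 (t * k1).
Let H3 t := height e3 e1 e2 n3 n1 n2 k3 (t * k1) (t * k2).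
Hypothesis h3_lt0 : height e3 e1 e2 n3 n1 n2 k3 k1 k2 < 0.
Let g1 := e1 * n1 + n2 * n3.
Let g2 := e2 * n2 + n1 * n3.

Let g1_ge0 : 0 <= g1. Proof. by case: W. Qed.
Let g2_ge0 : 0 <= g2. Proof. by case: W. Qed.

Let q3_gt0 : 0 < n3 ^+ 2 - e1 * e2.
Proof.
rewrite -(pmulr_lgt0 _ k3_gt0).
have : 0 <= g1 * k2 by rewrite mulr_ge0 // ltW.
have : 0 <= g2 * k1 by rewrite mulr_ge0 // ltW.
by move: h3_lt0; rewrite /height /g1 /g2; lra.
Qed.

Let heights_ge0 t : 0 < t -> H3 t <= 0 -> 0 <= H1 t /\ 0 <= H2 t.
Proof.
move=> t0 h3; have k1t : 0 < t * k1 by rewrite mulr_gt0.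
have k2t : 0 < t * k2 by rewrite mulr_gt0.
split; rewrite leNgt; apply/negP => lt0.
  have W' := triangle_weights_swap W.
  have q3' : 0 < n3 ^+ 2 - e2 * e1 by rewrite [e2 * _]mulrC.
  apply: (two_heights_le0 W' k2t k1t k3_gt0 q3').
    by move: lt0; rewrite /H1 /height; lra.
  by move: h3; rewrite /H3 /height; lra.
exact: (two_heights_le0 W k1t k2t k3_gt0 q3_gt0 lt0 h3).
Qed.

Let h1_ge0 : 0 <= height e1 e2 e3 n1 n2 n3 k1 k2 k3.
Proof.
have := @heights_ge0 1 ltr01; rewrite /H1 /H2 /H3 !mul1r => H.
by case: (H (ltW h3_lt0)).
Qed.

Let h2_ge0 : 0 <= height e2 e3 e1 n2 n3 n1 k2 k3 k1.
Proof.
have := @heights_ge0 1 ltr01; rewrite /H1 /H2 /H3 !mul1r => H.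
by case: (H (ltW h3_lt0)).
Qed.

(* Scaling k1 and k2 by t raises the negative height h3 to 0 at t = T, where the minor
   is visibly positive; the minor cannot vanish on the way, because together with
   [form_det] this would make a positive determinant nonpositive. *)
Lemma form_minor_gt0_generic : 0 < g1 * k2 + g2 * k1 ->
  0 < form_minor e1 e2 e3 n1 n2 n3 k1 k2 k3.
Proof.
move=> g0; pose q3 := n3 ^+ 2 - e1 * e2.
pose T := q3 * k3 / (g1 * k2 + g2 * k1).
have T1 : 1 <= T.
  rewrite ler_pdivlMr // mul1r.
  by move: h3_lt0; rewrite /height /q3 /g1 /g2; lra.
have h3T : H3 T = 0.
  have -> : H3 T = - (q3 * k3) + T * (g1 * k2 + g2 * k1) by rewrite /H3 /height /q3 /g1 /g2; ring.
  by rewrite /T divfK ?lt0r_neq0 // addNr.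
have h3t t : t <= T -> H3 t <= 0.
  move=> tT; rewrite -h3T -subr_ge0.
  have -> : H3 T - H3 t = (T - t) * (g1 * k2 + g2 * k1) by rewrite /H3 /height /g1 /g2; ring.
  by rewrite mulr_ge0 ?subr_ge0 // ltW.
have mt t : 1 <= t -> t <= T -> form_minor e1 e2 e3 n1 n2 n3 (t * k1) (t * k2) k3 != 0.
  move=> t1 tT; have t0 : 0 < t by rewrite (lt_le_trans ltr01).
  have [h1' h2'] := heights_ge0 t0 (h3t _ tT).
  have tt : 1 <= t ^+ 2 by rewrite expr2; nra.
  apply: form_minor_neq0 => //; rewrite ?mulr_gt0 //.
  - have : 0 < k1 ^+ 2 by rewrite exprn_gt0.
    by rewrite exprMn; move: r1_gt0; nra.
  - have : 0 < k2 ^+ 2 by rewrite exprn_gt0.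
    by rewrite exprMn; move: r2_gt0; nra.
  (* [gram_det] is a constant plus a quadratic form in the k whose gradient is twice the vector of
     heights. It does not decrease along the path, because h1 and h2 stay nonnegative there. *)
  apply: lt_le_trans q_gt0 _; rewrite -subr_ge0.
  have -> : gram_det e1 e2 e3 n1 n2 n3 (t * k1) (t * k2) k3 - gram_det e1 e2 e3 n1 n2 n3 k1 k2 k3 =
     (t - 1) * (k1 * H1 t + k2 * H2 t + (k1 * H1 1 + k2 * H2 1)).
    by rewrite /gram_det /H1 /H2 /height; ring.
  have [h1'' h2''] := heights_ge0 ltr01 (h3t _ T1).
  by rewrite mulr_ge0 ?subr_ge0 // !addr_ge0 // mulr_ge0 // ltW.
have mT : 0 < form_minor e1 e2 e3 n1 n2 n3 (T * k1) (T * k2) k3.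
  have T0 : 0 < T by rewrite (lt_le_trans ltr01).
  rewrite lt_def mt //=; have [h1' h2'] := heights_ge0 T0 (h3t _ (lexx T)).
  rewrite /form_minor /minor_poly -/(H1 T) -/(H2 T) -/(H3 T) h3T !mulr0 !addr0.
  have TT : 1 <= T ^+ 2 by rewrite expr2; nra.
  have k1T : 0 < T * k1 by rewrite mulr_gt0.
  have k2T : 0 < T * k2 by rewrite mulr_gt0.
  have r1T : 0 < (T * k1) ^+ 2 - e1.
    have : 0 < k1 ^+ 2 by rewrite exprn_gt0.
    by rewrite exprMn; move: r1_gt0; nra.
  have r2T : 0 < (T * k2) ^+ 2 - e2.
    have : 0 < k2 ^+ 2 by rewrite exprn_gt0.
    by rewrite exprMn; move: r2_gt0; nra.
  case: W => E1 E2 E3 N1 N2 N3 _ _ _.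
  have [P1 S1] := edge_cosh_sinh_gt0 E2 E3 N1 k2T k3_gt0 r2T r3_gt0.
  have [P2 S2] := edge_cosh_sinh_gt0 E3 E1 N2 k3_gt0 k1T r3_gt0 r1T.
  have [P3 S3] := edge_cosh_sinh_gt0 E1 E2 N3 k1T k2T r1T r2T.
  apply: addr_ge0; first by rewrite mulr_ge0 ?sqr_ge0 // mulr_ge0 // ltW.
  by rewrite !mulr_ge0 // ltW.
(* Instantiating the minor at [{poly R}] exhibits it as a polynomial in t, to which the intermediate
   value theorem of real closed fields applies. *)
pose p := form_minor e1%:P e2%:P e3%:P n1%:P n2%:P n3%:P ('X * k1%:P) ('X * k2%:P) k3%:P.
have pE t : p.[t] = form_minor e1 e2 e3 n1 n2 n3 (t * k1) (t * k2) k3.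
  rewrite /p /form_minor.
  have -> (a b c d e f g h i : {poly R}) : (minor_poly a b c d e f g h i).[t] =
      minor_poly a.[t] b.[t] c.[t] d.[t] e.[t] f.[t] g.[t] h.[t] i.[t].
    by rewrite /minor_poly !(hornerE, horner_exp).
  by rewrite /height !(hornerE, horner_exp).
rewrite ltNge; apply/negP => m1.
have /poly_ivt : p.[1] <= 0 <= p.[T] by rewrite !pE !mul1r m1 ltW.
case=> // t /andP[t1 tT]; rewrite /root pE; apply/negP; exact: mt.
Qed.

(* When both mixed coefficients vanish the scaling path leaves h3 unchanged, but
   then e1 = e2 = e3 = 1, n1 = n2 = 0 and the minor factors explicitly. *)
Lemma form_minor_gt0 : 0 < form_minor e1 e2 e3 n1 n2 n3 k1 k2 k3.
Proof.
have [/form_minor_gt0_generic //|g0] := ltP 0 (g1 * k2 + g2 * k1).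
have g1k : 0 <= g1 * k2 by rewrite mulr_ge0 // ltW.
have g2k : 0 <= g2 * k1 by rewrite mulr_ge0 // ltW.
have g10 : g1 = 0 by apply: (mulIf (lt0r_neq0 k2_gt0)); lra.
have g20 : g2 = 0 by apply: (mulIf (lt0r_neq0 k1_gt0)); lra.
case: W => E1 E2 E3 N1 N2 N3 _ _ _.
have n3_gt0 : 0 < n3 by apply: (sum_gt0_sqr_gt0 E1 E2).
have [a1 a2] : e1 = 1 /\ e2 = 1.
  move: g10 g20; rewrite /g1 /g2.
  case: E1 E2 N1 N2 => -> [] -> N1 N2 a b; split=> //; exfalso.
  - have : 0 < n2 * n3 by rewrite mulr_gt0 //; lra.
    lra.
  - have : 0 < n2 * n3 by rewrite mulr_gt0 //; lra.
    lra.
  - have : 0 < n2 * n3 by rewrite mulr_gt0 //; lra.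
    lra.
  - have : 0 < n1 * n3 by rewrite mulr_gt0 //; lra.
    lra.
move: q3_gt0 h3_lt0 g10 g20 N1 N2 r1_gt0 r2_gt0 r3_gt0 q_gt0; rewrite /g1 /g2 a1 a2 => q3 h3 b1 b2 N1 N2 r1 r2 r3.
have n10 : n1 = 0.
  have : n1 * (n3 ^+ 2 - 1 * 1) = 0.
    have -> : n1 * (n3 ^+ 2 - 1 * 1) = n3 * (1 * n2 + n1 * n3) - (1 * n1 + n2 * n3) by ring.
    by rewrite b1 b2; ring.
  by move/eqP; rewrite mulf_eq0 (gt_eqF q3) orbF => /eqP.
have n20 : n2 = 0 by move: b2; rewrite n10; lra.
have a3 : e3 = 1 by case: E3 N1 => -> //; rewrite n10; lra.
rewrite n10 n20 a3 in r3 *.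
have -> : gram_det 1 1 1 0 0 n3 k1 k2 k3 =
  (1 - n3 ^+ 2) * k3 ^+ 2 + k1 ^+ 2 + k2 ^+ 2 + 2 * n3 * k1 * k2 + n3 ^+ 2 - 1.
  by rewrite /gram_det; ring.
set q := _ - 1 => q0.
have -> : form_minor 1 1 1 0 0 n3 k1 k2 k3 = q *
  ((k2 + n3 * k1) * (k1 ^+ 2 * k2 * k3 ^+ 2 + n3 * k1 * (k2 ^+ 2 + (k3 ^+ 2 - 1))) +
   k2 ^+ 2 * k3 ^+ 2 * (k1 ^+ 2 + n3 * k1 * k2 + (n3 ^+ 2 - 1)) +
   k2 * (k2 + n3 * k1) * (k2 ^+ 2 + k3 ^+ 2 - 1)).
  by rewrite /form_minor /minor_poly /height /q; ring.
rewrite mulr_gt0 //.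
have u0 : 0 < n3 * k1 by rewrite mulr_gt0.
have k22 : 0 < k2 ^+ 2 by rewrite exprn_gt0.
have k32 : 0 < k3 ^+ 2 by rewrite exprn_gt0.
have k12 : 0 < k1 ^+ 2 by rewrite exprn_gt0.
have v0 : 0 < n3 * k1 * k2 by rewrite !mulr_gt0.
have k1k2 : 0 < k1 ^+ 2 * k2 by rewrite mulr_gt0.
have x0 : 0 < k1 ^+ 2 * k2 * k3 ^+ 2 by rewrite !mulr_gt0.
have k3k2 : 0 < k2 ^+ 2 + (k3 ^+ 2 - 1) by rewrite addr_gt0.
have y0 : 0 < n3 * k1 * (k2 ^+ 2 + (k3 ^+ 2 - 1)) by rewrite mulr_gt0.
have d0 : 0 < k2 + n3 * k1 by rewrite addr_gt0.
rewrite mulr1 in q3.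
rewrite -[k2 ^+ 2 + k3 ^+ 2 - 1]addrA.
by do ![by []|apply: addr_gt0|apply: mulr_gt0].
Qed.

End Path.

Section HyperbolicForm.
Variables (R : rcfType).

Let hyp_form_gt0_ge0 (e1 e2 e3 n1 n2 n3 k1 k2 k3 x y z : R) :
  triangle_weights e1 e2 e3 n1 n2 n3 -> 0 < k1 -> 0 < k2 -> 0 < k3 ->
  0 < k1 ^+ 2 - e1 -> 0 < k2 ^+ 2 - e2 -> 0 < k3 ^+ 2 - e3 ->
  0 < gram_det e1 e2 e3 n1 n2 n3 k1 k2 k3 ->
  0 <= height e1 e2 e3 n1 n2 n3 k1 k2 k3 ->
  0 <= height e2 e3 e1 n2 n3 n1 k2 k3 k1 ->
  (x != 0) || (y != 0) || (z != 0) ->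
  0 < hyp_form e1 e2 e3 n1 n2 n3 k1 k2 k3 x y z.
Proof.
move=> W K1 K2 K3 R1 R2 R3 Q h1 h2 xyz; apply: hyp_form_gt0_minor => //.
have [h3|h3] := ltP (height e3 e1 e2 n3 n1 n2 k3 k1 k2) 0; first exact: form_minor_gt0.
rewrite lt_def form_minor_neq0 //= /form_minor /minor_poly.
case: (W) => E1 E2 E3 N1 N2 N3 _ _ _.
have [P1 S1] := edge_cosh_sinh_gt0 E2 E3 N1 K2 K3 R2 R3.
have [P2 S2] := edge_cosh_sinh_gt0 E3 E1 N2 K3 K1 R3 R1.
have [P3 S3] := edge_cosh_sinh_gt0 E1 E2 N3 K1 K2 R1 R2.
by do ![by []|exact: ltW|exact: sqr_ge0|apply: mulr_ge0|apply: addr_ge0].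
Qed.

Lemma hyp_form_rot (e1 e2 e3 n1 n2 n3 k1 k2 k3 x y z : R) :
  hyp_form e1 e2 e3 n1 n2 n3 k1 k2 k3 x y z =
  hyp_form e2 e3 e1 n2 n3 n1 k2 k3 k1 y z x.
Proof. by rewrite /hyp_form -addrA addrC. Qed.

Lemma gram_det_rot (e1 e2 e3 n1 n2 n3 k1 k2 k3 : R) :
  gram_det e1 e2 e3 n1 n2 n3 k1 k2 k3 = gram_det e2 e3 e1 n2 n3 n1 k2 k3 k1.
Proof. by rewrite /gram_det; ring. Qed.

Lemma height_swap (e1 e2 e3 n1 n2 n3 k1 k2 k3 : R) :
  height e1 e2 e3 n1 n2 n3 k1 k2 k3 = height e1 e3 e2 n1 n3 n2 k1 k3 k2.
Proof. by rewrite /height; ring. Qed.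

(** At most one height is negative: a negative h3 already implies the inequality
    [0 < n3 ^+ 2 - e1 * e2] that [two_heights_le0] asks for. *)
Lemma two_heights_lt0 (e1 e2 e3 n1 n2 n3 k1 k2 k3 : R) :
  triangle_weights e1 e2 e3 n1 n2 n3 -> 0 < k1 -> 0 < k2 -> 0 < k3 ->
  height e2 e3 e1 n2 n3 n1 k2 k3 k1 < 0 -> 0 <= height e3 e1 e2 n3 n1 n2 k3 k1 k2.
Proof.
move=> W K1 K2 K3 h2; rewrite leNgt; apply/negP => h3.
apply: (two_heights_le0 W K1 K2 K3 _ h2 (ltW h3)).
rewrite -(pmulr_lgt0 _ K3); case: W => _ _ _ _ _ _ G1 G2 _.
have : 0 <= (e1 * n1 + n2 * n3) * k2 by rewrite mulr_ge0 // ltW.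
have : 0 <= (e2 * n2 + n1 * n3) * k1 by rewrite mulr_ge0 // ltW.
by move: h3; rewrite /height; lra.
Qed.

(** A rotation of the indices makes the only possibly negative height the third one. *)
Lemma hyp_form_gt0 (e1 e2 e3 n1 n2 n3 k1 k2 k3 x y z : R) :
  triangle_weights e1 e2 e3 n1 n2 n3 -> 0 < k1 -> 0 < k2 -> 0 < k3 ->
  0 < k1 ^+ 2 - e1 -> 0 < k2 ^+ 2 - e2 -> 0 < k3 ^+ 2 - e3 ->
  0 < gram_det e1 e2 e3 n1 n2 n3 k1 k2 k3 ->
  (x != 0) || (y != 0) || (z != 0) ->
  0 < hyp_form e1 e2 e3 n1 n2 n3 k1 k2 k3 x y z.
Proof.
move=> W K1 K2 K3 R1 R2 R3 Q xyz; have W' := triangle_weights_rot W.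
have W'' := triangle_weights_rot W'.
have [h1|h1] := ltP (height e1 e2 e3 n1 n2 n3 k1 k2 k3) 0.
  rewrite hyp_form_rot; apply: hyp_form_gt0_ge0 => //.
  - by rewrite -gram_det_rot.
  - exact: two_heights_lt0 W'' K3 K1 K2 h1.
  - rewrite leNgt; apply/negP => h3.
    by have := two_heights_lt0 W' K2 K3 K1 h3; rewrite leNgt h1.
  - by rewrite orbC orbA.
have [h2|h2] := ltP (height e2 e3 e1 n2 n3 n1 k2 k3 k1) 0.
  rewrite -hyp_form_rot; apply: hyp_form_gt0_ge0 => //.
  - by rewrite -2!gram_det_rot.
  - exact: two_heights_lt0 W K1 K2 K3 h2.
  - by rewrite orbAC orbC orbA orbAC.
exact: hyp_form_gt0_ge0.
Qed.

End HyperbolicForm.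

(** * The Euclidean form *)

Definition euc_weight (R : rcfType) (e1 e2 e3 n1 n2 n3 k1 k2 k3 : R) : R :=
  height e1 e2 e3 n1 n2 n3 k1 k2 k3 /
  (k1 * (e2 * k3 ^+ 2 + e3 * k2 ^+ 2 + 2 * n1 * k2 * k3)).

Definition euc_form (R : rcfType) (e1 e2 e3 n1 n2 n3 k1 k2 k3 x y z : R) : R :=
  euc_weight e1 e2 e3 n1 n2 n3 k1 k2 k3 * (y - z) ^+ 2 +
  euc_weight e2 e3 e1 n2 n3 n1 k2 k3 k1 * (z - x) ^+ 2 +
  euc_weight e3 e1 e2 n3 n1 n2 k3 k1 k2 * (x - y) ^+ 2.

(** A positive multiple of the squared area of the triangle; it takes the place of [gram_det]. *)
Definition euc_area2 (R : rcfType) (e1 e2 e3 n1 n2 n3 k1 k2 k3 : R) : R :=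
  k1 * height e1 e2 e3 n1 n2 n3 k1 k2 k3 + k2 * height e2 e3 e1 n2 n3 n1 k2 k3 k1
  + k3 * height e3 e1 e2 n3 n1 n2 k3 k1 k2.

Section EuclideanForm.
Variables (R : rcfType).

Lemma euc_length2_gt0 (a b n k l : R) :
  a = 0 \/ a = 1 -> b = 0 \/ b = 1 -> 0 < a * b + n -> 0 < k -> 0 < l ->
  0 < a * l ^+ 2 + b * k ^+ 2 + 2 * n * k * l.
Proof.
move=> Ha Hb H k0 l0; have kl : 0 < k * l by rewrite mulr_gt0.
have k2 : 0 < k ^+ 2 by rewrite exprn_gt0.
have l2 : 0 < l ^+ 2 by rewrite exprn_gt0.
case: Ha H => -> H; case: Hb H => -> H; rewrite ?(mul0r, mulr0, mul1r, add0r) in H *.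
- by rewrite !mulr_gt0.
- by rewrite addr_gt0 // !mulr_gt0.
- by rewrite addr0 addr_gt0 // !mulr_gt0.
have -> : l ^+ 2 + k ^+ 2 + 2 * n * k * l = 2 * (1 + n) * (k * l) + (k - l) ^+ 2 by ring.
by rewrite ltr_pwDl ?sqr_ge0 // !mulr_gt0.
Qed.

Let euc_form_gt0_ge0 (e1 e2 e3 n1 n2 n3 k1 k2 k3 x y z : R) :
  triangle_weights e1 e2 e3 n1 n2 n3 -> 0 < k1 -> 0 < k2 -> 0 < k3 ->
  0 < euc_area2 e1 e2 e3 n1 n2 n3 k1 k2 k3 ->
  0 <= height e1 e2 e3 n1 n2 n3 k1 k2 k3 ->
  0 <= height e2 e3 e1 n2 n3 n1 k2 k3 k1 ->
  (x != y) || (y != z) ->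
  0 < euc_form e1 e2 e3 n1 n2 n3 k1 k2 k3 x y z.
Proof.
move=> W K1 K2 K3 Q h1 h2 xyz; rewrite /euc_form /euc_weight.
have D := link_prod_gt0 W K1 K2 K3; case: W => E1 E2 E3 N1 N2 N3 _ _ _.
have L1 := euc_length2_gt0 E2 E3 N1 K2 K3.
have L2 := euc_length2_gt0 E3 E1 N2 K3 K1.
have L3 := euc_length2_gt0 E1 E2 N3 K1 K2.
have := mulr_gt0 Q D.
(* Euclidean counterpart of [form_det]: divided by [l1 * l2 * l3], the right-hand side becomes w1 w2
   + w2 w3 + w3 w1, the common value of the principal 2x2 minors of the form. *)
have -> : euc_area2 e1 e2 e3 n1 n2 n3 k1 k2 k3 * link_prod e1 e2 e3 n1 n2 n3 k1 k2 k3 =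
  k3 * (e1 * k2 ^+ 2 + e2 * k1 ^+ 2 + 2 * n3 * k1 * k2) * height e1 e2 e3 n1 n2 n3 k1 k2 k3 *
   height e2 e3 e1 n2 n3 n1 k2 k3 k1 +
  k1 * (e2 * k3 ^+ 2 + e3 * k2 ^+ 2 + 2 * n1 * k2 * k3) * height e2 e3 e1 n2 n3 n1 k2 k3 k1 *
   height e3 e1 e2 n3 n1 n2 k3 k1 k2 +
  k2 * (e3 * k1 ^+ 2 + e1 * k3 ^+ 2 + 2 * n2 * k3 * k1) * height e3 e1 e2 n3 n1 n2 k3 k1 k2 *
   height e1 e2 e3 n1 n2 n3 k1 k2 k3.
  by rewrite /euc_area2 /link_prod /height; ring.
move: (mulr_gt0 K1 L1) (mulr_gt0 K2 L2) (mulr_gt0 K3 L3) h1 h2.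
move: (height e1 _ _ _ _ _ _ _ _) (height e2 _ _ _ _ _ _ _ _) (height e3 _ _ _ _ _ _ _ _).
move: (k1 * _) (k2 * (_ + _)) (k3 * (_ + _)).
move=> l1 l2 l3 h1 h2 h3 l1_gt0 l2_gt0 l3_gt0 h1_ge0 h2_ge0 S.
pose w1 := h1 / l1; pose w2 := h2 / l2; pose w3 := h3 / l3.
rewrite -/w1 -/w2 -/w3.
have w1_ge0 : 0 <= w1 by rewrite divr_ge0 // ltW.
have w2_ge0 : 0 <= w2 by rewrite divr_ge0 // ltW.
have S' : 0 < w1 * w2 + w2 * w3 + w3 * w1.
  have -> : w1 * w2 + w2 * w3 + w3 * w1 =
     (l3 * h1 * h2 + l1 * h2 * h3 + l2 * h3 * h1) / (l1 * l2 * l3).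
    by rewrite /w1 /w2 /w3; field; rewrite !lt0r_neq0.
  by rewrite divr_gt0 // !mulr_gt0.
have p0 : 0 < w1 + w2.
  rewrite lt_def addr_ge0 // andbT paddr_eq0 //; apply/andP => -[/eqP a /eqP b].
  by move: S'; rewrite a b !(mul0r, mulr0, addr0) ltxx.
rewrite -(pmulr_rgt0 _ p0).
have -> : (w1 + w2) * (w1 * (y - z) ^+ 2 + w2 * (z - x) ^+ 2 + w3 * (x - y) ^+ 2) =
  (w1 * (y - z) + w2 * (x - z)) ^+ 2 + (w1 * w2 + w2 * w3 + w3 * w1) * (x - y) ^+ 2 by ring.
have [xy|xy] := eqVneq x y; last first.
  by apply: ltr_wpDl; rewrite ?sqr_ge0 // mulr_gt0 // exprn_even_gt0 //= subr_eq0.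
rewrite xy subrr expr0n /= mulr0 addr0 -mulrDl exprn_even_gt0 //= mulf_neq0 //.
  exact: lt0r_neq0.
by move: xyz; rewrite xy eqxx /= subr_eq0.
Qed.

Lemma euc_form_rot (e1 e2 e3 n1 n2 n3 k1 k2 k3 x y z : R) :
  euc_form e1 e2 e3 n1 n2 n3 k1 k2 k3 x y z =
  euc_form e2 e3 e1 n2 n3 n1 k2 k3 k1 y z x.
Proof. by rewrite /euc_form -addrA addrC. Qed.

Lemma euc_area2_rot (e1 e2 e3 n1 n2 n3 k1 k2 k3 : R) :
  euc_area2 e1 e2 e3 n1 n2 n3 k1 k2 k3 = euc_area2 e2 e3 e1 n2 n3 n1 k2 k3 k1.
Proof. by rewrite /euc_area2 -addrA addrC. Qed.

Lemma euc_form_gt0 (e1 e2 e3 n1 n2 n3 k1 k2 k3 x y z : R) :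
  triangle_weights e1 e2 e3 n1 n2 n3 -> 0 < k1 -> 0 < k2 -> 0 < k3 ->
  0 < euc_area2 e1 e2 e3 n1 n2 n3 k1 k2 k3 ->
  (x != y) || (y != z) ->
  0 < euc_form e1 e2 e3 n1 n2 n3 k1 k2 k3 x y z.
Proof.
move=> W K1 K2 K3 Q xyz; have W' := triangle_weights_rot W.
have W'' := triangle_weights_rot W'.
have [h1|h1] := ltP (height e1 e2 e3 n1 n2 n3 k1 k2 k3) 0.
  rewrite euc_form_rot; apply: euc_form_gt0_ge0 => //.
  - by rewrite -euc_area2_rot.
  - exact: two_heights_lt0 W'' K3 K1 K2 h1.
  - rewrite leNgt; apply/negP => h3.
    by have := two_heights_lt0 W' K2 K3 K1 h3; rewrite leNgt h1.
  - rewrite orbC; case: (eqVneq x y) xyz => [->|]; first by rewrite /= eq_sym => ->.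
    by case: (eqVneq z x) => [->|_ _ _]; rewrite ?orbT //= eq_sym => ->.
have [h2|h2] := ltP (height e2 e3 e1 n2 n3 n1 k2 k3 k1) 0.
  rewrite -euc_form_rot; apply: euc_form_gt0_ge0 => //.
  - by rewrite -2!euc_area2_rot.
  - exact: two_heights_lt0 W K1 K2 K3 h2.
  - case: (eqVneq x y) xyz => [->|_ _]; last by rewrite orbT.
    by rewrite orbF /= eq_sym.
exact: euc_form_gt0_ge0.
Qed.

End EuclideanForm.

(** * Spectral theorem and Frobenius norm *)

Section RealSpectral.
Variable R : rcfType.

(** An eigenvalue exists over the algebraically closed field [R[i]]. Evaluating v A w in two ways,
    with w the conjugate transpose of the eigenvector v, shows that it is real. *)
Lemma symmetric_eigenvalue n (A : 'M[R]_n.+1) : A^T = A -> exists a, eigenvalue A a.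
Proof.
move=> As; pose AC : 'M[R[i]]_n.+1 := map_mx (real_complex R) A.
have [a aP] := eigenvalue_closed AC (ltn0Sn n).
have /eigenvalueP[v vA v0] := aP.
have conjAC : map_mx Num.conj AC = AC.
  by apply/matrixP => i j; rewrite !mxE; apply: conjc_real.
pose w := map_mx Num.conj v^T.
have ACT : AC^T = AC by rewrite /AC -[in RHS]As map_trmx.
have Aw : AC *m w = Num.conj a *: w.
  have := congr1 (fun M => map_mx Num.conj M^T) vA.
  rewrite trmx_mul map_mxM ACT conjAC => ->; rewrite linearZ /= map_mxZ.
  by [].
have s0 : (v *m w) 0 0 != 0.
  rewrite mxE psumr_neq0; last by move=> i _; rewrite !mxE mul_conjC_ge0.
  have /matrix0Pn[i [j vij]] := v0; rewrite ord1 in vij.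
  by apply/hasP; exists j; rewrite ?mem_index_enum //= !mxE lt_def mul_conjC_ge0 mul_conjC_eq0 vij.
have aR : a \is Num.real.
  apply/CrealP/(mulIf s0).
  have : (v *m (AC *m w)) 0 0 = (v *m AC *m w) 0 0 by rewrite mulmxA.
  by rewrite Aw vA -scalemxAr -scalemxAl [LHS]mxE [RHS]mxE.
have /complex_realP[b aE] := aR.
exists b; move: aP; rewrite !eigenvalue_root_char -map_char_poly aE.
by rewrite fmorph_root.
Qed.

Lemma row_sqr_gt0 n (v : 'rV[R]_n) : v != 0 -> 0 < (v *m v^T) 0 0.
Proof.
move=> v0; rewrite lt_def; apply/andP; split; last first.
  by rewrite mxE sumr_ge0 // => i _; rewrite !mxE -expr2 sqr_ge0.
rewrite mxE psumr_neq0; last by move=> i _; rewrite !mxE -expr2 sqr_ge0.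
have /matrix0Pn[i [j vij]] := v0; rewrite ord1 in vij.
by apply/hasP; exists j; rewrite ?mem_index_enum //= !mxE -expr2 exprn_even_gt0.
Qed.

(* Q is the Householder reflection exchanging v and the first basis vector. *)
Lemma orthogonal_first_row n (v : 'rV[R]_n.+1) : v *m v^T = 1%:M ->
  exists Q : 'M[R]_n.+1, Q *m Q^T = 1%:M /\ row 0 Q = v.
Proof.
move=> vv; pose e : 'rV[R]_n.+1 := delta_mx 0 0.
have [->|ev] := eqVneq v e.
  by exists 1%:M; rewrite trmx1 mulmx1; split => //; apply/rowP => j; rewrite !mxE eq_sym.
pose w := e - v; have w0 : w != 0 by rewrite subr_eq0 eq_sym.
set c := (w *m w^T) 0 0; have c0 : c != 0 by rewrite lt0r_neq0 // row_sqr_gt0.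
have ww : w *m w^T = c%:M by rewrite [LHS]mx11_scalar.
have cE : c = 2 * (1 - v 0 0).
  have ee : e *m e^T = 1%:M.
    by rewrite /e trmx_delta mul_delta_mx; apply/matrixP => i j; rewrite !ord1 !mxE.
  have ev' : (e *m v^T) 0 0 = v 0 0 by rewrite -rowE !mxE.
  have ve' : (v *m e^T) 0 0 = v 0 0 by rewrite /e trmx_delta -colE !mxE.
  rewrite /c /w linearB /= mulmxBl !mulmxBr ee vv.
  rewrite !mxE in ev' ve' *; rewrite ev' ve' eqxx mulr1n; ring.
pose Q := 1%:M - (2 / c) *: (w^T *m w).
have QT : Q^T = Q by rewrite /Q linearB linearZ /= trmx_mul trmxK trmx1.
exists Q; split.
  have WW : (w^T *m w) *m (w^T *m w) = c *: (w^T *m w).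
    by rewrite mulmxA -(mulmxA w^T) ww mul_mx_scalar scalemxAl.
  rewrite QT /Q; move: (w^T *m w) WW => W WW.
  rewrite mulmxBl !mulmxBr !mulmx1 mul1mx -scalemxAr -scalemxAl WW !scalerA.
  by apply/matrixP => i j; rewrite !mxE; field.
have ew : e *m w^T = (c / 2)%:M.
  rewrite [LHS]mx11_scalar; congr (_%:M).
  rewrite /w linearB /= mulmxBr [LHS]mxE.
  have -> : (e *m e^T) 0 0 = 1 by rewrite /e trmx_delta mul_delta_mx !mxE eqxx.
  have -> : (- (e *m v^T)) 0 0 = - v 0 0 by rewrite mxE -rowE !mxE.
  by rewrite cE; field.
rewrite rowE -/e /Q mulmxBr mulmx1 -scalemxAr mulmxA ew mul_scalar_mx scalerA.
have -> : 2 / c * (c / 2) = 1 by field; rewrite c0.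
by rewrite scale1r /w opprB addrC subrK.
Qed.

(** Deflation: an orthogonal matrix whose first row is a unit eigenvector conjugates A to block
    diagonal form, and the induction hypothesis handles the remaining block. *)
Lemma symmetric_diagonalizable n (A : 'M[R]_n) : A^T = A ->
  exists (P : 'M[R]_n) (lam : 'rV[R]_n), P *m P^T = 1%:M /\ A = P^T *m diag_mx lam *m P.
Proof.
elim: n A => [|n IH] A As.
  by exists 1%:M, 0; split; apply/matrixP => -[].
have [a /eigenvalueP[v vA v0]] := symmetric_eigenvalue As.
pose s := (v *m v^T) 0 0; have s0 : 0 < s by apply: row_sqr_gt0.
pose v1 := (Num.sqrt s)^-1 *: v.
have v1A : v1 *m A = a *: v1 by rewrite -scalemxAl vA !scalerA mulrC.
have vv1 : v1 *m v1^T = 1%:M.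
  rewrite [LHS]mx11_scalar; congr (_%:M).
  rewrite linearZ /= -scalemxAr -scalemxAl scalerA [LHS]mxE -/s -invfM.
  by rewrite -expr2 sqr_sqrtr ?ltW // mulVf // lt0r_neq0.
have [Q [QQ Q0]] := orthogonal_first_row vv1.
have QQ' := mulmx1C QQ.
pose B := Q *m A *m Q^T.
have Bs : B^T = B by rewrite /B !trmx_mul trmxK As mulmxA.
have B0 : row 0 B = a *: delta_mx 0 0.
  rewrite /B !row_mul Q0 v1A -scalemxAl -Q0 -row_mul QQ; congr (_ *: _).
  by apply/rowP => j; rewrite !mxE eq_sym.
have AE : A = Q^T *m B *m Q by rewrite /B !mulmxA QQ' mul1mx -mulmxA QQ' mulmx1.
clearbody B; have B0j j : B 0 j = a *+ (j == 0).
  have := congr1 (fun M : 'rV[R]_n.+1 => M 0 j) B0.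
  by rewrite !mxE eqxx /= mulr_natr.
have Bi0 i : B i 0 = a *+ (i == 0) by rewrite -B0j -[in LHS]Bs mxE.
pose B' : 'M[R]_n := @drsubmx _ 1 n 1 n B.
have BE : B = block_mx (a%:M : 'M[R]_1) 0 0 B' :> 'M[R]_(1 + n).
  rewrite -[LHS](@submxK _ 1 n 1 n); congr block_mx.
  - apply/matrixP => i j; rewrite !ord1 !mxE /= -[RHS](B0j 0).
    by congr (B _ _); apply/val_inj.
  - apply/matrixP => i j; rewrite !ord1 !mxE /=.
    transitivity (B 0 (@rshift 1 n j)); first by congr (B _ _); apply/val_inj.
    by rewrite B0j; case: eqP => // /(congr1 val).
  - apply/matrixP => i j; rewrite !ord1 !mxE /=.
    transitivity (B (@rshift 1 n i) 0); first by congr (B _ _); apply/val_inj.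
    by rewrite Bi0; case: eqP => // /(congr1 val).
have Bs' : B'^T = B' by rewrite /B' trmx_drsub Bs.
have [P' [lam' [PP' B'E]]] := IH _ Bs'.
pose S : 'M[R]_(1 + n) := block_mx 1%:M 0 0 P'.
have SS : S *m S^T = 1%:M.
  rewrite /S tr_block_mx mulmx_block !trmx0 trmx1 !mulmx0 !mul0mx !addr0 add0r mulmx1 PP'.
  by rewrite -scalar_mx_block.
exists ((S : 'M[R]_n.+1) *m Q), (row_mx (a%:M : 'rV[R]_1) lam' : 'rV[R]_(1 + n)).
split.
  by rewrite trmx_mul mulmxA -(mulmxA S) QQ mulmx1; exact: SS.
rewrite AE trmx_mul -!mulmxA; congr (_ *m _); rewrite !mulmxA; congr (_ *m _).
rewrite BE [in LHS]B'E; change n.+1 with (1 + n)%N.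
rewrite diag_mx_row /S tr_block_mx !mulmx_block !trmx0 trmx1.
rewrite !mulmx0 !mul0mx !addr0 !add0r mulmx1 mul1mx; congr block_mx; rewrite ?mul0mx //.
by apply/matrixP => i j; rewrite !ord1 !mxE.
Qed.

End RealSpectral.

Section CauchySchwarz.
Context {R : realType}.

(** Lagrange's identity: the difference is half a double sum of squares. *)
Lemma sum_mul_sqr_le (I : finType) (x y : I -> R) :
  (\sum_i x i * y i) ^+ 2 <= (\sum_i x i ^+ 2) * (\sum_i y i ^+ 2).
Proof.
rewrite -subr_ge0.
have -> : (\sum_i x i ^+ 2) * (\sum_i y i ^+ 2) - (\sum_i x i * y i) ^+ 2 =
    2^-1 * \sum_i \sum_j (x i * y j - x j * y i) ^+ 2.
  have -> : \sum_i \sum_j (x i * y j - x j * y i) ^+ 2 =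
    \sum_i \sum_j (x i ^+ 2 * y j ^+ 2) + \sum_i \sum_j (y i ^+ 2 * x j ^+ 2)
    - 2 * \sum_i \sum_j (x i * y i) * (x j * y j).
    rewrite mulr_sumr -sumrN -!big_split /=; apply: eq_bigr => i _.
    rewrite mulr_sumr -sumrN -!big_split /=; apply: eq_bigr => j _; ring.
  by rewrite -!big_distrlr /=; field.
by rewrite mulr_ge0 ?invr_ge0 // sumr_ge0 // => i _; rewrite sumr_ge0 // => j _; rewrite sqr_ge0.
Qed.

End CauchySchwarz.

Section Frobenius.
Context {R : realType}.

(** Squared Frobenius norm. It is the Euclidean norm on columns, and on matrices it is
    submultiplicative and invariant under orthogonal factors, so one norm serves everywhere. *)
Definition fro2 m n (A : 'M[R]_(m, n)) : R := \sum_i \sum_j A i j ^+ 2.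

Lemma fro2_ge0 m n (A : 'M[R]_(m, n)) : 0 <= fro2 A.
Proof. by rewrite sumr_ge0 // => i _; rewrite sumr_ge0 // => j _; rewrite sqr_ge0. Qed.

Lemma fro2_trace m n (A : 'M[R]_(m, n)) : fro2 A = \tr (A *m A^T).
Proof.
by apply: eq_bigr => i _; rewrite mxE; apply: eq_bigr => j _; rewrite mxE expr2.
Qed.

Lemma fro2_tr m n (A : 'M[R]_(m, n)) : fro2 (A^T) = fro2 A.
Proof. by rewrite !fro2_trace trmxK mxtrace_mulC. Qed.

Lemma fro2N m n (A : 'M[R]_(m, n)) : fro2 (- A) = fro2 A.
Proof. by do 2![apply: eq_bigr => ? _]; rewrite mxE sqrrN. Qed.

Lemma fro2_orthogonal_r m n (A : 'M[R]_(m, n)) (P : 'M[R]_n) : P *m P^T = 1%:M ->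
  fro2 (A *m P) = fro2 A.
Proof. by move=> PP; rewrite !fro2_trace trmx_mul mulmxA -(mulmxA A) PP mulmx1. Qed.

Lemma fro2_orthogonal_l m n (A : 'M[R]_(m, n)) (P : 'M[R]_m) : P^T *m P = 1%:M ->
  fro2 (P *m A) = fro2 A.
Proof.
by move=> PP; rewrite -fro2_tr trmx_mul fro2_orthogonal_r ?trmxK // fro2_tr.
Qed.

Lemma fro2_mul m n p (A : 'M[R]_(m, n)) (B : 'M[R]_(n, p)) :
  fro2 (A *m B) <= fro2 A * fro2 B.
Proof.
rewrite -(fro2_tr B) /fro2 big_distrlr /=; apply: ler_sum => i _.
apply: ler_sum => j _; rewrite mxE.
rewrite (eq_bigr (fun k => A i k * B^T j k)) ?sum_mul_sqr_le // => k _.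
by rewrite [B^T _ _]mxE.
Qed.

Lemma fro2_col n (v : 'cV[R]_n) : fro2 v = \sum_i v i 0 ^+ 2.
Proof. by apply: eq_bigr => i _; rewrite big_ord1. Qed.

Definition fro m n (A : 'M[R]_(m, n)) : R := Num.sqrt (fro2 A).

Lemma fro_ge0 m n (A : 'M[R]_(m, n)) : 0 <= fro A. Proof. exact: sqrtr_ge0. Qed.

Lemma fro_sqr m n (A : 'M[R]_(m, n)) : fro A ^+ 2 = fro2 A.
Proof. by rewrite sqr_sqrtr // fro2_ge0. Qed.

Lemma l2normE n (v : 'cV[R]_n) : l2norm v = fro v.
Proof. by rewrite /l2norm /fro fro2_col. Qed.

Lemma fro_mul m n p (A : 'M[R]_(m, n)) (B : 'M[R]_(n, p)) : fro (A *m B) <= fro A * fro B.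
Proof. by rewrite -sqrtrM ?fro2_ge0 // ler_sqrt ?mulr_ge0 ?fro2_ge0 // fro2_mul. Qed.

Lemma froN m n (A : 'M[R]_(m, n)) : fro (- A) = fro A.
Proof. by rewrite /fro fro2N. Qed.

Lemma fro_coord m n (A : 'M[R]_(m, n)) i j : `|A i j| <= fro A.
Proof.
rewrite -sqrtr_sqr ler_sqrt ?fro2_ge0 // /fro2 (bigD1 i) //= (bigD1 j) //= -addrA lerDl.
by rewrite addr_ge0 // sumr_ge0 // => ? _; rewrite ?sumr_ge0 // => *; rewrite sqr_ge0.
Qed.

Lemma fro2_entry_le m n (A B : 'M[R]_(m, n)) :
  (forall i j, `|A i j| <= `|B i j|) -> fro A <= fro B.
Proof.
move=> AB; rewrite ler_sqrt ?fro2_ge0 //; apply: ler_sum => i _; apply: ler_sum => j _.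
by rewrite -[leLHS]real_normK ?num_real // -[leRHS]real_normK ?num_real // lerXn2r ?nnegrE.
Qed.

Lemma froZ m n (A : 'M[R]_(m, n)) a : fro (a *: A) = `|a| * fro A.
Proof.
rewrite -sqrtr_sqr -sqrtrM ?sqr_ge0 //; congr Num.sqrt.
rewrite /fro2 mulr_sumr; apply: eq_bigr => i _; rewrite mulr_sumr; apply: eq_bigr => j _.
by rewrite mxE exprMn.
Qed.

Lemma fro_dot n (u v : 'cV[R]_n) : `|(u^T *m v) 0 0| <= fro u * fro v.
Proof.
apply: le_trans (fro_coord _ _ _) _; apply: le_trans (fro_mul _ _) _.
by rewrite /fro fro2_tr.
Qed.

Lemma froD m n (A B : 'M[R]_(m, n)) : fro (A + B) <= fro A + fro B.
Proof.
rewrite -(ler_pXn2r (_ : 0 < 2)%N) ?nnegrE ?addr_ge0 ?fro_ge0 //.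
rewrite sqrrD !fro_sqr.
have -> : fro2 (A + B) = fro2 A + 2 * (\sum_(k : 'I_m * 'I_n) A k.1 k.2 * B k.1 k.2) + fro2 B.
  rewrite -(pair_bigA _ (fun i j => A i j * B i j)) /= mulr_sumr /fro2 -!big_split /=.
  apply: eq_bigr => i _; rewrite mulr_sumr -!big_split /=.
  by apply: eq_bigr => j _; rewrite mxE; ring.
rewrite lerD2r lerD2l -[leRHS]mulr_natl ler_pM2l //.
apply: le_trans (ler_norm _) _; rewrite -sqrtr_sqr -sqrtrM ?fro2_ge0 // ler_sqrt ?mulr_ge0 ?fro2_ge0 //.
apply: le_trans (sum_mul_sqr_le _ _) _.
by rewrite -!(pair_bigA _ (fun i j => _ i j ^+ 2)).
Qed.

Lemma fro0_eq0 m n (A : 'M[R]_(m, n)) : fro A = 0 -> A = 0.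
Proof.
move=> A0; apply/matrixP => i j; apply/eqP; rewrite mxE -normr_le0 -A0; exact: fro_coord.
Qed.

Lemma fro0 m n : fro (0 : 'M[R]_(m, n)) = 0.
Proof. by rewrite -(scale0r 0) froZ normr0 mul0r. Qed.

Lemma fro_le_sum m n (A : 'M[R]_(m, n)) : fro A <= \sum_i \sum_j `|A i j|.
Proof.
have le_sum (I : finType) (F : I -> 'M[R]_(m, n)) : fro (\sum_i F i) <= \sum_i fro (F i).
  elim/big_ind2: _ => [|x1 y1 x2 y2 h1 h2|//]; first by rewrite fro0.
  by apply: le_trans (froD _ _) _; rewrite lerD.
rewrite {1}[A]matrix_sum_delta.
apply: le_trans (le_sum _ _) _; apply: ler_sum => i _.
apply: le_trans (le_sum _ _) _; apply: ler_sum => j _.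
rewrite froZ ler_piMr // /fro.
have -> : fro2 (delta_mx i j : 'M[R]_(m, n)) = 1; last by rewrite sqrtr1.
rewrite /fro2 (bigD1 i) //= [X in _ + X]big1 => [|k ki].
  rewrite addr0 (bigD1 j) //= [X in _ + X]big1 => [|k kj]; first by rewrite !mxE !eqxx addr0 expr1n.
  by rewrite mxE (negPf kj) andbF expr0n.
by rewrite big1 // => l _; rewrite mxE (negPf ki) expr0n.
Qed.

End Frobenius.

Section FractionalPowers.
Context {R : realType}.

(** By [is_frac_pow_uniq] the value chosen in [frac_pow] can be computed from any
    diagonalization. *)
Lemma frac_powE n s (A P : 'M[R]_n) (lam : 'rV[R]_n) : P *m P^T = 1%:M -> (forall i, 0 <= lam 0 i) ->
  A = P^T *m diag_mx lam *m P ->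
  frac_pow s A = P^T *m diag_mx (map_mx (pow0 s) lam) *m P.
Proof.
move=> PP l0 AE.
have B : is_frac_pow s A (P^T *m diag_mx (map_mx (pow0 s) lam) *m P) by exists P, lam.
by apply: (is_frac_pow_uniq (A := A) (s := s)) => //; apply: xgetPex; exists (P^T *m diag_mx (map_mx (pow0 s) lam) *m P).
Qed.

(* In the eigenbases P and Q the entries of A - B are (a_i - b_j) S_ij, those of
   the difference of the powers are (a_i^s - b_j^s) S_ij, with S = P Q^T. *)
Lemma spectral_map_lipschitz n (P Q : 'M[R]_n) (a b : 'rV[R]_n) (f : R -> R) (k : R) :
  P *m P^T = 1%:M -> Q *m Q^T = 1%:M -> 0 <= k ->
  (forall i j, `|f (a 0 i) - f (b 0 j)| <= k * `|a 0 i - b 0 j|) ->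
  fro (P^T *m diag_mx (map_mx f a) *m P - Q^T *m diag_mx (map_mx f b) *m Q) <=
  k * fro (P^T *m diag_mx a *m P - Q^T *m diag_mx b *m Q).
Proof.
move=> PP QQ k0 fab.
have PP' := mulmx1C PP; have QQ' := mulmx1C QQ.
have E (c d : 'rV[R]_n) : fro (P^T *m diag_mx c *m P - Q^T *m diag_mx d *m Q) =
    fro (\matrix_(i, j) ((c 0 i - d 0 j) * (P *m Q^T) i j)).
  have -> : \matrix_(i, j) ((c 0 i - d 0 j) * (P *m Q^T) i j) =
      P *m (P^T *m diag_mx c *m P - Q^T *m diag_mx d *m Q) *m Q^T.
    rewrite mulmxBr mulmxBl !mulmxA PP mul1mx -!(mulmxA _ Q Q^T) QQ mulmx1.
    rewrite -(mulmxA (diag_mx c)).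
    move: (P *m Q^T) => S; apply/matrixP => i j.
    rewrite mxE [RHS]mxE [X in _ = _ + X]mxE mul_diag_mx mul_mx_diag !mxE mulrBl.
    by congr (_ - _); rewrite mulrC.
  rewrite /fro fro2_orthogonal_r ?trmxK // fro2_orthogonal_l //.
rewrite !E -{1}[k]ger0_norm // -froZ; apply: fro2_entry_le => i j.
by rewrite !mxE !normrM mulrA ler_wpM2r // (ger0_norm k0); exact: fab.
Qed.

End FractionalPowers.

(** * Fractional powers *)

Section PowerLipschitz.
Context {R : realType}.
Implicit Types x y : R.

Lemma expR_tangent x y : expR y * (x - y) <= expR x - expR y.
Proof.
have := expR_ge1Dx (x - y); rewrite -(ler_pM2l (expR_gt0 y)) -expRD [y + _]addrC subrK.
by rewrite mulrDr mulr1; lra.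
Qed.

Lemma expR_lipschitz m x y : x <= m -> y <= m ->
  `|expR x - expR y| <= expR m * `|x - y|.
Proof.
wlog xy : x y / y <= x.
  move=> H xm ym; have [xy|/ltW xy] := leP y x; first exact: H.
  by rewrite distrC [`|x - y|]distrC H.
move=> xm ym; rewrite !ger0_norm ?subr_ge0 ?ler_expR //.
have := expR_tangent y x; rewrite -subr_ge0 => H.
have : expR x * (x - y) <= expR m * (x - y) by rewrite ler_wpM2r ?subr_ge0 // ler_expR.
lra.
Qed.

Lemma ln_lipschitz a x y : 0 < a -> a <= x -> a <= y ->
  `|ln x - ln y| <= a^-1 * `|x - y|.
Proof.
move=> a0; wlog xy : x y / y <= x.
  move=> H xm ym; have [xy|/ltW xy] := leP y x; first exact: H.
  by rewrite distrC [`|x - y|]distrC H.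
move=> ax ay; have x0 : 0 < x by apply: lt_le_trans ax.
have y0 : 0 < y by apply: lt_le_trans ay.
have lxy : ln y <= ln x by rewrite ler_ln ?posrE.
rewrite !ger0_norm ?subr_ge0 // ler_pdivlMl //.
have := expR_tangent (ln x) (ln y); rewrite !lnK ?posrE //.
by apply: le_trans; rewrite ler_wpM2r // subr_ge0.
Qed.

Lemma ln_bound a b x : 0 < a -> a <= x -> x <= b -> `|ln x| <= `|ln a| + `|ln b|.
Proof.
move=> a0 ax xb; have x0 : 0 < x by apply: lt_le_trans ax.
have b0 : 0 < b by apply: lt_le_trans xb.
have h1 : ln a <= ln x by rewrite ler_ln ?posrE.
have h2 : ln x <= ln b by rewrite ler_ln ?posrE.
have := ler_norm (ln b); have := ler_norm (- ln a); rewrite normrN.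
by rewrite ler_norml => ? ?; have := normr_ge0 (ln a); have := normr_ge0 (ln b); lra.
Qed.

Lemma powR_bounds s a b : 0 < a -> exists m M : R, [/\ 0 < m, 0 < M &
  forall x, a <= x -> x <= b -> m <= x `^ s <= M].
Proof.
move=> a0; pose l := `|s| * (`|ln a| + `|ln b|).
exists (expR (- l)), (expR l); split; rewrite ?expR_gt0 // => x ax xb.
have x0 : 0 < x by apply: lt_le_trans ax.
rewrite /powR gt_eqF // !ler_expR -ler_norml normrM ler_wpM2l //.
exact: ln_bound.
Qed.

Lemma powR_lipschitz s a b : 0 < a -> exists k : R, 0 <= k /\
  forall x y, a <= x -> x <= b -> a <= y -> y <= b -> `|x `^ s - y `^ s| <= k * `|x - y|.
Proof.
move=> a0; pose l := `|s| * (`|ln a| + `|ln b|).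
exists (expR l * (`|s| * a^-1)); split.
  by rewrite !mulr_ge0 ?expR_ge0 ?invr_ge0 // ltW.
move=> x y ax xb ay yb.
have x0 : 0 < x by apply: lt_le_trans ax.
have y0 : 0 < y by apply: lt_le_trans ay.
have le z : a <= z -> z <= b -> s * ln z <= l.
  move=> az zb; apply: le_trans (ler_norm _) _.
  by rewrite normrM ler_wpM2l // ln_bound.
rewrite /powR !gt_eqF //; apply: le_trans (expR_lipschitz (le _ ax xb) (le _ ay yb)) _.
rewrite -!mulrA ler_wpM2l ?expR_ge0 // -mulrBr normrM ler_wpM2l //.
exact: ln_lipschitz.
Qed.

(** 0 is an isolated point of the allowed set: on [a, b] the power is at most M, and M <= (M / a) x
    because x >= a. This covers every real s, even when x^s is unbounded near 0. *)
Lemma pow0_lipschitz s a b : 0 < a -> exists k : R, 0 <= k /\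
  forall x y, x = 0 \/ a <= x <= b -> y = 0 \/ a <= y <= b ->
    `|pow0 s x - pow0 s y| <= k * `|x - y|.
Proof.
move=> a0; have [k [k0 kP]] := powR_lipschitz s b a0.
have [m [M [m0 M0 mM]]] := powR_bounds s b a0.
have H x : a <= x <= b -> `|pow0 s x| <= (k + M / a) * `|x|.
  move=> /andP[ax xb]; have x0 : 0 < x by apply: lt_le_trans ax.
  have /andP[xm xM] := mM _ ax xb.
  rewrite /pow0 gt_eqF // (ger0_norm (le_trans (ltW m0) xm)) gtr0_norm //.
  apply: le_trans xM _; apply: (@le_trans _ _ (M / a * x)).
    rewrite -mulrA; apply: ler_peMr; first exact: ltW.
    by rewrite mulrC ler_pdivlMr ?mul1r.
  by rewrite ler_wpM2r ?(ltW x0) // lerDr.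
exists (k + M / a); split; first by rewrite addr_ge0 // divr_ge0 // ltW.
have p00 : pow0 s 0 = 0 :> R by rewrite /pow0 eqxx.
move=> x y [->|hx] [->|hy].
- by rewrite p00 !subrr normr0 mulr0.
- by rewrite p00 !sub0r !normrN H.
- by rewrite p00 !subr0 H.
case/andP: hx => ax xb; case/andP: hy => ay yb.
rewrite /pow0 !gt_eqF ?(lt_le_trans a0) //.
apply: le_trans (kP _ _ ax xb ay yb) _; by rewrite ler_wpM2r // lerDl divr_ge0 // ltW.
Qed.

End PowerLipschitz.

(** * Fractional powers under a spectral gap *)

Section SpectralGap.
Context {R : realType} (n : nat) (q : 'cV[R]_n).
Implicit Types A B : 'M[R]_n.

(* For q = 0 this is a lower bound on the whole spectrum. *)
Record spectral_gap (a b : R) A : Prop := {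
  gap_sym : A^T = A;
  gap_ker : A *m q = 0;
  gap_lower : forall v : 'cV[R]_n, (q^T *m v) 0 0 = 0 ->
    a * fro2 v <= (v^T *m A *m v) 0 0;
  gap_upper : fro A <= b }.

(** An eigenvector for a nonzero eigenvalue is orthogonal to the null vector q, so the lower bound
    of the gap applies to it. *)
Lemma gap_spectrum a b A : 0 < a -> spectral_gap a b A ->
  exists (P : 'M[R]_n) (lam : 'rV[R]_n), [/\ P *m P^T = 1%:M, A = P^T *m diag_mx lam *m P &
    forall i, lam 0 i = 0 \/ a <= lam 0 i <= b].
Proof.
move=> a0 [As Aq Al Au]; have [P [lam [PP AE]]] := symmetric_diagonalizable As.
exists P, lam; split => // i; pose v : 'cV[R]_n := P^T *m delta_mx i 0.
have Av : A *m v = lam 0 i *: v.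
  rewrite AE /v !mulmxA -(mulmxA _ P P^T) PP mulmx1 -!mulmxA scalemxAr; congr (_ *m _).
  by apply/colP => j; rewrite mul_diag_mx !mxE; case: eqP => [->|]; rewrite ?mulr0.
have v1 : fro2 v = 1.
  rewrite -fro2_tr fro2_trace trmxK /v trmx_mul trmxK mulmxA -(mulmxA _ P P^T) PP mulmx1.
  by rewrite trmx_delta mul_delta_mx /mxtrace big_ord1 mxE !eqxx.
have vAv : (v^T *m A *m v) 0 0 = lam 0 i.
  rewrite -mulmxA Av -scalemxAr mxE; have -> : (v^T *m v) 0 0 = fro2 v.
    by rewrite fro2_col mxE; apply: eq_bigr => j _; rewrite mxE expr2.
  by rewrite v1 mulr1.
have [->|l0] := eqVneq (lam 0 i) 0; [by left|right].
have qv : (q^T *m v) 0 0 = 0.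
  have : (q^T *m (A *m v)) 0 0 = 0.
    by rewrite mulmxA -{1}As -trmx_mul Aq trmx0 mul0mx mxE.
  by rewrite Av -scalemxAr mxE => /eqP; rewrite mulf_eq0 (negPf l0) => /eqP.
have := Al v qv; rewrite v1 mulr1 vAv => -> /=.
rewrite -vAv -mulmxA; apply: le_trans (ler_norm _) _; apply: le_trans (fro_dot _ _) _.
have f1 : fro v = 1 by rewrite /fro v1 sqrtr1.
rewrite f1 mul1r; apply: le_trans (fro_mul _ _) _; by rewrite f1 mulr1.
Qed.

Lemma gap_frac_powE s a b A : 0 < a -> spectral_gap a b A ->
  exists (P : 'M[R]_n) (lam : 'rV[R]_n), [/\ P *m P^T = 1%:M, A = P^T *m diag_mx lam *m P,
    frac_pow s A = P^T *m diag_mx (map_mx (pow0 s) lam) *m P &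
    forall i, lam 0 i = 0 \/ a <= lam 0 i <= b].
Proof.
move=> a0 gA; have [P [lam [PP AE lamP]]] := gap_spectrum a0 gA.
exists P, lam; split => //; apply: frac_powE => // i.
by case: (lamP i) => [->//|/andP[+ _]]; apply: le_trans; rewrite ltW.
Qed.

Lemma frac_pow_lipschitz s a b : 0 < a -> exists k : R, 0 <= k /\
  forall A B, spectral_gap a b A -> spectral_gap a b B ->
    fro (frac_pow s A - frac_pow s B) <= k * fro (A - B).
Proof.
move=> a0; have [k [k0 kP]] := pow0_lipschitz s b a0; exists k; split=> // A B gA gB.
have [P [l [PP -> -> lP]]] := gap_frac_powE s a0 gA.
have [Q [m [QQ -> -> mP]]] := gap_frac_powE s a0 gB.
by apply: spectral_map_lipschitz => // i j; apply: kP.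
Qed.

(** This rests on the convention 0^s = 0. Along the flow it conserves the component of u on q, that
    is, the sum of the coordinates in the Euclidean case. *)
Lemma frac_pow_ker s a b A : 0 < a -> spectral_gap a b A -> q^T *m frac_pow s A = 0.
Proof.
move=> a0 gA; have Aq := gap_ker gA.
have [P [l [PP AE -> _]]] := gap_frac_powE s a0 gA.
apply: trmx_inj; rewrite !trmx_mul !trmxK tr_diag_mx trmx0 -!mulmxA.
suff -> : diag_mx (map_mx (pow0 s) l) *m (P *m q) = 0 by rewrite mulmx0.
have : P *m (A *m q) = 0 by rewrite Aq mulmx0.
rewrite AE !mulmxA PP mul1mx -!mulmxA; move: (P *m q) => y E; apply/colP => i.
have := congr1 (fun M : 'cV_n => M i 0) E; rewrite !mul_diag_mx !mxE => /eqP.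
by rewrite mulf_eq0 => /orP[/eqP ->|/eqP ->]; rewrite ?mulr0 // /pow0 eqxx mul0r.
Qed.

Lemma frac_pow_coercive s a b : 0 < a -> exists c : R, 0 < c /\
  forall A, spectral_gap a b A -> forall v : 'cV[R]_n, (q^T *m v) 0 0 = 0 ->
    c * fro2 v <= (v^T *m frac_pow s A *m (A *m v)) 0 0.
Proof.
move=> a0; have [m [M [m0 M0 mM]]] := powR_bounds s b a0.
(* In an eigenbasis each nonzero eigenvalue contributes a power at least m, so the form is at least
   m v^T A v, and the gap bounds that by m a |v|^2. Zero eigenvalues contribute to neither sum. *)
exists (m * a); rewrite mulr_gt0 //; split=> // A gA v qv.
have lo := gap_lower gA qv.
have [P [l [PP AE fE lP]]] := gap_frac_powE s a0 gA.
rewrite -mulrA; apply: (@le_trans _ _ (m * (v^T *m A *m v) 0 0)); first by rewrite ler_pM2l.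
pose y := P *m v.
have E1 : (v^T *m A *m v) 0 0 = \sum_i l 0 i * y i 0 ^+ 2.
  have -> : v^T *m A *m v = y^T *m (diag_mx l *m y) by rewrite AE /y trmx_mul !mulmxA.
  by rewrite mxE; apply: eq_bigr => i _; rewrite mul_diag_mx !mxE; ring.
have E2 : (v^T *m frac_pow s A *m (A *m v)) 0 0 = \sum_i (pow0 s (l 0 i) * l 0 i) * y i 0 ^+ 2.
  have -> : v^T *m frac_pow s A *m (A *m v) =
      y^T *m (diag_mx (map_mx (pow0 s) l) *m (diag_mx l *m y)).
    by rewrite fE AE /y trmx_mul !mulmxA -(mulmxA _ P P^T) PP mulmx1.
  by rewrite mxE; apply: eq_bigr => i _; rewrite !mul_diag_mx !mxE; ring.
rewrite E1 E2 mulr_sumr; apply: ler_sum => i _; rewrite mulrA ler_wpM2r ?sqr_ge0 //.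
case: (lP i) => [->|/andP[al lb]]; first by rewrite !mulr0.
have l0 : 0 < l 0 i by apply: lt_le_trans al.
rewrite ler_wpM2r ?(ltW l0) // /pow0 gt_eqF //.
by have /andP[] := mM _ al lb.
Qed.

Lemma dot_fro2 (v : 'cV[R]_n) : (v^T *m v) 0 0 = fro2 v.
Proof. by rewrite fro2_col mxE; apply: eq_bigr => j _; rewrite mxE expr2. Qed.

Lemma spectral_gap_exists A : A^T = A -> A *m q = 0 ->
  (forall v : 'cV[R]_n, (q^T *m v) 0 0 = 0 -> v != 0 -> 0 < (v^T *m A *m v) 0 0) ->
  (forall v : 'cV[R]_n, 0 <= (v^T *m A *m v) 0 0) ->
  exists a, 0 < a /\ spectral_gap a (fro A) A.
Proof.
move=> As Aq Apos A0.
have [P [l [PP AE]]] := symmetric_diagonalizable As.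
have PP' := mulmx1C PP.
have formE (v : 'cV[R]_n) : (v^T *m A *m v) 0 0 = \sum_i l 0 i * (P *m v) i 0 ^+ 2.
  have -> : v^T *m A *m v = (P *m v)^T *m (diag_mx l *m (P *m v)).
    by rewrite AE trmx_mul !mulmxA.
  move: (P *m v) => y.
  by rewrite mxE; apply: eq_bigr => i _; rewrite mul_diag_mx !mxE; ring.
pose p i : 'cV[R]_n := P^T *m delta_mx i 0.
have Pp i : P *m p i = delta_mx i 0 by rewrite /p mulmxA PP mul1mx.
have l0 i : 0 <= l 0 i.
  have := A0 (p i); rewrite formE Pp (bigD1 i) //= big1 => [|j ji].
    by rewrite !mxE !eqxx expr1n mulr1 addr0.
  by rewrite mxE (negPf ji) expr0n mulr0.
(* The inverse of [b] is at most every nonzero eigenvalue; the summand 1 keeps [b] positive even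
   when there is none. *)
pose b := 1 + \sum_(i | l 0 i != 0) (l 0 i)^-1.
have b0 : 0 < b by rewrite ltr_pwDl // sumr_ge0 // => i _; rewrite invr_ge0.
exists b^-1; rewrite invr_gt0; split=> //; split => // v qv.
have -> : fro2 v = fro2 (P *m v) by rewrite fro2_orthogonal_l.
rewrite formE fro2_col mulr_sumr; apply: ler_sum => i _.
have [li0|li] := eqVneq (l 0 i) 0; last first.
  rewrite ler_wpM2r ?sqr_ge0 //.
  have lp : 0 < l 0 i by rewrite lt_def li l0.
  rewrite -[leRHS]invrK lef_pV2 ?posrE ?invr_gt0 //.
  rewrite /b (bigD1 i) //= addrCA lerDl addr_ge0 // sumr_ge0 // => j _.
  by rewrite invr_ge0.
suff -> : (P *m v) i 0 = 0 by rewrite expr0n /= !mulr0.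
have Ap : A *m p i = 0.
  rewrite AE -!mulmxA Pp; apply/colP => j; rewrite mxE big1 ?mxE // => k _.
  rewrite mul_diag_mx !mxE; case: eqP => [->|_]; last by rewrite !mulr0.
  by rewrite li0 mul0r mulr0.
(* The part of a null eigenvector orthogonal to q must vanish by [Apos], so the eigenvector is a
   multiple of q. For q = 0 the coefficient is 0, as division by 0 gives 0. *)
pose c := (q^T *m p i) 0 0 / fro2 q; pose p' := p i - c *: q.
have qp' : (q^T *m p') 0 0 = 0.
  rewrite /p' mulmxBr -scalemxAr mxE [X in _ + X]mxE [X in _ - X]mxE dot_fro2 /c.
  have [q0|q0] := eqVneq (fro2 q) 0; last by rewrite divfK // subrr.
  have -> : q = 0 by apply: fro0_eq0; rewrite /fro q0 sqrtr0.
  by rewrite trmx0 mul0mx !mxE mul0r mul0r subrr.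
have p'0 : p' = 0.
  apply/eqP/negP => /negP p'0; have := Apos _ qp' p'0.
  by rewrite /p' -mulmxA mulmxBr Ap -scalemxAr Aq scaler0 subrr mulmx0 mxE ltxx.
have -> : (P *m v) i 0 = ((p i)^T *m v) 0 0.
  by rewrite /p trmx_mul trmxK trmx_delta -mulmxA -rowE [RHS]mxE.
have -> : p i = c *: q by apply/eqP; rewrite -subr_eq0 -/p' p'0.
by rewrite linearZ /= -scalemxAl mxE qv mulr0.
Qed.

(** B annihilates the same q, so only the lower bound on the complement is at stake, and a
    perturbation of norm at most a / 2 takes away at most half of it. *)
Lemma spectral_gap_perturb a b A B : spectral_gap a b A ->
  B^T = B -> B *m q = 0 -> fro (B - A) <= a / 2 -> fro (B - A) <= 1 ->
  spectral_gap (a / 2) (b + 1) B.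
Proof.
move=> [As Aq Al Au] Bs Bq BA BA1; split => // [v qv|]; last first.
  by rewrite -[B](subrK A) addrC; apply: le_trans (froD _ _) _; rewrite lerD.
have -> : (v^T *m B *m v) 0 0 = (v^T *m A *m v) 0 0 + (v^T *m ((B - A) *m v)) 0 0.
  by rewrite mulmxBl mulmxBr !mulmxA [X in _ = _ + X]mxE [X in _ = _ + (_ + X)]mxE addrC subrK.
have := Al v qv.
have : `|(v^T *m ((B - A) *m v)) 0 0| <= a / 2 * fro2 v.
  apply: le_trans (fro_dot _ _) _; rewrite -fro_sqr expr2 mulrCA ler_wpM2l ?fro_ge0 //.
  apply: le_trans (fro_mul _ _) _; by rewrite ler_wpM2r ?fro_ge0.
by rewrite ler_norml => /andP[+ _]; lra.
Qed.

End SpectralGap.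

(** * One-sided derivatives and integral equations *)

Section Calculus.
Context {R : realType}.
Implicit Types (f g : R -> R) (t d : R).

Lemma within_dnbhsP (J : set R) f t d :
  f x @[x --> within J t^'] --> d <->
  (forall e, 0 < e -> exists2 del, 0 < del &
     forall x, J x -> x != t -> `|x - t| < del -> `|f x - d| < e).
Proof.
split=> [/cvgrPdist_lt fd e e0|H].
  have /nbhs_ballP[del /= del0 H] : nbhs t (fun x => x != t -> J x -> `|d - f x| < e) := fd e e0.
  exists del => // x Jx xt xdel.
  by rewrite distrC; apply: H => //=; rewrite /ball /= distrC.
apply/cvgrPdist_lt => e e0; have [del del0 H'] := H e e0.
suff : nbhs t (fun x => x != t -> J x -> `|d - f x| < e) by [].
apply/nbhs_ballP; exists del => //= x xdel xt Jx.
by rewrite distrC; apply: H' => //; rewrite distrC.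
Qed.

Lemma is_derive1P f t d : is_derive t 1 f d <->
  (forall e, 0 < e -> exists2 del, 0 < del &
     forall x, x != t -> `|x - t| < del -> `|(f x - f t) / (x - t) - d| < e).
Proof.
have E : (fun h => h^-1 *: (f (h *: 1 + t) - f t)) @ 0^' --> d <->
  (forall e, 0 < e -> exists2 del, 0 < del &
     forall x, x != t -> `|x - t| < del -> `|(f x - f t) / (x - t) - d| < e).
  split=> [/cvgrPdist_lt fd e e0|H].
    have /nbhs_ballP[del /= del0 H] : nbhs (0 : R) (fun h : R => h != 0 ->
      `|d - h^-1 *: (f (h *: 1 + t) - f t)| < e) := fd e e0.
    exists del => // x xt xdel.
    rewrite distrC; have := H (x - t); rewrite /ball /= sub0r normrN => /(_ xdel).
    rewrite subr_eq0 => /(_ xt); rewrite /GRing.scale /= mulr1 subrK.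
    by rewrite [_^-1 * _]mulrC.
  apply/cvgrPdist_lt => e e0; have [del del0 H'] := H e e0.
  suff : nbhs (0 : R) (fun h : R => h != 0 -> `|d - h^-1 *: (f (h *: 1 + t) - f t)| < e) by [].
  apply/nbhs_ballP; exists del => //= h.
  rewrite /ball /= sub0r normrN => hdel h0; rewrite distrC.
  have := H' (h + t); rewrite addrK => /(_ _ hdel).
  rewrite -subr_eq0 addrK => /(_ h0).
  by rewrite /GRing.scale /= mulr1 [_^-1 * _]mulrC.
rewrite -E; split=> [[df <-]|fd].
  by move: df; rewrite /derivable /derive => df; apply: df.
apply: DeriveDef; first by apply/cvg_ex; exists d.
exact: cvg_lim fd.
Qed.

Lemma is_derive1_within (J : set R) f t d : is_derive t 1 f d ->
  (fun r => (f r - f t) / (r - t)) @ within J t^' --> d.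
Proof.
move=> /is_derive1P H; apply/within_dnbhsP => e /H[del del0 {}H]; exists del => // x _.
exact: H.
Qed.

Lemma within_is_derive1 (J : set R) f t d r : 0 < r ->
  (forall x, `|x - t| < r -> J x) ->
  (fun x => (f x - f t) / (x - t)) @ within J t^' --> d -> is_derive t 1 f d.
Proof.
move=> r0 Jr /within_dnbhsP H; apply/is_derive1P => e /H[del del0 {}H].
exists (Num.min del r); first by rewrite lt_min del0 r0.
by move=> x xt; rewrite lt_min => /andP[xd xr]; apply: H => //; exact: Jr.
Qed.

(* Extending by the tangent on the left turns a right derivative into a derivative. *)
Lemma within_is_derive1_extend (J : set R) f t d r : 0 < r ->
  (forall x, t <= x < t + r -> J x) ->
  (fun x => (f x - f t) / (x - t)) @ within J t^' --> d ->
  is_derive t 1 (fun x => if x < t then f t + d * (x - t) else f x) d.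
Proof.
move=> r0 Jr /within_dnbhsP H; apply/is_derive1P => e e0; have [del del0 {}H] := H e e0.
exists (Num.min del r); first by rewrite lt_min del0 r0.
move=> x xt; rewrite lt_min ltxx => /andP[xd xr]; case: (ltP x t) => [xt'|tx].
  have -> : f t + d * (x - t) - f t = d * (x - t) by ring.
  by rewrite mulfK ?subr_eq0 // subrr normr0.
apply: H => //; apply: Jr; rewrite tx /= -ltrBlDl; exact: le_lt_trans (ler_norm _) xr.
Qed.

Lemma is_derive1_near f g t d r : 0 < r -> (forall x, `|x - t| < r -> f x = g x) ->
  is_derive t 1 f d -> is_derive t 1 g d.
Proof.
move=> r0 fg /is_derive1P H; apply/is_derive1P => e /H[del del0 {}H].
exists (Num.min del r); first by rewrite lt_min del0 r0.
move=> x xt; rewrite lt_min => /andP[xd xr].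
by rewrite -!fg ?subrr ?normr0 //; apply: H.
Qed.

(** The sign of [df] is asked for before b only: in the uniqueness proof b is an exit time, and the
    estimates are available strictly before it. *)
Lemma le_of_derive_le0 (f df : R -> R) (a b : R) : a <= b ->
  (forall x, a <= x <= b -> is_derive x 1 f (df x)) ->
  (forall x, a <= x < b -> df x <= 0) -> f b <= f a.
Proof.
rewrite le_eqVlt => /predU1P[->//|ab] fd df0.
have H1 x : x \in `]a, b[%R -> is_derive x 1 f (df x).
  by rewrite in_itv /= => /andP[/ltW ax /ltW xb]; apply: fd; rewrite ax xb.
have H2 : {within `[a, b], continuous f}.
  apply: derivable_within_continuous => x; rewrite in_itv /= => xab.
  by have [] := fd x xab.
have [x xab fE] := MVT ab H1 H2.
move: xab; rewrite in_itv /= => /andP[/ltW ax xb].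
by rewrite -subr_le0 fE mulr_le0_ge0 ?subr_ge0 ?(ltW ab) // df0 // ax.
Qed.

Lemma expR_scale_derive (k c t : R) :
  is_derive t 1 (fun s => c * expR (k * s)) (k * (c * expR (k * t))).
Proof.
have D : is_derive t 1 (fun s : R => k * s) k.
  by apply: is_derive_eq (is_deriveZ k (is_derive_id t (1 : R))) _; rewrite /GRing.scale /= mulr1.
have D2 := is_derive1_comp (is_derive_expR (k * t)) D.
have D3 := is_deriveZ c D2.
by apply: is_derive_eq D3 _; rewrite /GRing.scale /=; ring.
Qed.

(* Integral from 0 to t; the base point -1 makes it differentiable at 0 too. *)
Definition primitive f t : R :=
  \int[lebesgue_measure]_(x in `[-1, t]) f x - \int[lebesgue_measure]_(x in `[-1, 0]) f x.

Lemma primitive0 f : primitive f 0 = 0.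
Proof. exact: subrr. Qed.

Lemma is_derive_primitive f t : continuous f -> -1 < t -> is_derive t 1 (primitive f) (f t).
Proof.
move=> cf t1; have itf : lebesgue_measure.-integrable `[-1, t + 1] (EFin \o f).
  apply: continuous_compact_integrable; first exact: segment_compact.
  exact: continuous_subspaceT.
have t1' : t < t + 1 by rewrite ltrDl.
have [D E] := continuous_FTC1_closed t1' itf t1 (cf t).
have D' : is_derive t 1 (fun x => \int[lebesgue_measure]_(x in `[-1, x]) f x) (f t).
  by apply: DeriveDef; [exact: D|rewrite -derive1E; exact: E].
by apply: is_derive_eq (is_deriveB D' (is_derive_cst _ _ _)) _; rewrite subr0.
Qed.

(** Estimate in an exponentially weighted norm (Bielecki's device): integration gains a factor 1 /
    k, so a large k beats any Lipschitz constant on the whole half-line at once. *)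
Lemma primitive_le f g (h : R -> R) (k c t : R) : continuous f -> continuous g -> 0 < k -> 0 <= t -> 0 <= c ->
  (forall s, 0 <= s -> `|f s - g s| <= k * (c * expR (k * s))) ->
  `|primitive f t - primitive g t| <= c * expR (k * t).
Proof.
move=> cf cg k0 t0 c0 fg.
have D s : 0 <= s <= t -> is_derive s 1 (fun x => primitive f x - primitive g x) (f s - g s).
  move=> /andP[s0 _]; have s1 : -1 < s by lra.
  exact: is_deriveB (is_derive_primitive cf s1) (is_derive_primitive cg s1).
have H (a : R) : `|a| = 1 -> a * (primitive f t - primitive g t) <= c * expR (k * t).
  move=> a1; have := @le_of_derive_le0 (fun x => a * (primitive f x - primitive g x) - c * expR (k * x))
     (fun s => a * (f s - g s) - k * (c * expR (k * s))) 0 t t0 _ _.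
  rewrite !primitive0 subrr mulr0 sub0r mulr0 expR0 mulr1 => H.
  rewrite -subr_le0; apply: le_trans (H _ _) _; last by rewrite oppr_le0.
  - move=> s st; exact: is_deriveB (is_deriveZ a (D s st)) (expR_scale_derive k c s).
  - move=> s /andP[s0 _]; rewrite subr_le0; apply: le_trans (fg s s0).
    by apply: le_trans (ler_norm _) _; rewrite normrM a1 mul1r.
rewrite ler_norml; apply/andP; split; last by have := H 1 (normr1 _); rewrite mul1r.
by rewrite lerNl; have := H (-1); rewrite normrN1 mulN1r; apply.
Qed.

Lemma lipschitz_continuous f (k : R) :
  (forall s t, `|f s - f t| <= k * `|s - t|) -> continuous f.
Proof.
move=> fk t; apply/cvgrPdist_lt => e e0.
have k0 : 0 < `|k| + 1 by rewrite ltr_wpDl.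
suff : nbhs t (fun s => `|f t - f s| < e) by [].
apply/nbhs_ballP; exists (e / (`|k| + 1)) => /=; first by rewrite divr_gt0.
move=> s; rewrite /ball /= => ts; apply: le_lt_trans (fk _ _) _.
apply: (@le_lt_trans _ _ ((`|k| + 1) * `|t - s|)).
  by rewrite ler_wpM2r // (le_trans (ler_norm _)) // lerDl.
by rewrite mulrC -ltr_pdivlMr.
Qed.

Lemma primitive_lipschitz f (B s t : R) : continuous f -> 0 <= s -> 0 <= t ->
  (forall x, `|f x| <= B) -> `|primitive f s - primitive f t| <= B * `|s - t|.
Proof.
move=> cf; wlog st : s t / t <= s.
  move=> H s0 t0 fB; have [ts|/ltW st] := leP t s; first exact: H.
  by rewrite distrC [`|s - t|]distrC; apply: H.
move=> s0 t0 fB; rewrite [`|s - t|]ger0_norm ?subr_ge0 //.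
have H (a : R) : `|a| = 1 -> a * (primitive f s - primitive f t) <= B * (s - t).
  move=> a1; have := @le_of_derive_le0 (fun x => a * primitive f x - B * x)
     (fun s => a * f s - B * 1) t s st.
  move=> H; rewrite -subr_le0.
  have -> : a * (primitive f s - primitive f t) - B * (s - t) =
    (a * primitive f s - B * s) - (a * primitive f t - B * t) by ring.
  rewrite subr_le0; apply: H => x /andP[tx _].
    have x1 : -1 < x by lra.
    exact: is_deriveB (is_deriveZ a (is_derive_primitive cf x1)) (is_deriveZ B (is_derive_id x 1)).
  rewrite mulr1 subr_le0; apply: le_trans (fB x).
  by apply: le_trans (ler_norm _) _; rewrite normrM a1 mul1r.
rewrite ler_norml; apply/andP; split; last by have := H 1 (normr1 _); rewrite mul1r.
by rewrite lerNl; have := H (-1); rewrite normrN1 mulN1r; apply.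
Qed.

End Calculus.

Section GeometricCauchy.
Context {R : realType}.

Lemma le_geometric (x y c : R) : (forall n, x <= y + c / 2 ^+ n) -> x <= y.
Proof.
move=> H; have [//|yx] := leP x y; exfalso.
have c0 : 0 < c.
  by have := H 0%N; rewrite expr0 divr1; lra.
have [n nP] : exists n, c / (x - y) < n%:R.
  by exists (Num.bound (c / (x - y))); apply: archi_boundP; rewrite divr_ge0 //; lra.
have n2 : n%:R <= 2 ^+ n :> R by rewrite -natrX ler_nat ltnW // ltn_expl.
have := H n; apply/negP; rewrite -ltNge -ltrBrDl.
rewrite ltr_pdivrMr ?exprn_gt0 // mulrC -ltr_pdivrMr ?subr_gt0 //.
exact: lt_le_trans nP n2.
Qed.

(** The intervals with center a n and radius the tail of the geometric series are nested; the
    supremum of their left ends lies in all of them. *)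
Lemma geometric_limit (a : nat -> R) (c : R) : 0 <= c ->
  (forall n, `|a n.+1 - a n| <= c / 2 ^+ n) ->
  exists l, forall n, `|l - a n| <= 2 * c / 2 ^+ n.
Proof.
move=> c0 ac; pose r n := 2 * c / 2 ^+ n.
have rS n : r n.+1 = r n - c / 2 ^+ n.
  have p0 : (2 ^+ n : R) != 0 by rewrite expf_neq0.
  by rewrite /r exprS; field; rewrite p0.
have lo n m : a n - r n <= a (n + m)%N - r (n + m)%N.
  elim: m => [|m IH]; first by rewrite addn0.
  apply: le_trans IH _; rewrite addnS rS.
  by have := ac (n + m)%N; rewrite ler_norml => /andP[+ _]; lra.
have hi n m : a (n + m)%N + r (n + m)%N <= a n + r n.
  elim: m => [|m IH]; first by rewrite addn0.
  apply: le_trans IH; rewrite addnS rS.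
  by have := ac (n + m)%N; rewrite ler_norml => /andP[_ +]; lra.
have r0 n : 0 <= r n by rewrite divr_ge0 ?mulr_ge0 ?exprn_ge0.
have lh n m : a n - r n <= a m + r m.
  apply: le_trans (lo n m) _; apply: le_trans _ (hi m n); rewrite addnC.
  by have := r0 (n + m)%N; rewrite addnC; lra.
pose S := [set x | exists n, x = a n - r n].
have Sub m : ubound S (a m + r m) by move=> _ [n ->].
have S0 : S !=set0 by exists (a 0%N - r 0%N), 0%N.
exists (sup S) => n; rewrite -/(r n).
have h1 : a n - r n <= sup S.
  by apply: ub_le_sup; [exists (a 0%N + r 0%N); exact: Sub | exists n].
have h2 : sup S <= a n + r n by apply: ge_sup.
by rewrite ler_norml; apply/andP; split; lra.
Qed.

End GeometricCauchy.

(** * Picard iteration for a bounded, globally Lipschitz field *)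

Section Picard.
Context {R : realType} (n : nat).
Local Notation E := 'cV[R]_n.
Variables (G : E -> E) (L B : R) (u0 : E).
Hypothesis L_ge0 : 0 <= L.
Hypothesis B_ge0 : 0 <= B.
Hypothesis G_lipschitz : forall u v, fro (G u - G v) <= L * fro (u - v).
Hypothesis G_bounded : forall u, fro (G u) <= B.

(** Freezing the iterates at negative times makes them Lipschitz on the whole line, so that the
    integrands are continuous everywhere. *)
Let pos (t : R) := Num.max t 0.

Definition picard_step (y : R -> E) (t : R) : E :=
  u0 + \col_i primitive (fun s => G (y s) i 0) (pos t).

Definition picard_iter k : R -> E := iter k picard_step (fun=> u0).

Let pos_ge0 t : 0 <= pos t. Proof. by rewrite /pos le_max lexx orbT. Qed.

Let pos_lip s t : `|pos s - pos t| <= `|s - t|.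
Proof.
rewrite /pos; case: (leP s 0) => hs; case: (leP t 0) => ht; rewrite ?subrr ?normr0 //.
- by rewrite sub0r normrN gtr0_norm // ler0_norm; lra.
- by rewrite subr0 gtr0_norm // gtr0_norm; lra.
Qed.

Let lip (y : R -> E) := forall s t i, `|y s i 0 - y t i 0| <= B * `|s - t|.

Let fro_coords_le (v : E) c : (forall i, `|v i 0| <= c) -> fro v <= n%:R * c.
Proof.
move=> vc; apply: le_trans (fro_le_sum _) _.
rewrite (eq_bigr (fun i => `|v i 0|)) => [|i _]; last by rewrite big_ord1.
by apply: le_trans (ler_sum _ (fun i _ => vc i)) _; rewrite sumr_const card_ord mulr_natl.
Qed.

Let lip_continuous y i : lip y -> continuous (fun s => G (y s) i 0).
Proof.
move=> ly; apply: (@lipschitz_continuous _ _ (L * (n%:R * B))) => s t.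
have -> : G (y s) i 0 - G (y t) i 0 = (G (y s) - G (y t)) i 0 by rewrite !mxE.
apply: le_trans (fro_coord _ _ _) _; apply: le_trans (G_lipschitz _ _) _.
rewrite -!mulrA ler_wpM2l //; apply: fro_coords_le => j.
by rewrite !mxE; exact: ly.
Qed.

Let G_coord u i : `|G u i 0| <= B.
Proof. exact: le_trans (fro_coord _ _ _) (G_bounded u). Qed.

Let step_lip y : lip y -> lip (picard_step y).
Proof.
move=> ly s t i; rewrite !mxE opprD addrACA subrr add0r.
apply: le_trans (primitive_lipschitz (lip_continuous ly) (pos_ge0 s) (pos_ge0 t)
  (fun x => G_coord (y x) i)) _.
by rewrite ler_wpM2l // pos_lip.
Qed.

Let iter_lip k : lip (picard_iter k).
Proof.
elim: k => [|k IH]; last exact: step_lip.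
by move=> s t i; rewrite subrr normr0 mulr_ge0.
Qed.

(** The factor n is lost in passing from coordinates to the norm, the factor 2 yields the
    contraction constant 1/2, and the summand 1 keeps K positive when L = 0. *)
Let K := 2 * (n%:R * L + 1).
Let K_gt0 : 0 < K.
Proof. by rewrite mulr_gt0 // ltr_wpDl // mulr_ge0. Qed.

Let step_contract (y z : R -> E) c : lip y -> lip z -> 0 <= c ->
  (forall t, 0 <= t -> fro (y t - z t) <= c * expR (K * t)) ->
  forall t, fro (picard_step y t - picard_step z t) <= c / 2 * expR (K * pos t).
Proof.
move=> ly lz c0 yz t.
have Lc0 : 0 <= L * c / K by apply: divr_ge0; [exact: mulr_ge0|exact: ltW].
apply: (@le_trans _ _ (n%:R * (L * c / K * expR (K * pos t)))).
  apply: fro_coords_le => i; rewrite !mxE opprD addrACA subrr add0r.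
  apply: primitive_le => //; try exact: lip_continuous.
  move=> s s0; have -> : G (y s) i 0 - G (z s) i 0 = (G (y s) - G (z s)) i 0 by rewrite !mxE.
  apply: le_trans (fro_coord _ _ _) _; apply: le_trans (G_lipschitz _ _) _.
  have -> : K * (L * c / K * expR (K * s)) = L * (c * expR (K * s)) by field; rewrite gt_eqF.
  by rewrite ler_wpM2l // yz.
rewrite mulrA ler_wpM2r ?expR_ge0 // mulrA ler_pdivrMr //.
have -> : c / 2 * K = c * (n%:R * L + 1) by rewrite /K; field.
have : 0 <= c * 1 by rewrite mulr1.
by lra.
Qed.

Let C := n%:R * B.
Let C_ge0 : 0 <= C. Proof. by rewrite mulr_ge0. Qed.

Let iter_cauchy k t : fro (picard_iter k.+1 t - picard_iter k t) <= C / 2 ^+ k * expR (K * pos t).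
Proof.
elim: k t => [|k IH] t.
  rewrite expr0 divr1 /picard_iter /= /picard_step addrC addKr.
  rewrite /C -mulrA; apply: fro_coords_le => i; rewrite mxE.
  have := primitive_lipschitz (lip_continuous (i := i) (@iter_lip 0%N)) (pos_ge0 t) (lexx 0) (fun x => G_coord u0 i).
  rewrite primitive0 !subr0 [`|pos t|]ger0_norm // => /le_trans; apply.
  rewrite ler_wpM2l // (le_trans _ (expR_ge1Dx _)) //.
  have : 1 * pos t <= K * pos t.
    rewrite ler_wpM2r // /K; have : 0 <= n%:R * L by rewrite mulr_ge0.
    by lra.
  by lra.
have -> : C / 2 ^+ k.+1 = C / 2 ^+ k / 2.
  have p0 : (2 ^+ k : R) != 0 by rewrite expf_neq0.
  by rewrite exprS; field; rewrite p0.
have c0 : 0 <= C / 2 ^+ k by rewrite divr_ge0 // exprn_ge0.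
apply: (step_contract (@iter_lip k.+1) (@iter_lip k) c0) => s s0; apply: le_trans (IH s) _.
by rewrite /pos (max_idPl s0).
Qed.

Theorem picard : exists z : R -> E, z 0 = u0 /\
  forall (t : R) i, 0 <= t -> is_derive t 1 (fun s : R => z s i 0) (G (z t) i 0).
Proof.
have lim t i : exists l, forall k, `|l - picard_iter k t i 0| <= 2 * (C * expR (K * pos t)) / 2 ^+ k.
  apply: geometric_limit; first by rewrite mulr_ge0 ?expR_ge0.
  move=> k; have -> : picard_iter k.+1 t i 0 - picard_iter k t i 0 =
    (picard_iter k.+1 t - picard_iter k t) i 0 by rewrite !mxE.
  apply: le_trans (fro_coord _ _ _) _; apply: le_trans (iter_cauchy k t) _.
  by rewrite mulrAC.
pose y t : E := \col_i xget 0 [set l | forall k, `|l - picard_iter k t i 0| <= 2 * (C * expR (K * pos t)) / 2 ^+ k].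
have yP t i k : `|y t i 0 - picard_iter k t i 0| <= 2 * (C * expR (K * pos t)) / 2 ^+ k.
  rewrite mxE; exact: (@xgetPex _ 0 [set l | forall k, `|l - picard_iter k t i 0| <=
      2 * (C * expR (K * pos t)) / 2 ^+ k] (lim t i)).
have ly : lip y.
  move=> s t i; apply: (@le_geometric _ _ _ (2 * (C * expR (K * pos s)) + 2 * (C * expR (K * pos t)))) => k.
  have := yP s i k; have := yP t i k; have := @iter_lip k s t i.
  set a := y s i 0; set b := y t i 0; set c := picard_iter k s i 0; set d := picard_iter k t i 0.
  move=> h1 h2 h3.
  have -> : a - b = (a - c) + (c - d) + (d - b) by ring.
  apply: le_trans (ler_normD _ _) _; rewrite [`|d - b|]distrC.
  have := ler_normD (a - c) (c - d); rewrite mulrDl; lra.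
have yE t : y t = picard_step y t.
  apply/colP => i; apply/eqP; rewrite -subr_eq0 -normr_le0.
  pose M := 2 * (C * expR (K * pos t)).
  apply: (@le_geometric _ _ _ (M * 2^-1 + n%:R * (2 * C) * 2^-1 * expR (K * pos t))) => k.
  rewrite add0r.
  have h1 := yP t i k.+1.
  have h2 : `|picard_iter k.+1 t i 0 - picard_step y t i 0| <=
      n%:R * (2 * C) / 2 ^+ k / 2 * expR (K * pos t).
    have c0 : 0 <= n%:R * (2 * C) / 2 ^+ k by rewrite divr_ge0 ?mulr_ge0 ?exprn_ge0.
    have -> : picard_iter k.+1 t i 0 - picard_step y t i 0 =
      (picard_step (picard_iter k) t - picard_step y t) i 0 by rewrite !mxE.
    apply: le_trans (fro_coord _ _ _) _; apply: (step_contract (@iter_lip k) ly c0).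
    move=> s s0; have -> : n%:R * (2 * C) / 2 ^+ k * expR (K * s) =
        n%:R * (2 * (C * expR (K * s)) / 2 ^+ k) by ring.
    apply: fro_coords_le => j; rewrite mxE mxE distrC.
    by have := yP s j k; rewrite /pos (max_idPl s0).
  have p0 : (2 ^+ k : R) != 0 by rewrite expf_neq0.
  have -> : (M / 2 + n%:R * (2 * C) / 2 * expR (K * pos t)) / 2 ^+ k =
    M / 2 ^+ k.+1 + n%:R * (2 * C) / 2 ^+ k / 2 * expR (K * pos t).
    by rewrite exprS; field; rewrite p0.
  rewrite -(subrKA (picard_iter k.+1 t i 0)); apply: le_trans (ler_normD _ _) _.
  by rewrite lerD.
(* [pos] is dropped here: it would create a corner at 0, where a two-sided derivative is claimed. *)
exists (fun t => u0 + \col_i primitive (fun s => G (y s) i 0) t); split.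
  by apply/colP => i; rewrite !mxE primitive0 addr0.
move=> t i t0.
have zy : u0 + \col_i primitive (fun s => G (y s) i 0) t = y t.
  by rewrite [RHS]yE /picard_step /pos (max_idPl t0).
rewrite zy; have t1 : -1 < t by lra.
have D := is_derive_primitive (lip_continuous (i := i) ly) t1.
apply: (is_derive1_near (f := fun s => u0 i 0 + primitive (fun s => G (y s) i 0) s) ltr01).
  by move=> x _; rewrite !mxE.
by apply: is_derive_eq (is_deriveD (is_derive_cst _ _ _) D) _; rewrite add0r.
Qed.

End Picard.

(** * Dissipative flows on a ball *)

Section Cutoff.
Context {R : realType} (n : nat).
Local Notation E := 'cV[R]_n.
Variables (ubar : E) (r : R).
Hypothesis r_gt0 : 0 < r.

Definition ball_scale (u : E) : R := r / Num.max r (fro (u - ubar)).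

(** Radial retraction onto the closed ball. Composed with it, a field that is Lipschitz on the ball
    becomes bounded and globally Lipschitz, and [picard] gives a solution for all time without a
    continuation argument. *)
Definition ball_retract (u : E) : E := ubar + ball_scale u *: (u - ubar).

Let max_gt0 u : 0 < Num.max r (fro (u - ubar)).
Proof. by rewrite lt_max r_gt0. Qed.

Lemma ball_scale_gt0 u : 0 < ball_scale u.
Proof. by rewrite divr_gt0. Qed.

Lemma ball_retract_in u : fro (ball_retract u - ubar) <= r.
Proof.
rewrite /ball_retract addrC addKr froZ gtr0_norm ?ball_scale_gt0 // /ball_scale.
by rewrite mulrAC ler_pdivrMr // ler_wpM2l ?(ltW r_gt0) // le_max lexx orbT.
Qed.

Lemma ball_retract_id u : fro (u - ubar) <= r -> ball_retract u = u.
Proof.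
move=> ur; rewrite /ball_retract /ball_scale (max_idPl ur) divff ?gt_eqF // scale1r.
by rewrite addrC subrK.
Qed.

Lemma ball_retract_lipschitz u v :
  fro (ball_retract u - ball_retract v) <= 2 * fro (u - v).
Proof.
rewrite /ball_retract opprD addrACA subrr add0r /ball_scale.
set w := u - ubar; set x := v - ubar.
have wx : u - v = w - x by rewrite /w /x opprB addrA subrK.
rewrite wx; set a := Num.max r (fro w); set b := Num.max r (fro x).
have a0 : 0 < a by exact: max_gt0.
have b0 : 0 < b by exact: max_gt0.
have fwx : `|fro w - fro x| <= fro (w - x).
  rewrite ler_norml lerNl opprB; apply/andP; split.
    by rewrite lerBlDr -(froN (w - x)) opprB; apply: le_trans (froD _ _); rewrite subrK.
  by rewrite lerBlDr; apply: le_trans (froD _ _); rewrite subrK.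
have ab : `|b - a| <= fro (w - x).
  apply: le_trans fwx; rewrite /a /b.
  case: (leP r (fro w)) => h1; case: (leP r (fro x)) => h2; rewrite ?subrr ?normr0 //.
  - by rewrite distrC.
  - have := ler_norm (fro w - fro x); rewrite ler_norml; set m := `|_|.
    by move=> ?; apply/andP; split; lra.
  - have := ler_norm (fro x - fro w); rewrite [`|fro x - fro w|]distrC ler_norml; set m := `|_|.
    by move=> ?; apply/andP; split; lra.
(* Each of the two terms has norm at most that of w - x, hence the constant 2. *)
have -> : (r / a) *: w - (r / b) *: x = (r / a) *: (w - x) + (r * (b - a) / (a * b)) *: x.
  rewrite [in RHS]scalerBr -addrA; congr (_ + _).
  rewrite -[LHS]scaleNr -[X in _ = X + _]scaleNr -scalerDl; congr (_ *: _).
  by field; rewrite !gt_eqF.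
apply: le_trans (froD _ _) _; rewrite !froZ mulrDl mul1r lerD //.
  rewrite gtr0_norm ?divr_gt0 // ler_piMl ?fro_ge0 // ler_pdivrMr // mul1r.
  by rewrite le_max lexx.
have -> : `|r * (b - a) / (a * b)| = r * `|b - a| / (a * b).
  by rewrite normrM (gtr0_norm (x := (a * b)^-1)) ?invr_gt0 ?mulr_gt0 // normrM (gtr0_norm r_gt0).
have -> : r * `|b - a| / (a * b) * fro x = `|b - a| * ((r / a) * (fro x / b)).
  by field; rewrite !gt_eqF.
apply: le_trans ab; rewrite ler_piMr // mulr_ile1 //.
- by apply: divr_ge0; exact: ltW.
- by apply: divr_ge0; [exact: fro_ge0|exact: ltW].
- by rewrite ler_pdivrMr // mul1r le_max lexx.
- by rewrite ler_pdivrMr // mul1r le_max lexx orbT.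
Qed.

End Cutoff.

Section Energy.
Context {R : realType} (n : nat).
Local Notation E := 'cV[R]_n.

Lemma is_derive_dot (q : E) (z : R -> E) (dz : E) (t : R) :
  (forall i, is_derive t 1 (fun s : R => z s i 0) (dz i 0)) ->
  is_derive t 1 (fun s : R => (q^T *m z s) 0 0) ((q^T *m dz) 0 0).
Proof.
move=> D; have -> : (fun s : R => (q^T *m z s) 0 0) = \sum_i (fun s : R => q i 0 * z s i 0).
  apply/funext => s; rewrite mxE fct_sumE; apply: eq_bigr => i _; by rewrite mxE.
have -> : (q^T *m dz) 0 0 = \sum_i q i 0 *: dz i 0.
  by rewrite mxE; apply: eq_bigr => i _; rewrite mxE.
apply: is_derive_sum => i; exact: is_deriveZ.
Qed.

Lemma is_derive_fro2 (z : R -> E) (dz : E) (t : R) :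
  (forall i, is_derive t 1 (fun s : R => z s i 0) (dz i 0)) ->
  is_derive t 1 (fun s : R => fro2 (z s)) (2 * ((z t)^T *m dz) 0 0).
Proof.
move=> D; have -> : (fun s : R => fro2 (z s)) = \sum_i (fun s : R => z s i 0 * z s i 0).
  apply/funext => s; rewrite fro2_col fct_sumE; apply: eq_bigr => i _; by rewrite expr2.
have -> : 2 * ((z t)^T *m dz) 0 0 = \sum_i (z t i 0 *: dz i 0 + z t i 0 *: dz i 0).
  rewrite mxE mulr_sumr; apply: eq_bigr => i _; rewrite mxE /GRing.scale /=; ring.
apply: is_derive_sum => i; exact: is_deriveM.
Qed.

(** Gronwall's inequality. A negative k gives the rate of convergence, a nonnegative one gives
    uniqueness. *)
Lemma energy_decay (e de : R -> R) (k a b : R) : a <= b ->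
  (forall t : R, a <= t <= b -> is_derive t 1 e (de t)) ->
  (forall t, a <= t < b -> de t <= k * e t) ->
  e b * expR (- k * b) <= e a * expR (- k * a).
Proof.
move=> ab De lek.
apply: (@le_of_derive_le0 _ (fun s => e s * expR (- k * s))
  (fun s => expR (- k * s) * (de s - k * e s)) _ _ ab) => t tab; last first.
  by rewrite pmulr_rle0 ?expR_gt0 // subr_le0 lek.
have D2 : is_derive t 1 (fun s : R => expR (- k * s)) (- k * expR (- k * t)).
  have := expR_scale_derive (- k) 1 t; rewrite mul1r.
  by rewrite (_ : (fun s => 1 * _) = (fun s => expR (- k * s))) //; apply/funext => s; rewrite mul1r.
apply: is_derive_eq (is_deriveM (De t tab) D2) _.
by rewrite /GRing.scale /=; ring.
Qed.

End Energy.

Section DissipativeFlow.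
Context {R : realType} (n : nat).
Local Notation E := 'cV[R]_n.
Variables (G : E -> E) (ubar q : E) (r L c : R).
Hypothesis r_gt0 : 0 < r.
Hypothesis L_ge0 : 0 <= L.
Hypothesis c_gt0 : 0 < c.
Hypothesis G_lipschitz : forall u v, fro (u - ubar) <= r -> fro (v - ubar) <= r ->
  fro (G u - G v) <= L * fro (u - v).
Hypothesis G_tangent : forall u, fro (u - ubar) <= r -> (q^T *m G u) 0 0 = 0.
Hypothesis G_dissipative : forall u, fro (u - ubar) <= r -> (q^T *m (u - ubar)) 0 0 = 0 ->
  ((u - ubar)^T *m G u) 0 0 <= - c * fro2 (u - ubar).

Let GG u := G (ball_retract ubar r u).

Let GG_lipschitz u v : fro (GG u - GG v) <= L * 2 * fro (u - v).
Proof.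
apply: le_trans (G_lipschitz (ball_retract_in _ r_gt0 _) (ball_retract_in _ r_gt0 _)) _.
by rewrite -mulrA ler_wpM2l // ball_retract_lipschitz.
Qed.

Let GG_bounded u : fro (GG u) <= fro (G ubar) + L * r.
Proof.
have h0 : fro (ubar - ubar) <= r by rewrite subrr fro0 ltW.
have hu := ball_retract_in ubar r_gt0 u.
rewrite -(subrK (G ubar) (GG u)) addrC; apply: le_trans (froD _ _) _; rewrite lerD2l.
by apply: le_trans (G_lipschitz hu h0) _; rewrite ler_wpM2l.
Qed.

(* Radial retraction keeps the sign of the dissipation outside the ball too. *)
Let cutoff_solution u0 : fro (u0 - ubar) < r -> (q^T *m (u0 - ubar)) 0 0 = 0 ->
  exists z : R -> E, [/\ z 0 = u0,
    forall (t : R) i, 0 <= t -> is_derive t 1 (fun s : R => z s i 0) (G (z t) i 0),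
    forall t, 0 <= t -> fro (z t - ubar) <= fro (u0 - ubar) &
    forall t, 0 <= t -> (q^T *m (z t - ubar)) 0 0 = 0].
Proof.
move=> u0r qu0.
have [z [z0 dz]] : exists z : R -> E, z 0 = u0 /\
    forall (t : R) i, 0 <= t -> is_derive t 1 (fun s : R => z s i 0) (GG (z t) i 0).
  apply: (picard (L := L * 2) (B := fro (G ubar) + L * r)) => //.
  - by rewrite mulr_ge0.
  - by rewrite addr_ge0 ?fro_ge0 // mulr_ge0 // ltW.
have dzu (t : R) i : 0 <= t -> is_derive t 1 (fun s : R => (z s - ubar) i 0) (GG (z t) i 0).
  move=> t0; have -> : (fun s : R => (z s - ubar) i 0) = (fun s => z s i 0) - (fun=> ubar i 0).
    by apply/funext => s; rewrite !mxE.
  by apply: is_derive_eq (is_deriveB (dz t i t0) (is_derive_cst _ _ _)) _; rewrite subr0.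
have tang (t : R) : 0 <= t -> (q^T *m GG (z t)) 0 0 = 0.
  by move=> t0; apply: G_tangent; exact: ball_retract_in.
have qz t : 0 <= t -> (q^T *m (z t - ubar)) 0 0 = 0.
  move=> t0; rewrite -qu0 -z0; apply/eqP; rewrite eq_le; apply/andP; split.
    apply: (@le_of_derive_le0 _ (fun s => (q^T *m (z s - ubar)) 0 0) (fun s => (q^T *m GG (z s)) 0 0)) => // s /andP[s0 _].
      by apply: is_derive_dot => i; exact: dzu.
    by rewrite tang.
  rewrite -lerN2.
  apply: (@le_of_derive_le0 _ (fun s => - (q^T *m (z s - ubar)) 0 0) (fun s => - (q^T *m GG (z s)) 0 0)) => // s /andP[s0 _].
    by apply: is_deriveN; apply: is_derive_dot => i; exact: dzu.
  by rewrite tang // oppr0.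
have dec t : 0 <= t -> ((z t - ubar)^T *m GG (z t)) 0 0 <= 0.
  move=> t0; have l0 := ball_scale_gt0 ubar r_gt0 (z t).
  have rE : ball_retract ubar r (z t) - ubar = ball_scale ubar r (z t) *: (z t - ubar).
    by rewrite /ball_retract addrC addKr.
  rewrite -(pmulr_rle0 _ l0).
  have -> : ball_scale ubar r (z t) * ((z t - ubar)^T *m GG (z t)) 0 0 =
      ((ball_retract ubar r (z t) - ubar)^T *m GG (z t)) 0 0.
    by rewrite rE linearZ /= -scalemxAl [RHS]mxE.
  apply: le_trans (G_dissipative (ball_retract_in _ r_gt0 _) _) _.
    by rewrite rE -scalemxAr mxE qz // mulr0.
  by rewrite mulNr oppr_le0 mulr_ge0 ?fro2_ge0 // ltW.
have stay t : 0 <= t -> fro (z t - ubar) <= fro (u0 - ubar).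
  move=> t0; rewrite -z0 ler_sqrt ?fro2_ge0 //.
  apply: (@le_of_derive_le0 _ (fun s => fro2 (z s - ubar))
    (fun s => 2 * ((z s - ubar)^T *m GG (z s)) 0 0)) => // s /andP[s0 _].
    by apply: is_derive_fro2 => i; exact: dzu.
  by rewrite pmulr_rle0 // dec.
exists z; split => // t i t0.
have := dz t i t0; rewrite /GG ball_retract_id //.
exact: le_trans (stay t t0) (ltW u0r).
Qed.

Lemma flow_decay (z : R -> E) :
  (forall (t : R) i, 0 <= t -> is_derive t 1 (fun s : R => z s i 0) (G (z t) i 0)) ->
  (forall t, 0 <= t -> fro (z t - ubar) <= r) ->
  (forall t, 0 <= t -> (q^T *m (z t - ubar)) 0 0 = 0) ->
  forall t, 0 <= t -> fro (z t - ubar) <= r * expR (- c * t).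
Proof.
move=> dz zr qz t t0.
have dzu (s : R) i : 0 <= s -> is_derive s 1 (fun s : R => (z s - ubar) i 0) (G (z s) i 0).
  move=> s0; have -> : (fun s : R => (z s - ubar) i 0) = (fun s => z s i 0) - (fun=> ubar i 0).
    by apply/funext => x; rewrite !mxE.
  by apply: is_derive_eq (is_deriveB (dz s i s0) (is_derive_cst _ _ _)) _; rewrite subr0.
have := @energy_decay _ (fun s => fro2 (z s - ubar))
  (fun s => 2 * ((z s - ubar)^T *m G (z s)) 0 0) (- (2 * c)) 0 t t0.
rewrite mulr0 expR0 mulr1 opprK => H.
have {}H : fro2 (z t - ubar) * expR (2 * c * t) <= fro2 (z 0 - ubar).
  apply: H => s /andP[s0 _].
    by apply: is_derive_fro2 => i; exact: dzu.
  rewrite mulNr -mulrA -mulrN ler_pM2l // -mulNr G_dissipative //; [exact: zr|exact: qz].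
have r0 : 0 <= r by exact: ltW.
rewrite -(ler_pXn2r (_ : 0 < 2)%N) ?nnegrE ?fro_ge0 ?mulr_ge0 ?expR_ge0 //.
rewrite exprMn fro_sqr.
have -> : expR (- c * t) ^+ 2 = (expR (2 * c * t))^-1.
  by rewrite expr2 -expRD -expRN; congr expR; ring.
rewrite ler_pdivlMr ?expR_gt0 //; apply: le_trans H _.
by rewrite -fro_sqr ler_pXn2r ?nnegrE ?fro_ge0 // zr.
Qed.

(** The ball condition stops short of [t1], so that the lemma applies when [t1] is the first time v
    reaches the boundary. *)
Let gronwall_eq (v z : R -> E) (t1 : R) : 0 <= t1 -> v 0 = z 0 ->
  (forall (t : R) i, 0 <= t <= t1 -> is_derive t 1 (fun s : R => v s i 0) (G (v t) i 0)) ->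
  (forall (t : R) i, 0 <= t <= t1 -> is_derive t 1 (fun s : R => z s i 0) (G (z t) i 0)) ->
  (forall t, 0 <= t < t1 -> fro (v t - ubar) <= r) ->
  (forall t, 0 <= t < t1 -> fro (z t - ubar) <= r) ->
  v t1 = z t1.
Proof.
move=> t1_ge0 vz0 dv dz vr zr.
have := @energy_decay _ (fun s => fro2 (v s - z s))
  (fun s => 2 * ((v s - z s)^T *m (G (v s) - G (z s))) 0 0) (2 * L) 0 t1 t1_ge0.
rewrite vz0 subrr -[fro2 0]fro_sqr fro0 expr0n /= mul0r => H.
have {}H : fro2 (v t1 - z t1) * expR (- (2 * L) * t1) <= 0.
  apply: H => s s01.
    apply: is_derive_fro2 => i.
    have -> : (fun s : R => (v s - z s) i 0) = (fun s => v s i 0) - (fun s => z s i 0).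
      by apply/funext => x; rewrite !mxE.
    by apply: is_derive_eq (is_deriveB (dv s i s01) (dz s i s01)) _; rewrite !mxE.
  rewrite -mulrA ler_pM2l //; apply: le_trans (ler_norm _) _; apply: le_trans (fro_dot _ _) _.
  by rewrite -fro_sqr expr2 mulrCA ler_wpM2l ?fro_ge0 // G_lipschitz // ?vr ?zr.
move: H; rewrite pmulr_lle0 ?expR_gt0 // => H.
apply/eqP; rewrite -subr_eq0; apply/eqP/fro0_eq0/eqP.
by rewrite sqrtr_eq0.
Qed.

(** A competing solution v could leave the ball in which the field is controlled. At its first exit
    time Gronwall still gives v = z, while z stays within rho < r. *)
Let flow_unique (v z : R -> E) (T rho : R) : rho < r -> v 0 = z 0 ->
  (forall (t : R) i, 0 <= t < T -> is_derive t 1 (fun s : R => v s i 0) (G (v t) i 0)) ->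
  (forall (t : R) i, 0 <= t -> is_derive t 1 (fun s : R => z s i 0) (G (z t) i 0)) ->
  (forall t, 0 <= t -> fro (z t - ubar) <= rho) ->
  forall t, 0 <= t < T -> v t = z t.
Proof.
move=> rho_r vz0 dv dz zr.
have zr' t : 0 <= t -> fro (z t - ubar) <= r.
  by move=> t0; exact: le_trans (zr t t0) (ltW rho_r).
have dvu (s : R) i : 0 <= s < T -> is_derive s 1 (fun s : R => (v s - ubar) i 0) (G (v s) i 0).
  move=> s0; have -> : (fun s : R => (v s - ubar) i 0) = (fun s => v s i 0) - (fun=> ubar i 0).
    by apply/funext => x; rewrite !mxE.
  by apply: is_derive_eq (is_deriveB (dv s i s0) (is_derive_cst _ _ _)) _; rewrite subr0.
pose e t := fro (v t - ubar).
have econt (t : R) : 0 <= t < T -> {for t, continuous (fun s => fro2 (v s - ubar))}.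
  move=> tT; have [D _] := is_derive_fro2 (fun i => dvu t i tT).
  exact/differentiable_continuous/derivable1_diffP.
have inball t : 0 <= t < T -> e t < r.
  move=> /andP[t0 tT]; rewrite ltNge; apply/negP => et.
  pose S := [set s | 0 <= s <= t /\ r <= e s].
  have S0 : S !=set0 by exists t; rewrite /S /= t0 lexx.
  have lbS : lbound S 0 by move=> s [/andP[]].
  have infS : has_inf S by split => //; exists 0.
  set s0 := inf S.
  have s0_ge0 : 0 <= s0 by apply: lb_le_inf.
  have s0_t : s0 <= t by apply: ge_inf; [exists 0|split; rewrite ?t0 ?lexx].
  have s0T : 0 <= s0 < T by rewrite s0_ge0 (le_lt_trans s0_t).
  (* By continuity the infimum belongs to the set: otherwise v would stay inside the open ball for a
     short time after s0. *)
  have es0 : r <= e s0.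
    rewrite leNgt; apply/negP => es0.
    have gap : 0 < r ^+ 2 - fro2 (v s0 - ubar).
      by rewrite subr_gt0 -fro_sqr ltr_pXn2r ?nnegrE ?fro_ge0 ?(ltW r_gt0).
    have /cvgrPdist_lt/(_ _ gap)/nbhs_ballP[del /= del0 H] := econt s0 s0T.
    have [s [/andP[sge0 st] es] sdel] := inf_adherent del0 infS.
    have ss0 : s0 <= s by apply: ge_inf; [exists 0|split; rewrite ?sge0].
    have := H s; rewrite /ball /= => /(_ _).
    rewrite distrC ger0_norm ?subr_ge0 // ltrBlDl sdel => /(_ isT).
    rewrite ltr_norml => /andP[hs _].
    have : fro2 (v s - ubar) < r ^+ 2 by lra.
    rewrite -fro_sqr.
    by rewrite ltr_pXn2r ?nnegrE ?fro_ge0 ?(ltW r_gt0) // ltNge es.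
  have vr s : 0 <= s < s0 -> fro (v s - ubar) <= r.
    move=> /andP[sge0 ss0]; rewrite leNgt; apply/negP => /ltW es.
    have : s0 <= s by apply: ge_inf; [exists 0|split => //; rewrite sge0 ltW ?(lt_le_trans ss0)].
    by rewrite leNgt ss0.
  have vz : v s0 = z s0.
    apply: gronwall_eq => // [s i /andP[sge0 ss0]|s i /andP[sge0 _]|s /andP[sge0 _]].
    - by apply: dv; rewrite sge0 (le_lt_trans ss0) //; case/andP: s0T.
    - exact: dz.
    - exact: zr'.
  by move: es0; rewrite /e vz leNgt (le_lt_trans (zr s0 s0_ge0)).
move=> t /andP[t0 tT]; apply: gronwall_eq => // [s i /andP[s0 st]|s i /andP[s0 _]|s /andP[s0 st]|s /andP[s0 _]].
- by apply: dv; rewrite s0 (le_lt_trans st).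
- exact: dz.
- by apply/ltW/inball; rewrite s0 (lt_trans st).
- exact: zr'.
Qed.

Theorem dissipative_flow u0 : fro (u0 - ubar) < r -> (q^T *m (u0 - ubar)) 0 0 = 0 ->
  exists z : R -> E, [/\ z 0 = u0,
    (forall (t : R) i, 0 <= t -> is_derive t 1 (fun s : R => z s i 0) (G (z t) i 0)),
    (forall t, 0 <= t -> fro (z t - ubar) <= r /\ fro (z t - ubar) <= r * expR (- c * t)) &
    forall (T : R) (v : R -> E), 0 < T -> v 0 = u0 ->
      (forall (t : R) i, 0 <= t < T ->
         (fun s => (v s i 0 - v t i 0) / (s - t)) @ within `[0, T[ t^' --> G (v t) i 0) ->
      forall t, 0 <= t < T -> v t = z t].
Proof.
move=> u0r qu0; have [z [z0 dz zr qz]] := cutoff_solution u0r qu0.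
have zr' t : 0 <= t -> fro (z t - ubar) <= r.
  by move=> t0; exact: le_trans (zr t t0) (ltW u0r).
exists z; split => // [t t0|T v T0 v0 dv].
  by split; [exact: zr'|exact: flow_decay].
pose w t : E := \col_i (if t < 0 then v 0 i 0 + G (v 0) i 0 * (t - 0) else v t i 0).
have wv t : 0 <= t -> w t = v t.
  by move=> t0; apply/colP => i; rewrite mxE ltNge t0.
have dw (t : R) i : 0 <= t < T -> is_derive t 1 (fun s : R => w s i 0) (G (w t) i 0).
  move=> /andP[t0 tT]; rewrite wv //; move: t0; rewrite le_eqVlt => /predU1P[<-|t0].
    have Dv := dv 0 i; rewrite lexx T0 in Dv.
    have J x : 0 <= x < 0 + T -> `[0, T[%classic x by rewrite add0r /= in_itv.
    have D := within_is_derive1_extend T0 J (Dv isT).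
    by apply: (is_derive1_near ltr01 _ D) => x _; rewrite mxE.
  have m0 : 0 < Num.min t (T - t) by rewrite lt_min t0 subr_gt0.
  have J x : `|x - t| < Num.min t (T - t) -> `[0, T[%classic x.
    rewrite lt_min /= in_itv /= !ltr_norml => /andP[/andP[h1 _] /andP[_ h2]].
    by apply/andP; split; lra.
  have tT' : 0 <= t < T by rewrite ltW.
  have D := within_is_derive1 m0 J (dv t i tT').
  apply: (is_derive1_near m0 _ D) => x /J; rewrite /= in_itv /= => /andP[x0 _].
  by rewrite wv.
have wz0 : w 0 = z 0 by rewrite wv // v0 z0.
move=> t tT; rewrite -wv; last by case/andP: tT.
exact: (flow_unique u0r wz0 dw dz zr).
Qed.

End DissipativeFlow.

(** * Angle derivatives in a triangle *)

Section FaceDerivative.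
Context {R : realType} (g : background).
Implicit Types a b c : R.

(* A side is represented by its squared length in the Euclidean case and by the
   cosh of its length in the hyperbolic case. *)
Definition cos_num a b c : R :=
  match g with Euclidean => a + b - c | Hyperbolic => a * b - c end.

Definition cos_den a b : R :=
  match g with Euclidean => 4 * a * b | Hyperbolic => (a ^+ 2 - 1) * (b ^+ 2 - 1) end.

Definition area2 a b c : R :=
  match g with
  | Euclidean => 4 * a * b - (a + b - c) ^+ 2
  | Hyperbolic => 1 + 2 * a * b * c - a ^+ 2 - b ^+ 2 - c ^+ 2
  end.

Definition side_min : R := match g with Euclidean => 0 | Hyperbolic => 1 end.

Definition side_coef a b c : R :=
  match g with
  | Euclidean => (a + c - b) / (2 * a)
  | Hyperbolic => (a * c - b) / (a ^+ 2 - 1)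
  end.

(** The derivative of the angle between a and b times the square root of [area2] (see
    [is_derive_angle]). Differentiating c itself gets coefficient 1 in either geometry. *)
Definition angle_deriv a b c a' b' c' : R :=
  c' - side_coef a b c * a' - side_coef b a c * b'.

Definition side (e1 e2 n r1 r2 c1 c2 : R) : R :=
  match g with
  | Euclidean => e1 * r1 ^+ 2 + e2 * r2 ^+ 2 + 2 * n * r1 * r2
  | Hyperbolic => c1 * c2 + n * r1 * r2
  end.

(** Partial derivative of [side] in the coordinate u of its first end point. In the hyperbolic case
    dr/du = c r and dc/du = e r^2. *)
Definition dside (e1 n r1 r2 c1 c2 : R) : R :=
  match g with
  | Euclidean => 2 * (e1 * r1 ^+ 2 + n * r1 * r2)
  | Hyperbolic => e1 * r1 ^+ 2 * c2 + n * c1 * r1 * r2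
  end.

Definition vertex_rel (e r c : R) : Prop :=
  match g with Euclidean => c = 1 | Hyperbolic => c ^+ 2 = 1 + e * r ^+ 2 end.

(** The k of the quadratic forms is c / r here, with r = e^f; the factors 2 and [r1] are those
    produced by [face_off_diag]. *)
Definition face_weight (e1 e2 e3 n1 n2 n3 r1 r2 r3 c1 c2 c3 : R) : R :=
  match g with
  | Euclidean => 2 * euc_weight e1 e2 e3 n1 n2 n3 r1^-1 r2^-1 r3^-1
  | Hyperbolic => r1 * edge_weight e1 e2 e3 n1 n2 n3 (c1 / r1) (c2 / r2) (c3 / r3)
  end.

Definition face_angle_deriv (e1 e2 e3 n1 n2 n3 r1 r2 r3 c1 c2 c3 x1 x2 x3 : R) : R :=
  angle_deriv (side e1 e2 n3 r1 r2 c1 c2) (side e1 e3 n2 r1 r3 c1 c3)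
    (side e2 e3 n1 r2 r3 c2 c3)
    (dside e1 n3 r1 r2 c1 c2 * x1 + dside e2 n3 r2 r1 c2 c1 * x2)
    (dside e1 n2 r1 r3 c1 c3 * x1 + dside e3 n2 r3 r1 c3 c1 * x3)
    (dside e2 n1 r2 r3 c2 c3 * x2 + dside e3 n1 r3 r2 c3 c2 * x3).

Definition side_mul a : R := match g with Euclidean => 1 | Hyperbolic => a end.

Lemma side_sym (e1 e2 n r1 r2 c1 c2 : R) :
  side e1 e2 n r1 r2 c1 c2 = side e2 e1 n r2 r1 c2 c1.
Proof. by rewrite /side; case: g; ring. Qed.

Lemma side_gt_min (e1 e2 n r1 r2 c1 c2 : R) :
  e1 = 0 \/ e1 = 1 -> e2 = 0 \/ e2 = 1 -> 0 < e1 * e2 + n ->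
  0 < r1 -> 0 < r2 -> 0 < c1 -> 0 < c2 -> vertex_rel e1 r1 c1 -> vertex_rel e2 r2 c2 ->
  side_min < side e1 e2 n r1 r2 c1 c2.
Proof.
rewrite /side_min /side /vertex_rel => E1 E2 N r1_gt0 r2_gt0 c1_gt0 c2_gt0; case: g => V1 V2.
  have := euc_length2_gt0 E2 E1 (_ : 0 < e2 * e1 + n) r1_gt0 r2_gt0.
  by rewrite [e2 * _]mulrC => /(_ N); congr (0 < _); ring.
have R1 : 0 < (c1 / r1) ^+ 2 - e1.
  have -> : (c1 / r1) ^+ 2 - e1 = r1 ^- 2 by rewrite expr_div_n V1; field; rewrite gt_eqF.
  by rewrite invr_gt0 exprn_gt0.
have R2 : 0 < (c2 / r2) ^+ 2 - e2.
  have -> : (c2 / r2) ^+ 2 - e2 = r2 ^- 2 by rewrite expr_div_n V2; field; rewrite gt_eqF.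
  by rewrite invr_gt0 exprn_gt0.
have [p s] := edge_cosh_sinh_gt0 E1 E2 N (divr_gt0 c1_gt0 r1_gt0) (divr_gt0 c2_gt0 r2_gt0) R1 R2.
have r120 : 0 < r1 * r2 by rewrite mulr_gt0.
have C0 : 0 < c1 * c2 + n * r1 * r2.
  have -> : c1 * c2 + n * r1 * r2 = (r1 * r2) * (c1 / r1 * (c2 / r2) + n) by field; rewrite !gt_eqF.
  by rewrite mulr_gt0.
have C1 : 0 < (c1 * c2 + n * r1 * r2) ^+ 2 - 1.
  have -> : (c1 * c2 + n * r1 * r2) ^+ 2 - 1 = (r1 * r2) ^+ 2 *
     ((c1 / r1 * (c2 / r2) + n) ^+ 2 - ((c1 / r1) ^+ 2 - e1) * ((c2 / r2) ^+ 2 - e2)).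
    rewrite !expr_div_n V1 V2; field: V1 V2; by rewrite !gt_eqF.
  by rewrite mulr_gt0 // exprn_gt0.
rewrite ltNge; apply/negP => C_le1; suff : (c1 * c2 + n * r1 * r2) ^+ 2 <= 1 by lra.
by rewrite expr_le1 // ltW.
Qed.

Section Vertices.
Variables (e1 e2 e3 n1 n2 n3 r1 r2 r3 c1 c2 c3 : R).
Hypothesis W : triangle_weights e1 e2 e3 n1 n2 n3.
Hypotheses (r1_gt0 : 0 < r1) (r2_gt0 : 0 < r2) (r3_gt0 : 0 < r3).
Hypotheses (c1_gt0 : 0 < c1) (c2_gt0 : 0 < c2) (c3_gt0 : 0 < c3).
Hypotheses (V1 : vertex_rel e1 r1 c1) (V2 : vertex_rel e2 r2 c2) (V3 : vertex_rel e3 r3 c3).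

Let r1_neq0 : r1 != 0. Proof. by rewrite gt_eqF. Qed.
Let r2_neq0 : r2 != 0. Proof. by rewrite gt_eqF. Qed.
Let r3_neq0 : r3 != 0. Proof. by rewrite gt_eqF. Qed.

Let side12 : side_min < side e1 e2 n3 r1 r2 c1 c2.
Proof. by case: W => *; exact: side_gt_min. Qed.

(* The left-hand side is the derivative of the angle at vertex 1 in direction 2. *)
Lemma face_off_diag : dside e2 n1 r2 r3 c2 c3 -
    side_coef (side e1 e2 n3 r1 r2 c1 c2) (side e1 e3 n2 r1 r3 c1 c3) (side e2 e3 n1 r2 r3 c2 c3)
      * dside e2 n3 r2 r1 c2 c1 =
    face_weight e3 e1 e2 n3 n1 n2 r3 r1 r2 c3 c1 c2.
Proof.
move: side12; rewrite /side_min /side /dside /side_coef /face_weight.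
move: V1 V2 V3; rewrite /vertex_rel; case: g => v1 v2 v3 s12.
  rewrite /euc_weight /height.
  have L0 : e1 * r2^-1 ^+ 2 + e2 * r1^-1 ^+ 2 + 2 * n3 * r1^-1 * r2^-1 =
     (e1 * r1 ^+ 2 + e2 * r2 ^+ 2 + 2 * n3 * r1 * r2) / (r1 * r2) ^+ 2.
    by field; rewrite r1_neq0 r2_neq0.
  rewrite L0; field.
  by rewrite ?r1_neq0 ?r2_neq0 ?r3_neq0 ?gt_eqF.
have S0 : (c1 / r1 * (c2 / r2) + n3) ^+ 2 - ((c1 / r1) ^+ 2 - e1) * ((c2 / r2) ^+ 2 - e2) =
    ((c1 * c2 + n3 * r1 * r2) ^+ 2 - 1) / (r1 * r2) ^+ 2.
  have E1 : (c1 / r1) ^+ 2 - e1 = r1 ^- 2 by rewrite expr_div_n v1; field.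
  have E2 : (c2 / r2) ^+ 2 - e2 = r2 ^- 2 by rewrite expr_div_n v2; field.
  by rewrite E1 E2; field; rewrite ?r1_neq0 ?r2_neq0.
have s0 : (c1 * c2 + n3 * r1 * r2) ^+ 2 - 1 != 0.
  by rewrite subr_eq0 gt_eqF // exprn_egt1.
rewrite /edge_weight S0 /height.
set s := (c1 * c2 + n3 * r1 * r2) ^+ 2 - 1 in s0 *.
have -> (h : R) : r3 * (h / (s / (r1 * r2) ^+ 2)) = (r1 * r2) ^+ 2 * r3 * h / s.
  by field; rewrite ?s0 ?r1_neq0 ?r2_neq0.
apply: (mulIf s0); rewrite mulrBl divfK //.
have -> (x y : R) : x / s * y * s = x * y by field; rewrite ?s0.
rewrite /s; field: v1 v2 v3.
by rewrite ?r1_neq0 ?r2_neq0 ?r3_neq0.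
Qed.

End Vertices.

(** With [face_off_diag] this is the symmetry of the Jacobian of the three angles. *)
Lemma face_weight_swap (e1 e2 e3 n1 n2 n3 r1 r2 r3 c1 c2 c3 : R) :
  face_weight e1 e2 e3 n1 n2 n3 r1 r2 r3 c1 c2 c3 =
  face_weight e1 e3 e2 n1 n3 n2 r1 r3 r2 c1 c3 c2.
Proof.
rewrite /face_weight /euc_weight /edge_weight; case: g; rewrite height_swap.
  by congr (_ * (_ / _)); ring.
by congr (_ * (_ / _)); ring.
Qed.

Section FaceForm.
Variables (e1 e2 e3 n1 n2 n3 r1 r2 r3 c1 c2 c3 : R).
Hypothesis W : triangle_weights e1 e2 e3 n1 n2 n3.
Hypotheses (r1_gt0 : 0 < r1) (r2_gt0 : 0 < r2) (r3_gt0 : 0 < r3).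
Hypotheses (c1_gt0 : 0 < c1) (c2_gt0 : 0 < c2) (c3_gt0 : 0 < c3).
Hypotheses (V1 : vertex_rel e1 r1 c1) (V2 : vertex_rel e2 r2 c2) (V3 : vertex_rel e3 r3 c3).

Lemma face_angle_derivE x1 x2 x3 :
  let w2 := face_weight e2 e3 e1 n2 n3 n1 r2 r3 r1 c2 c3 c1 in
  let w3 := face_weight e3 e1 e2 n3 n1 n2 r3 r1 r2 c3 c1 c2 in
  face_angle_deriv e1 e2 e3 n1 n2 n3 r1 r2 r3 c1 c2 c3 x1 x2 x3 =
  w3 * x2 + w2 * x3 - (side_mul (side e1 e2 n3 r1 r2 c1 c2) * w3
                       + side_mul (side e3 e1 n2 r3 r1 c3 c1) * w2) * x1.
Proof.
move=> w2 w3.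
have o3 := face_off_diag W r1_gt0 r2_gt0 r3_gt0 c1_gt0 c2_gt0 V1 V2 V3.
rewrite -/w3 in o3.
have W' := triangle_weights_rot (triangle_weights_swap W).
have o2 := face_off_diag W' r1_gt0 r3_gt0 r2_gt0 c1_gt0 c3_gt0 V1 V3 V2.
rewrite face_weight_swap -/w2 in o2.
have s12 : side_min < side e1 e2 n3 r1 r2 c1 c2 by case: W => *; exact: side_gt_min.
have s13 : side_min < side e1 e3 n2 r1 r3 c1 c3.
  by rewrite side_sym; case: W => *; exact: side_gt_min.
rewrite [side e3 e2 _ _ _ _ _]side_sym in o2.
rewrite /face_angle_deriv /angle_deriv [side e3 e1 _ _ _ _ _]side_sym -o2 -o3.
(* The diagonal entry comes from a stationary direction: the angle at vertex 1 does not change to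
   first order along (1, m3, m2), where the m are the cosh of the adjacent lengths, or 1 in the
   Euclidean case (scaling). In the hyperbolic case each bracket reduces to c sinh^2. *)
have D : side_coef (side e1 e2 n3 r1 r2 c1 c2) (side e1 e3 n2 r1 r3 c1 c3) (side e2 e3 n1 r2 r3 c2 c3)
      * (dside e1 n3 r1 r2 c1 c2 + side_mul (side e1 e2 n3 r1 r2 c1 c2) * dside e2 n3 r2 r1 c2 c1) +
    side_coef (side e1 e3 n2 r1 r3 c1 c3) (side e1 e2 n3 r1 r2 c1 c2) (side e2 e3 n1 r2 r3 c2 c3)
      * (dside e1 n2 r1 r3 c1 c3 + side_mul (side e1 e3 n2 r1 r3 c1 c3) * dside e3 n2 r3 r1 c3 c1) =
    side_mul (side e1 e2 n3 r1 r2 c1 c2) * dside e2 n1 r2 r3 c2 c3 +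
    side_mul (side e1 e3 n2 r1 r3 c1 c3) * dside e3 n1 r3 r2 c3 c2.
  move: s12 s13 V1 V2 V3; rewrite /side_min /side /dside /side_mul /side_coef /vertex_rel.
  case: g => s12 s13 v1 v2 v3.
    by field; rewrite gt_eqF //= gt_eqF.
  set a := c1 * c2 + n3 * r1 * r2 in s12 *; set b := c1 * c3 + n2 * r1 * r3 in s13 *.
  have a2 : a ^+ 2 - 1 != 0 by rewrite subr_eq0 gt_eqF // exprn_egt1.
  have b2 : b ^+ 2 - 1 != 0 by rewrite subr_eq0 gt_eqF // exprn_egt1.
  have -> : e1 * r1 ^+ 2 * c2 + n3 * c1 * r1 * r2 + a * (e2 * r2 ^+ 2 * c1 + n3 * c2 * r2 * r1)
    = c2 * (a ^+ 2 - 1) by rewrite /a; ring: v1 v2.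
  have -> : e1 * r1 ^+ 2 * c3 + n2 * c1 * r1 * r3 + b * (e3 * r3 ^+ 2 * c1 + n2 * c3 * r3 * r1)
    = c3 * (b ^+ 2 - 1) by rewrite /b; ring: v1 v3.
  have dv (x y z : R) : z != 0 -> x / z * (y * z) = x * y by move=> z0; field.
  rewrite !dv //.
  by rewrite /a /b; ring: v2 v3.
have E (k l m m' d12 d21 d13 d31 d23 d32 : R) :
    k * (d12 + m * d21) + l * (d13 + m' * d31) = m * d23 + m' * d32 ->
    d23 * x2 + d32 * x3 - k * (d12 * x1 + d21 * x2) - l * (d13 * x1 + d31 * x3) =
    (d23 - k * d21) * x2 + (d32 - l * d31) * x3
    - (m * (d23 - k * d21) + m' * (d32 - l * d31)) * x1.
  move=> H.
  have -> : m * (d23 - k * d21) + m' * (d32 - l * d31) =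
     (m * d23 + m' * d32) - k * (m * d21) - l * (m' * d31) by ring.
  by rewrite -H; ring.
exact: E.
Qed.

Definition face_bilinear x1 x2 x3 y1 y2 y3 : R :=
  y1 * face_angle_deriv e1 e2 e3 n1 n2 n3 r1 r2 r3 c1 c2 c3 x1 x2 x3 +
  y2 * face_angle_deriv e2 e3 e1 n2 n3 n1 r2 r3 r1 c2 c3 c1 x2 x3 x1 +
  y3 * face_angle_deriv e3 e1 e2 n3 n1 n2 r3 r1 r2 c3 c1 c2 x3 x1 x2.

End FaceForm.

Section FaceBilinear.
Variables (e1 e2 e3 n1 n2 n3 r1 r2 r3 c1 c2 c3 : R).
Hypothesis W : triangle_weights e1 e2 e3 n1 n2 n3.
Hypotheses (r1_gt0 : 0 < r1) (r2_gt0 : 0 < r2) (r3_gt0 : 0 < r3).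
Hypotheses (c1_gt0 : 0 < c1) (c2_gt0 : 0 < c2) (c3_gt0 : 0 < c3).
Hypotheses (V1 : vertex_rel e1 r1 c1) (V2 : vertex_rel e2 r2 c2) (V3 : vertex_rel e3 r3 c3).
Let W' := triangle_weights_rot W.
Let W'' := triangle_weights_rot W'.
Let w1 := face_weight e1 e2 e3 n1 n2 n3 r1 r2 r3 c1 c2 c3.
Let w2 := face_weight e2 e3 e1 n2 n3 n1 r2 r3 r1 c2 c3 c1.
Let w3 := face_weight e3 e1 e2 n3 n1 n2 r3 r1 r2 c3 c1 c2.
Let m1 := side_mul (side e2 e3 n1 r2 r3 c2 c3).
Let m2 := side_mul (side e3 e1 n2 r3 r1 c3 c1).
Let m3 := side_mul (side e1 e2 n3 r1 r2 c1 c2).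
Local Notation B := (face_bilinear e1 e2 e3 n1 n2 n3 r1 r2 r3 c1 c2 c3).

Let face_bilinearE x1 x2 x3 y1 y2 y3 : B x1 x2 x3 y1 y2 y3 =
  w1 * (x2 * y3 + x3 * y2 - m1 * (x2 * y2 + x3 * y3)) +
  w2 * (x3 * y1 + x1 * y3 - m2 * (x3 * y3 + x1 * y1)) +
  w3 * (x1 * y2 + x2 * y1 - m3 * (x1 * y1 + x2 * y2)).
Proof.
rewrite /face_bilinear !face_angle_derivE // -/w1 -/w2 -/w3 -/m1 -/m2 -/m3.
ring.
Qed.

Lemma face_bilinear_sym x1 x2 x3 y1 y2 y3 : B x1 x2 x3 y1 y2 y3 = B y1 y2 y3 x1 x2 x3.
Proof. by rewrite !face_bilinearE; ring. Qed.

Hypothesis A : 0 < area2 (side e1 e2 n3 r1 r2 c1 c2) (side e3 e1 n2 r3 r1 c3 c1)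
  (side e2 e3 n1 r2 r3 c2 c3).

(** With k = c / r the form is -2 [euc_form] in the Euclidean case, and - r1 r2 r3 times [hyp_form]
    at the x_i / r_i in the hyperbolic case. *)
Lemma face_bilinear_neg x1 x2 x3 :
  match g with
  | Euclidean => ~~ ((x1 == x2) && (x2 == x3))
  | Hyperbolic => ~~ [&& x1 == 0, x2 == 0 & x3 == 0]
  end -> B x1 x2 x3 x1 x2 x3 < 0.
Proof.
rewrite face_bilinearE /m1 /m2 /m3 /w1 /w2 /w3.
move: A V1 V2 V3; rewrite /area2 /side /vertex_rel /side_mul /face_weight.
have r1n : r1 != 0 by rewrite gt_eqF.
have r2n : r2 != 0 by rewrite gt_eqF.
have r3n : r3 != 0 by rewrite gt_eqF.
case: g => A0 v1 v2 v3 xn.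
  have Q : 0 < euc_area2 e1 e2 e3 n1 n2 n3 r1^-1 r2^-1 r3^-1.
    have P0 : 0 < 4 * (r1 * r2 * r3) ^+ 2 by rewrite mulr_gt0 // exprn_gt0 // !mulr_gt0.
    rewrite -(pmulr_rgt0 _ P0); move: A0; congr (0 < _).
    by rewrite /euc_area2 /height; field; rewrite r1n r2n r3n.
  have r1i : 0 < r1^-1 by rewrite invr_gt0.
  have r2i : 0 < r2^-1 by rewrite invr_gt0.
  have r3i : 0 < r3^-1 by rewrite invr_gt0.
  rewrite negb_and in xn; have := euc_form_gt0 W r1i r2i r3i Q xn.
  by rewrite /euc_form !expr2; lra.
have rho (e r c : R) : c ^+ 2 = 1 + e * r ^+ 2 -> r != 0 -> (c / r) ^+ 2 - e = r ^- 2.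
  by move=> v r0; rewrite expr_div_n v; field.
have Q : 0 < gram_det e1 e2 e3 n1 n2 n3 (c1 / r1) (c2 / r2) (c3 / r3).
  have P0 : 0 < (r1 * r2 * r3) ^+ 2 by rewrite exprn_gt0 // !mulr_gt0.
  rewrite -(pmulr_rgt0 _ P0); move: A0; congr (0 < _).
  rewrite /gram_det !rho //.
  by field; rewrite r1n r2n r3n.
have [R1 R2 R3] : [/\ 0 < (c1 / r1) ^+ 2 - e1, 0 < (c2 / r2) ^+ 2 - e2 & 0 < (c3 / r3) ^+ 2 - e3].
  by rewrite !rho // !invr_gt0 !exprn_gt0.
have xn' : (x1 / r1 != 0) || (x2 / r2 != 0) || (x3 / r3 != 0).
  by rewrite !mulf_eq0 !invr_eq0 (negPf r1n) (negPf r2n) (negPf r3n) !orbF -!negb_and -andbA.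
have F := hyp_form_gt0 W (divr_gt0 c1_gt0 r1_gt0) (divr_gt0 c2_gt0 r2_gt0)
  (divr_gt0 c3_gt0 r3_gt0) R1 R2 R3 Q xn'.
have P0 : 0 < r1 * r2 * r3 by rewrite !mulr_gt0.
move: F; rewrite -(pmulr_rgt0 _ P0) -oppr_lt0; congr (_ < 0).
rewrite /hyp_form /edge_form !rho //.
move: (edge_weight _ _ _ _ _ _ _ _ _) (edge_weight _ _ _ _ _ _ _ _ _) (edge_weight _ _ _ _ _ _ _ _ _) => a b c.
by field; rewrite r1n r2n r3n.
Qed.

Lemma face_bilinear_const y1 y2 y3 : g = Euclidean -> B 1 1 1 y1 y2 y3 = 0.
Proof.
by move=> gE; rewrite face_bilinearE /m1 /m2 /m3 /side_mul gE; ring.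
Qed.

End FaceBilinear.

End FaceDerivative.

(** * Hyperbolic trigonometry and the angles of a triangle *)

Section Trigonometry.
Context {R : realType}.
Implicit Types x y : R.

Lemma coshD x y : cosh (x + y) = cosh x * cosh y + sinh x * sinh y.
Proof. by rewrite /cosh /sinh opprD !expRD; field. Qed.

Lemma coshB x y : cosh (x - y) = cosh x * cosh y - sinh x * sinh y.
Proof. by rewrite /cosh /sinh opprD opprK !expRD; field. Qed.

Lemma sinh_sqr x : sinh x ^+ 2 = cosh x ^+ 2 - 1.
Proof.
have : expR x * expR (- x) = 1 by rewrite -expRD subrr expR0.
by rewrite /sinh /cosh; move: (expR x) (expR (- x)) => u v uv; field: uv.
Qed.

Lemma sinh_ge0 x : 0 <= x -> 0 <= sinh x.
Proof. by move=> x0; rewrite divr_ge0 // subr_ge0 ler_expR; lra. Qed.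

Lemma coshN x : cosh (- x) = cosh x.
Proof. by rewrite /cosh opprK addrC. Qed.

Lemma cosh_gt0 x : 0 < cosh x.
Proof. by rewrite divr_gt0 // addr_gt0 // expR_gt0. Qed.

Lemma ltr_cosh x y : 0 <= x -> x < y -> cosh x < cosh y.
Proof.
move=> x0 xy; rewrite -(subrK x y) coshD -[ltLHS]add0r addrC.
have c1 : 1 < cosh (y - x).
  have : 0 < sinh (y - x) ^+ 2.
    by rewrite exprn_gt0 // divr_gt0 // subr_gt0 ltr_expR; lra.
  rewrite sinh_sqr => h; rewrite ltNge; apply/negP => le1.
  by have := exprn_ile1 2 (ltW (cosh_gt0 (y - x))) le1; lra.
apply: ltr_leD; first by rewrite ltr_pMl ?cosh_gt0.
by rewrite mulr_ge0 ?sinh_ge0 // subr_ge0 ltW.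
Qed.

Lemma sinh_arcosh x : 1 <= x -> sinh (arcosh x) = Num.sqrt (x ^+ 2 - 1).
Proof.
move=> x1; rewrite -(ger0_norm (sinh_ge0 (arcosh_ge0 x1))) -sqrtr_sqr sinh_sqr.
by rewrite arcoshK.
Qed.

End Trigonometry.

Section Triangle.
Context {R : realType} (g : background).
Implicit Types a b c : R.

Definition length a : R := match g with Euclidean => Num.sqrt a | Hyperbolic => arcosh a end.

Lemma area2E a b c : area2 g a b c = cos_den g a b - cos_num g a b c ^+ 2.
Proof. by rewrite /area2 /cos_den /cos_num; case: g => //; ring. Qed.

Lemma cos_den_gt0 a b : side_min g < a -> side_min g < b -> 0 < cos_den g a b.
Proof.
rewrite /side_min /cos_den; case: g => a0 b0; first by rewrite !mulr_gt0.
by rewrite mulr_gt0 // subr_gt0 exprn_egt1.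
Qed.

Lemma angle_length a b c : side_min g < a -> side_min g < b -> side_min g < c ->
  angle g (length a) (length b) (length c) = acos (cos_num g a b c / Num.sqrt (cos_den g a b)).
Proof.
rewrite /side_min /angle /length /cos_num /cos_den; case: g => a0 b0 c0.
  have -> : Num.sqrt (4 * a * b) = 2 * Num.sqrt a * Num.sqrt b.
    rewrite -mulrA sqrtrM // sqrtrM ?(ltW a0) // mulrA; congr (_ * _ * _).
    by rewrite -[RHS]ger0_norm // -sqrtr_sqr; congr Num.sqrt; ring.
  by rewrite !sqr_sqrtr // ltW.
by rewrite !arcoshK ?ltW // !sinh_arcosh ?ltW // sqrtrM // subr_ge0 exprn_ege1 // ltW.
Qed.

(** Heron's factorization, whose hyperbolic analogue is (cosh (x + y) - cosh z) (cosh z - cosh (x -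
    y)). *)
Lemma triangle_area2_gt0 a b c :
  side_min g < a -> side_min g < b -> side_min g < c ->
  length a < length b + length c -> length b < length a + length c ->
  length c < length a + length b -> 0 < area2 g a b c.
Proof.
rewrite /side_min /length /area2; case: g => a0 b0 c0.
  have := sqr_sqrtr (ltW a0); have := sqr_sqrtr (ltW b0); have := sqr_sqrtr (ltW c0).
  have : 0 < Num.sqrt a by rewrite sqrtr_gt0.
  have : 0 < Num.sqrt b by rewrite sqrtr_gt0.
  have : 0 < Num.sqrt c by rewrite sqrtr_gt0.
  move: (Num.sqrt a) (Num.sqrt b) (Num.sqrt c) => x y z z0 y0 x0 <- <- <- h1 h2 h3.
  have -> : 4 * x ^+ 2 * y ^+ 2 - (x ^+ 2 + y ^+ 2 - z ^+ 2) ^+ 2 =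
    (x + y + z) * (x + y - z) * ((x + z - y) * (y + z - x)) by ring.
  by rewrite !mulr_gt0 //; lra.
have := arcoshK (ltW a0); have := arcoshK (ltW b0); have := arcoshK (ltW c0).
have := arcosh_ge0 (ltW a0); have := arcosh_ge0 (ltW b0); have := arcosh_ge0 (ltW c0).
move: (arcosh a) (arcosh b) (arcosh c) => x y z z0 y0 x0 <- <- <- h1 h2 h3.
have -> : 1 + 2 * cosh x * cosh y * cosh z - cosh x ^+ 2 - cosh y ^+ 2 - cosh z ^+ 2 =
   (cosh (x + y) - cosh z) * (cosh z - cosh (x - y)).
  rewrite coshD coshB; transitivity (sinh x ^+ 2 * sinh y ^+ 2 - (cosh x * cosh y - cosh z) ^+ 2).
    by rewrite !sinh_sqr; ring.
  by ring.
have zxy : cosh (x - y) < cosh z.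
  have [xy|/ltW xy] := leP y x; first by apply: ltr_cosh; lra.
  by rewrite -coshN; apply: ltr_cosh; lra.
by rewrite mulr_gt0 // subr_gt0 // ltr_cosh.
Qed.

Lemma is_derive_angle (a b c : R -> R) (t a' b' c' : R) :
  side_min g < a t -> side_min g < b t -> 0 < area2 g (a t) (b t) (c t) ->
  is_derive t 1 a a' -> is_derive t 1 b b' -> is_derive t 1 c c' ->
  is_derive t 1 (fun s => acos (cos_num g (a s) (b s) (c s) / Num.sqrt (cos_den g (a s) (b s))))
    (angle_deriv g (a t) (b t) (c t) a' b' c' / Num.sqrt (area2 g (a t) (b t) (c t))).
Proof.
move=> at0 bt0; rewrite area2E => A0 Da Db Dc.
have Y0 := cos_den_gt0 at0 bt0.
pose X s := cos_num g (a s) (b s) (c s); pose Y s := cos_den g (a s) (b s).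
pose X' := match g with Euclidean => a' + b' - c' | Hyperbolic => a t * b' + b t * a' - c' end.
pose Y' := match g with
  | Euclidean => 4 * (a t * b' + b t * a')
  | Hyperbolic => (a t ^+ 2 - 1) * (2 * b t * b') + (b t ^+ 2 - 1) * (2 * a t * a') end.
have DX : is_derive t 1 X X'.
  rewrite /X /X' /cos_num; case: g; first exact: is_deriveB (is_deriveD Da Db) Dc.
  exact: is_deriveB (is_deriveM Da Db) Dc.
have DY : is_derive t 1 Y Y'.
  rewrite /Y /Y' /cos_den; case: g.
    apply: is_derive_eq (is_deriveM (is_deriveZ 4 Da) Db) _.
    by change (4 * a t * b' + b t * (4 * a') = 4 * (a t * b' + b t * a')); ring.
  have D2 (f : R -> R) (f' : R) : is_derive t 1 f f' -> is_derive t 1 (fun s => f s ^+ 2 - 1) (2 * f t * f').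
    move=> Df; have -> : (fun s => f s ^+ 2 - 1) = (f * f) - (fun=> 1).
      by apply/funext => s; rewrite expr2.
    apply: is_derive_eq (is_deriveB (is_deriveM Df Df) (is_derive_cst (1 : R) t 1)) _.
    by rewrite /GRing.scale /= subr0; ring.
  exact: is_deriveM (D2 _ _ Da) (D2 _ _ Db).
have S0 : 0 < Num.sqrt (Y t) by rewrite sqrtr_gt0.
have DS : is_derive t 1 (fun s => Num.sqrt (Y s)) ((2 * Num.sqrt (Y t))^-1 * Y').
  exact: (@is_derive1_comp R Num.sqrt Y t _ _ (is_derive1_sqrt Y0) DY).
have DI : is_derive t 1 (fun s => (Num.sqrt (Y s))^-1)
    (- (Num.sqrt (Y t)) ^- 2 *: ((2 * Num.sqrt (Y t))^-1 * Y')).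
  by apply: is_deriveV DS; rewrite gt_eqF.
have DQ := is_deriveM DX DI.
have YE : Num.sqrt (Y t) ^+ 2 = Y t by rewrite sqr_sqrtr // ltW.
have XY1 : (X t / Num.sqrt (Y t)) ^+ 2 < 1.
  by rewrite expr_div_n YE ltr_pdivrMr // mul1r -subr_gt0.
have XYb : -1 < X t / Num.sqrt (Y t) < 1.
  by rewrite -ltr_norml -(ltr_pXn2r (_ : 0 < 2)%N) ?nnegrE // real_normK ?num_real // expr1n.
have DA := is_derive1_acos XYb.
have D := @is_derive1_comp R acos (X * (fun s => (Num.sqrt (Y s))^-1)) t _ _ DA DQ.
apply: is_derive_eq D _.
have -> : Num.sqrt (1 - (X t / Num.sqrt (Y t)) ^+ 2) =
    Num.sqrt (Y t - X t ^+ 2) / Num.sqrt (Y t).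
  rewrite -[in RHS]sqrtrV ?(ltW Y0) // -[in RHS]sqrtrM ?(ltW A0) //.
  by congr Num.sqrt; rewrite expr_div_n YE; field; rewrite gt_eqF.
have A1 : Num.sqrt (Y t - X t ^+ 2) != 0 by rewrite gt_eqF // sqrtr_gt0.
(* The chain rule for acos (X / sqrt Y) gives - (X' - X Y' / (2 Y)) / sqrt (Y - X^2), and Y - X^2 is
   [area2]. *)
have E : angle_deriv g (a t) (b t) (c t) a' b' c' = - (X' - X t * Y' / (2 * Y t)).
  move: Y0; rewrite /angle_deriv /side_coef /X /X' /Y /Y' /cos_num /cos_den.
  move: at0 bt0; rewrite /side_min; case: g => at0 bt0 _.
    by field; rewrite !gt_eqF.
  have a2 : (a t) ^+ 2 - 1 != 0 by rewrite subr_eq0 gt_eqF // exprn_egt1.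
  have b2 : (b t) ^+ 2 - 1 != 0 by rewrite subr_eq0 gt_eqF // exprn_egt1.
  by field; rewrite a2 b2.
rewrite E /GRing.scale /= -/(X t) -/(Y t).
move: A1 (lt0r_neq0 S0) YE; move: (Num.sqrt (Y t)) => y A1 y0 YE.
rewrite -YE in A1 *.
by field; rewrite A1 y0.
Qed.

End Triangle.

(** * Locally Lipschitz functions *)

Section LocallyLipschitz.
Context {R : realType} (n : nat).
Local Notation E := 'cV[R]_n.
Implicit Types (x u v : E) (f h : E -> R).

Definition near_fro x (P : E -> Prop) := exists r : R, 0 < r /\ forall u, fro (u - x) < r -> P u.

Lemma near_fro_imp x (P Q : E -> Prop) : (forall u, P u -> Q u) -> near_fro x P -> near_fro x Q.
Proof. by move=> PQ [r [r0 H]]; exists r; split=> // u /H/PQ. Qed.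

Lemma near_fro_and x (P Q : E -> Prop) :
  near_fro x P -> near_fro x Q -> near_fro x (fun u => P u /\ Q u).
Proof.
move=> [r [r0 H]] [s [s0 K]]; exists (Num.min r s); split; first by rewrite lt_min r0.
by move=> u; rewrite lt_min => /andP[/H ? /K].
Qed.

Lemma near_fro_forall (I : finType) x (P : I -> E -> Prop) :
  (forall i, near_fro x (P i)) -> near_fro x (fun u => forall i, P i u).
Proof.
move=> H; suff [r [r0 K]] : near_fro x (fun u => forall i, i \in enum I -> P i u).
  by exists r; split=> // u /K {}K i; apply: K; rewrite mem_enum.
elim: (enum I) => [|i s IH]; first by exists 1.
apply: near_fro_imp (near_fro_and (H i) IH) => u [Pi Ps] j.
by rewrite inE => /orP[/eqP->//|/Ps].
Qed.

Lemma near_fro_implies x (A : Prop) (P : E -> Prop) :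
  (A -> near_fro x P) -> near_fro x (fun u => A -> P u).
Proof.
move=> AP; have [a|na] := pselect A; last by exists 1; split.
by apply: near_fro_imp (AP a).
Qed.

(** This class is closed under all operations in the formulas for the Laplacian. It yields the
    Lipschitz bounds without second derivatives, and also the openness of strict inequalities
    ([loc_lip_lt]). *)
Definition loc_lip x f := exists k : R, 0 <= k /\
  exists r : R, 0 < r /\ forall u v, fro (u - x) < r -> fro (v - x) < r ->
    `|f u - f v| <= k * fro (u - v).

Definition loc_lip1 (a : R) (phi : R -> R) := exists k : R, 0 <= k /\
  exists r : R, 0 < r /\ forall s t, `|s - a| < r -> `|t - a| < r ->
    `|phi s - phi t| <= k * `|s - t|.

Lemma loc_lip_cst x a : loc_lip x (fun=> a).
Proof.
exists 0; split=> //; exists 1; split=> // u v _ _.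
by rewrite subrr normr0 mul0r.
Qed.

Lemma loc_lip_coord x i : loc_lip x (fun u => u i 0).
Proof.
exists 1; split=> //; exists 1; split=> // u v _ _.
have -> : u i 0 - v i 0 = (u - v) i 0 by rewrite !mxE.
by rewrite mul1r fro_coord.
Qed.

Lemma loc_lip_near x f e : loc_lip x f -> 0 < e -> near_fro x (fun u => `|f u - f x| < e).
Proof.
move=> [k [k0 [r [r0 H]]]] e0; exists (Num.min r (e / (k + 1))).
have k1 : 0 < k + 1 by rewrite ltr_wpDl.
split; first by rewrite lt_min r0 divr_gt0.
move=> u; rewrite lt_min => /andP[ur]; rewrite ltr_pdivlMr // => ue.
apply: le_lt_trans (H u x ur _) _; first by rewrite subrr fro0.
by apply: le_lt_trans ue; rewrite mulrC ler_wpM2l ?fro_ge0 // lerDl.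
Qed.

Lemma loc_lip_lt x f h : loc_lip x f -> loc_lip x h -> f x < h x ->
  near_fro x (fun u => f u < h u).
Proof.
move=> Hf Hh fh; have e0 : 0 < (h x - f x) / 2 by rewrite divr_gt0 // subr_gt0.
apply: near_fro_imp (near_fro_and (loc_lip_near Hf e0) (loc_lip_near Hh e0)) => u [].
by rewrite !ltr_norml => /andP[_ h1] /andP[h2 _]; lra.
Qed.

Lemma loc_lip_eq x f h : near_fro x (fun u => f u = h u) -> loc_lip x f -> loc_lip x h.
Proof.
move=> [s [s0 fh]] [k [k0 [r [r0 H]]]]; exists k; split=> //.
exists (Num.min r s); split; first by rewrite lt_min r0.
by move=> u v; rewrite !lt_min => /andP[ur us] /andP[vr vs]; rewrite -!fh //; apply: H.
Qed.

Lemma loc_lipD x f h : loc_lip x f -> loc_lip x h -> loc_lip x (fun u => f u + h u).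
Proof.
move=> [k [k0 [r [r0 H]]]] [l [l0 [s [s0 K]]]]; exists (k + l); split; first exact: addr_ge0.
exists (Num.min r s); split; first by rewrite lt_min r0.
move=> u v; rewrite !lt_min => /andP[ur us] /andP[vr vs].
rewrite opprD addrACA mulrDl; apply: le_trans (ler_normD _ _) _.
by rewrite lerD ?H ?K.
Qed.

Lemma loc_lipN x f : loc_lip x f -> loc_lip x (fun u => - f u).
Proof.
move=> [k [k0 [r [r0 H]]]]; exists k; split=> //; exists r; split=> // u v ur vr.
by rewrite -opprD normrN H.
Qed.

Lemma loc_lipB x f h : loc_lip x f -> loc_lip x h -> loc_lip x (fun u => f u - h u).
Proof. by move=> Hf Hh; apply: loc_lipD => //; exact: loc_lipN. Qed.

Lemma loc_lipM x f h : loc_lip x f -> loc_lip x h -> loc_lip x (fun u => f u * h u).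
Proof.
move=> Hf Hh; have [p [p0 P]] := loc_lip_near Hf ltr01.
have [q [q0 Q]] := loc_lip_near Hh ltr01.
case: Hf => [k [k0 [r [r0 H]]]]; case: Hh => [l [l0 [s [s0 K]]]].
pose a := `|f x| + 1; pose b := `|h x| + 1.
have a0 : 0 <= a by rewrite addr_ge0.
have b0 : 0 <= b by rewrite addr_ge0.
exists (a * l + b * k); split; first by rewrite addr_ge0 // mulr_ge0.
exists (Num.min (Num.min r s) (Num.min p q)); split; first by rewrite !lt_min r0 s0 p0.
move=> u v; rewrite !lt_min => /andP[/andP[ur us] /andP[up uq]] /andP[/andP[vr vs] /andP[vp vq]].
have -> : f u * h u - f v * h v = f u * (h u - h v) + h v * (f u - f v) by ring.
apply: le_trans (ler_normD _ _) _; rewrite !normrM mulrDl -!mulrA.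
have fa : `|f u| <= a.
  have := P u up; have := ler_normD (f u - f x) (f x).
  by rewrite subrK /a; lra.
have hb : `|h v| <= b.
  have := Q v vq; have := ler_normD (h v - h x) (h x).
  by rewrite subrK /b; lra.
by apply: lerD; apply: ler_pM => //; [exact: K|exact: H].
Qed.

Lemma loc_lip_sum (I : finType) (P : pred I) x (f : I -> E -> R) :
  (forall i, P i -> loc_lip x (f i)) -> loc_lip x (fun u => \sum_(i | P i) f i u).
Proof.
move=> H; suff : loc_lip x (fun u => \sum_(i <- index_enum I | P i) f i u) by [].
elim: (index_enum I) => [|i s IH].
  apply: loc_lip_eq (loc_lip_cst x 0); exists 1; split=> // u _; by rewrite big_nil.
case: (boolP (P i)) => [Pi|nPi].
  apply: loc_lip_eq (loc_lipD (H i Pi) IH); exists 1; split=> // u _; by rewrite big_cons Pi.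
apply: loc_lip_eq IH; exists 1; split=> // u _; by rewrite big_cons (negPf nPi).
Qed.

Lemma loc_lip_comp x f (phi : R -> R) :
  loc_lip1 (f x) phi -> loc_lip x f -> loc_lip x (fun u => phi (f u)).
Proof.
move=> [l [l0 [s [s0 K]]]] Hf; have [p [p0 P]] := loc_lip_near Hf s0.
case: Hf => [k [k0 [r [r0 H]]]].
exists (l * k); split; first exact: mulr_ge0.
exists (Num.min r p); split; first by rewrite lt_min r0.
move=> u v; rewrite !lt_min => /andP[ur up] /andP[vr vp].
apply: le_trans (K _ _ (P _ up) (P _ vp)) _; rewrite -mulrA ler_wpM2l //; exact: H.
Qed.

Lemma loc_lip1_expR a : loc_lip1 a expR.
Proof.
exists (expR (a + 1)); split; first exact: expR_ge0.
exists 1; split=> // s t; rewrite !ltr_norml => /andP[_ h1] /andP[_ h2].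
by apply: expR_lipschitz; lra.
Qed.

Lemma loc_lip1_ln a : 0 < a -> loc_lip1 a (@ln R).
Proof.
move=> a0; have a2 : 0 < a / 2 by rewrite divr_gt0.
exists (a / 2)^-1; split; first by rewrite invr_ge0 ltW.
exists (a / 2); split=> // s t; rewrite !ltr_norml => /andP[h1 _] /andP[h2 _].
by apply: ln_lipschitz; lra.
Qed.

Lemma loc_lip1_inv a : a != 0 -> loc_lip1 a GRing.inv.
Proof.
move=> a0; have na0 : 0 < `|a| by rewrite normr_gt0.
have a2 : 0 < `|a| / 2 by rewrite divr_gt0.
exists ((`|a| / 2) ^+ 2)^-1; split; first by rewrite invr_ge0 exprn_ge0 // ltW.
exists (`|a| / 2); split=> // s t sa ta.
have lo w : `|w - a| < `|a| / 2 -> `|a| / 2 < `|w|.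
  by move=> wa; have := ler_normD (a - w) w; rewrite subrK distrC; lra.
have s0 : s != 0 by rewrite -normr_gt0; apply: lt_trans (lo _ sa).
have t0 : t != 0 by rewrite -normr_gt0; apply: lt_trans (lo _ ta).
have -> : s^-1 - t^-1 = (s * t)^-1 * (t - s) by field; rewrite s0 t0.
rewrite normrM [`|t - s|]distrC ler_wpM2r // normrV ?unitfE ?mulf_neq0 // lef_pV2 ?posrE.
- by rewrite normrM expr2; apply: ler_pM; rewrite ?ltW // lo.
- by rewrite normr_gt0 mulf_neq0.
- by rewrite exprn_gt0.
Qed.

Lemma loc_lip1_sqrt a : 0 < a -> loc_lip1 a Num.sqrt.
Proof.
move=> a0; have a2 : 0 < a / 2 by rewrite divr_gt0.
have b0 : 0 < Num.sqrt (a / 2) by rewrite sqrtr_gt0.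
exists (Num.sqrt (a / 2))^-1; split; first by rewrite invr_ge0 ltW.
exists (a / 2); split=> // s t; rewrite !ltr_norml => /andP[h1 _] /andP[h2 _].
have s0 : a / 2 <= s by lra.
have t0 : 0 <= t by lra.
have sb : Num.sqrt (a / 2) <= Num.sqrt s by rewrite ler_sqrt //; lra.
have c0 : 0 < Num.sqrt s + Num.sqrt t by rewrite ltr_pwDl ?sqrtr_ge0 // (lt_le_trans b0).
rewrite ler_pdivlMl //.
have -> : `|s - t| = (Num.sqrt s + Num.sqrt t) * `|Num.sqrt s - Num.sqrt t|.
  rewrite -[X in X * _](gtr0_norm c0) -normrM; congr `|_|.
  by rewrite mulrC -subr_sqr !sqr_sqrtr //; lra.
by rewrite ler_wpM2r //; have := sqrtr_ge0 t; lra.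
Qed.

Lemma loc_lip_expR x f : loc_lip x f -> loc_lip x (fun u => expR (f u)).
Proof. by apply: loc_lip_comp; exact: loc_lip1_expR. Qed.

Lemma loc_lipV x f : f x != 0 -> loc_lip x f -> loc_lip x (fun u => (f u)^-1).
Proof. by move=> fx; apply: loc_lip_comp; exact: loc_lip1_inv. Qed.

Lemma loc_lip_sqrt x f : 0 < f x -> loc_lip x f -> loc_lip x (fun u => Num.sqrt (f u)).
Proof. by move=> fx; apply: loc_lip_comp; exact: loc_lip1_sqrt. Qed.

Lemma loc_lip_ln x f : 0 < f x -> loc_lip x f -> loc_lip x (fun u => ln (f u)).
Proof. by move=> fx; apply: loc_lip_comp; exact: loc_lip1_ln. Qed.

End LocallyLipschitz.

(** * Derivative of the curvature *)

Section Calculus.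
Context {R : realType}.

Lemma is_derive_scaled_mul (f h : R -> R) (c t f' h' : R) :
  is_derive t 1 f f' -> is_derive t 1 h h' ->
  is_derive t 1 (fun s => c * f s * h s) (c * (f t * h' + h t * f')).
Proof.
move=> Df Dh; apply: is_derive_eq (is_deriveM (is_deriveZ c Df) Dh) _.
by change (c * f t * h' + h t * (c * f') = c * (f t * h' + h t * f')); ring.
Qed.

Lemma is_derive_quadratic (f h : R -> R) (a b c t f' h' : R) :
  is_derive t 1 f f' -> is_derive t 1 h h' ->
  is_derive t 1 (fun s => a * f s ^+ 2 + b * h s ^+ 2 + c * f s * h s)
    (2 * a * f t * f' + 2 * b * h t * h' + c * (f t * h' + h t * f')).
Proof.
move=> Df Dh.
have -> : (fun s => a * f s ^+ 2 + b * h s ^+ 2 + c * f s * h s) =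
  (fun s => a * f s * f s) + (fun s => b * h s * h s) + (fun s => c * f s * h s).
  by apply/funext => s; rewrite !expr2 !mulrA.
apply: is_derive_eq (is_deriveD (is_deriveD (is_derive_scaled_mul a Df Df)
  (is_derive_scaled_mul b Dh Dh)) (is_derive_scaled_mul c Df Dh)) _.
by ring.
Qed.

End Calculus.

Section Coordinates.
Context {R : realType} (N : nat) (g : background) (F : {set {set 'I_N}}).
Variables (eps : 'I_N -> bool) (eta : {set 'I_N} -> R).
Local Notation E := 'cV[R]_N.
Implicit Types (u x : E) (i j k : 'I_N).

Definition weight i : R := (eps i)%:R.

Lemma weight01 i : weight i = 0 \/ weight i = 1.
Proof. by rewrite /weight; case: (eps i); [right|left]. Qed.

(* [rad] is e^f and [chr] is sqrt (1 + eps e^(2f)) (1 in the Euclidean case), as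
   functions of the coordinate u. *)
Definition rad u i : R :=
  if (if g is Hyperbolic then eps i else false)
  then 2 * expR (u i 0) / (1 - expR (2 * u i 0)) else expR (u i 0).

Definition chr u i : R :=
  if (if g is Hyperbolic then eps i else false)
  then (1 + expR (2 * u i 0)) / (1 - expR (2 * u i 0)) else 1.

(** The image of [u_of_f], on which [f_of_u] is a two-sided inverse. *)
Definition in_domain u : Prop :=
  forall i, (if g is Hyperbolic then eps i else false) -> u i 0 < 0.

Lemma exp2 (a : R) : expR (2 * a) = expR a ^+ 2.
Proof. by rewrite expr2 -expRD; congr expR; ring. Qed.

Lemma one_sub_exp2_gt0 (a : R) : a < 0 -> 0 < 1 - expR (2 * a).
Proof. by move=> a0; rewrite subr_gt0 -[ltRHS]expR0 ltr_expR; lra. Qed.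

Lemma rad_gt0 u i : in_domain u -> 0 < rad u i.
Proof.
move=> /(_ i); rewrite /rad; case: ifP => [_ /(_ isT) u0|_ _]; last exact: expR_gt0.
by rewrite divr_gt0 ?one_sub_exp2_gt0 // mulr_gt0 // expR_gt0.
Qed.

Lemma chr_gt0 u i : in_domain u -> 0 < chr u i.
Proof.
move=> /(_ i); rewrite /chr; case: ifP => [_ /(_ isT) u0|_ _] //.
by rewrite divr_gt0 ?one_sub_exp2_gt0 // addr_gt0 // expR_gt0.
Qed.

Lemma chr_sqr u i : in_domain u -> g = Hyperbolic ->
  chr u i ^+ 2 = 1 + weight i * rad u i ^+ 2.
Proof.
move=> du gH; move: (du i); rewrite /chr /rad /weight gH; case: (eps i) => [/(_ isT) u0|_].
  have := one_sub_exp2_gt0 u0; rewrite exp2 mul1r; move: (expR (u i 0)) => a a0.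
  by field; rewrite gt_eqF.
by rewrite mul0r addr0 expr1n.
Qed.

Lemma chr_vertex_rel u i : in_domain u -> vertex_rel g (weight i) (rad u i) (chr u i).
Proof.
move=> du; rewrite /vertex_rel; case gE: g; last exact: chr_sqr.
by rewrite /chr gE.
Qed.

Lemma expR_f_of_u u i : in_domain u -> expR (f_of_u g eps u i 0) = rad u i.
Proof.
move=> du; have := rad_gt0 i du; rewrite mxE /rad; case: g => //; case: (eps i) => // r0.
by rewrite lnK ?posrE.
Qed.

Definition side_at u i j : R :=
  side g (weight i) (weight j) (eta [set i; j]%SET) (rad u i) (rad u j) (chr u i) (chr u j).

Lemma side_atC u i j : side_at u i j = side_at u j i.
Proof. by rewrite /side_at side_sym finset.setUC. Qed.

Lemma edge_lengthE u i j : in_domain u ->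
  edge_length g eps eta (f_of_u g eps u) i j = length g (side_at u i j).
Proof.
move=> du; rewrite /edge_length /length /side_at /side !exp2 expRD !expR_f_of_u //.
rewrite -/(weight i) -/(weight j); case gE: g.
  by congr Num.sqrt; rewrite !mulrA.
rewrite -!chr_sqr // -exprMn sqrtr_sqr gtr0_norm ?mulr_gt0 ?chr_gt0 //.
by rewrite mulrA.
Qed.

Lemma f_of_uK u : in_domain u -> u_of_f g eps (f_of_u g eps u) = u.
Proof.
move=> du; apply/colP => i; rewrite [LHS]mxE; case gE: g; first by rewrite mxE.
case ei: (eps i); last by rewrite mxE ei.
have u0 : u i 0 < 0 by apply: du; rewrite gE.
have e0 := one_sub_exp2_gt0 u0; have ep : 0 < expR (2 * u i 0) := expR_gt0 _.
rewrite -{1}gE exp2 expR_f_of_u //.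
have -> : Num.sqrt (1 + rad u i ^+ 2) = chr u i.
  have := chr_sqr i du gE; rewrite /weight ei mul1r => <-.
  by rewrite sqrtr_sqr gtr0_norm // chr_gt0.
rewrite /=; have -> : (chr u i - 1) / (chr u i + 1) = expR (2 * u i 0).
  rewrite /chr gE ei; move: (expR _) e0 ep => a a0 a1.
  by field; rewrite gt_eqF //= gt_eqF //; lra.
by rewrite gtr0_norm // expRK mulrA mulVf // mul1r.
Qed.

Lemma u_of_f_in_domain (f : E) : in_domain (u_of_f g eps f).
Proof.
move=> i gi; rewrite mxE; case: g gi => // ei; rewrite ei /=.
set c := Num.sqrt _.
have c1 : 1 < c by rewrite -[ltLHS]sqrtr1 ltr_sqrt // ?ltrDl ?expR_gt0 // addr_gt0 ?expR_gt0.
have q0 : 0 < (c - 1) / (c + 1) by rewrite divr_gt0 //; lra.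
rewrite gtr0_norm // pmulr_rlt0 ?invr_gt0 // -ln1 ltr_ln ?posrE //.
by rewrite ltr_pdivrMr ?mul1r; lra.
Qed.

(** Nondegeneracy with f recovered from u instead of quantified, a form in which openness can be
    proved. *)
Definition good u : Prop := in_domain u /\ triangle_inequalities g F eps eta (f_of_u g eps u).

Lemma goodP u : nondegenerate_structure g F eps eta u -> good u.
Proof. by move=> [f [-> tf]]; split; [exact: u_of_f_in_domain | rewrite u_of_fK]. Qed.

Lemma good_nondegenerate u : good u -> nondegenerate_structure g F eps eta u.
Proof. by move=> [du tu]; exists (f_of_u g eps u); rewrite f_of_uK. Qed.

Hypothesis Hsurf : connected_closed_surface F.
Hypothesis Hstr : structure_condition F eps eta.

Lemma face_rot i j k : ([set j; k; i]%SET \in F) = ([set i; j; k]%SET \in F).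
Proof. by congr (_ \in F); apply/setP => a; rewrite !inE orbC orbA. Qed.

Lemma face_swap i j k : ([set i; k; j]%SET \in F) = ([set i; j; k]%SET \in F).
Proof. by congr (_ \in F); apply/setP => a; rewrite !inE orbAC. Qed.

Lemma face_edge i j k : [set i; j; k]%SET \in F -> [set i; j]%SET \in edges F.
Proof.
move=> ijk; have := surf_face Hsurf ijk.
have -> : [set i; j; k]%SET = (k |: [set i; j])%SET by apply/setP => a; rewrite !inE orbC.
move=> c3; rewrite inE; apply/andP; split; last first.
  by apply/existsP; exists [set i; j; k]%SET; rewrite ijk finset.subsetUl.
move: c3; rewrite cardsU1 cards2; case: (k \notin _) => //; case: (i != j) => //.
Qed.

Lemma face_neq i j k : [set i; j; k]%SET \in F -> j != k.
Proof.
rewrite -face_rot => /face_edge; rewrite inE => /andP[+ _].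
by rewrite cards2; case: (j != k).
Qed.

Lemma face_weights i j k : [set i; j; k]%SET \in F ->
  triangle_weights (weight i) (weight j) (weight k)
    (eta [set j; k]%SET) (eta [set k; i]%SET) (eta [set i; j]%SET).
Proof.
have [S1 S2] := Hstr.
have H p q r : [set p; q; r]%SET \in F ->
    0 <= weight p * eta [set q; r]%SET + eta [set r; p]%SET * eta [set p; q]%SET.
  by move=> f; have := S2 p q r f; rewrite (finset.setUC [set p]%SET [set r]%SET) [eta [set p; q]%SET * _]mulrC.
move=> f1; have f2 := f1; rewrite -face_rot in f2; have f3 := f2; rewrite -face_rot in f3.
split; try exact: weight01.
- exact: S1 (face_edge f2).
- exact: S1 (face_edge f3).
- exact: S1 (face_edge f1).
- exact: H.
- by rewrite [_ * eta [set i; j]%SET]mulrC; exact: H.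
- exact: H.
Qed.

Lemma side_at_gt u i j k : in_domain u -> [set i; j; k]%SET \in F ->
  side_min g < side_at u i j.
Proof.
move=> du f; case: (face_weights f) => E1 E2 _ _ _ N3 _ _ _.
by apply: side_gt_min => //; rewrite ?rad_gt0 ?chr_gt0 //; exact: chr_vertex_rel.
Qed.

Lemma area2_swap (a b c : R) : area2 g a b c = area2 g b a c.
Proof. by rewrite /area2; case: g; ring. Qed.

Lemma area2_rot (a b c : R) : area2 g a b c = area2 g b c a.
Proof. by rewrite /area2; case: g; ring. Qed.

Lemma area2_at_gt0 u i j k : good u -> [set i; j; k]%SET \in F ->
  0 < area2 g (side_at u i j) (side_at u k i) (side_at u j k).
Proof.
move=> [du tu] f1; have f2 := f1; rewrite -face_rot in f2; have f3 := f2; rewrite -face_rot in f3.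
have T p q r : [set p; q; r]%SET \in F ->
    length g (side_at u p q) < length g (side_at u r p) + length g (side_at u q r).
  by move=> /tu; rewrite !edge_lengthE // (side_atC u p r) (side_atC u r q).
apply: triangle_area2_gt0.
- exact: side_at_gt f1.
- exact: side_at_gt f3.
- exact: side_at_gt f2.
- exact: T.
- by rewrite addrC; exact: T.
- exact: T.
Qed.

Lemma inner_angleE u i j k : in_domain u -> [set i; j; k]%SET \in F ->
  inner_angle g eps eta u i j k = acos (cos_num g (side_at u i j) (side_at u k i) (side_at u j k)
    / Num.sqrt (cos_den g (side_at u i j) (side_at u k i))).
Proof.
move=> du f1; have f2 := f1; rewrite -face_rot in f2; have f3 := f2; rewrite -face_rot in f3.
rewrite /inner_angle !edge_lengthE // (side_atC u i k); apply: angle_length.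
- exact: side_at_gt f1.
- exact: side_at_gt f3.
- exact: side_at_gt f2.
Qed.

Definition face_deriv u i j k x : R :=
  face_angle_deriv g (weight i) (weight j) (weight k)
    (eta [set j; k]%SET) (eta [set k; i]%SET) (eta [set i; j]%SET)
    (rad u i) (rad u j) (rad u k) (chr u i) (chr u j) (chr u k) (x i 0) (x j 0) (x k 0) /
  Num.sqrt (area2 g (side_at u i j) (side_at u k i) (side_at u j k)).

Definition curvature_deriv u x i : R :=
  - \sum_(j < N) \sum_(k < N | (j < k)%N && ([set i; j; k]%SET \in F)) face_deriv u i j k x.

Section Line.
Variables (u x : E) (t : R).
(** Differentiation along lines is enough: the entries of the Laplacian are directional derivatives,
    and the mean value estimates use segments. *)
Let l (s : R) : E := u + s *: x.
Hypothesis dl : in_domain (l t).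

Let is_derive_l i : is_derive t 1 (fun s : R => l s i 0) (x i 0).
Proof.
have -> : (fun s : R => l s i 0) = (fun=> u i 0) + (fun s : R => s * x i 0).
  by apply/funext => s; rewrite !mxE.
apply: is_derive_eq (is_deriveD (is_derive_cst _ _ _) (is_deriveM (is_derive_id t (1:R)) (is_derive_cst (x i 0) t (1:R)))) _.
by rewrite add0r /GRing.scale /= mulr0 add0r mulr1.
Qed.

Let is_derive_exp2 i : is_derive t 1 (fun s : R => expR (2 * l s i 0))
  (2 * x i 0 * expR (2 * l t i 0)).
Proof.
have D := @is_derive1_comp R expR (fun s => 2 * l s i 0) t _ _ (is_derive_expR _)
  (is_deriveZ 2 (is_derive_l i)).
by apply: is_derive_eq D _; rewrite mulrC.
Qed.

Let is_derive_exp i : is_derive t 1 (fun s : R => expR (l s i 0)) (x i 0 * expR (l t i 0)).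
Proof.
have D := @is_derive1_comp R expR (fun s => l s i 0) t _ _ (is_derive_expR _) (is_derive_l i).
by apply: is_derive_eq D _; rewrite mulrC.
Qed.

Lemma is_derive_rad i : is_derive t 1 (fun s : R => rad (l s) i)
  (chr (l t) i * rad (l t) i * x i 0).
Proof.
move: (@dl i); rewrite /rad /chr; case: ifP => [_ /(_ isT) l0|_ _].
  have e0 := one_sub_exp2_gt0 l0.
  have D1 := is_deriveB (is_derive_cst (1 : R) t (1 : R)) (is_derive_exp2 i).
  have D2 := @is_deriveV R (fun s => 1 - expR (2 * l s i 0)) t _ 1 (lt0r_neq0 e0) D1.
  have D3 := is_deriveM (is_deriveZ 2 (is_derive_exp i)) D2.
  apply: is_derive_eq D3 _.
  change ((2 * expR (l t i 0)) * (- (1 - expR (2 * l t i 0)) ^- 2 * (0 - 2 * x i 0 * expR (2 * l t i 0)))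
    + (1 - expR (2 * l t i 0))^-1 * (2 * (x i 0 * expR (l t i 0))) =
    (1 + expR (2 * l t i 0)) / (1 - expR (2 * l t i 0)) *
    (2 * expR (l t i 0) / (1 - expR (2 * l t i 0))) * x i 0).
  by field; rewrite lt0r_neq0.
by apply: is_derive_eq (is_derive_exp i) _; rewrite mul1r mulrC.
Qed.

Lemma is_derive_chr i : is_derive t 1 (fun s : R => chr (l s) i)
  (if g is Hyperbolic then weight i * rad (l t) i ^+ 2 * x i 0 else 0).
Proof.
move: (@dl i); rewrite /chr /rad /weight; case: g; first by move=> _; exact: is_derive_cst.
case: (eps i) => [/(_ isT) l0|_]; last by rewrite !mul0r; exact: is_derive_cst.
have e0 := one_sub_exp2_gt0 l0.
have D1 := is_deriveB (is_derive_cst (1 : R) t (1 : R)) (is_derive_exp2 i).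
have D2 := @is_deriveV R (fun s => 1 - expR (2 * l s i 0)) t _ 1 (lt0r_neq0 e0) D1.
have D3 := is_deriveM (is_deriveD (is_derive_cst (1 : R) t (1 : R)) (is_derive_exp2 i)) D2.
apply: is_derive_eq D3 _.
change ((1 + expR (2 * l t i 0)) * (- (1 - expR (2 * l t i 0)) ^- 2 * (0 - 2 * x i 0 * expR (2 * l t i 0)))
  + (1 - expR (2 * l t i 0))^-1 * (0 + 2 * x i 0 * expR (2 * l t i 0)) =
  1 * (2 * expR (l t i 0) / (1 - expR (2 * l t i 0))) ^+ 2 * x i 0).
move: e0; rewrite exp2; move: (expR _) => a a0.
by field; rewrite lt0r_neq0.
Qed.

Lemma is_derive_side_at i j : is_derive t 1 (fun s : R => side_at (l s) i j)
  (dside g (weight i) (eta [set i; j]%SET) (rad (l t) i) (rad (l t) j) (chr (l t) i) (chr (l t) j) * x i 0 +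
   dside g (weight j) (eta [set i; j]%SET) (rad (l t) j) (rad (l t) i) (chr (l t) j) (chr (l t) i) * x j 0).
Proof.
have Ri := is_derive_rad i; have Rj := is_derive_rad j.
have Ci := is_derive_chr i; have Cj := is_derive_chr j.
have Vi := chr_vertex_rel i dl; have Vj := chr_vertex_rel j dl.
move: Ri Rj Ci Cj Vi Vj; rewrite /side_at /side /dside /vertex_rel; case: g => Ri Rj Ci Cj Vi Vj.
  apply: is_derive_eq (is_derive_quadratic (weight i) (weight j) (2 * eta [set i; j]%SET) Ri Rj) _.
  by rewrite Vi Vj; ring.
have -> : (fun s : R => chr (l s) i * chr (l s) j + eta [set i; j]%SET * rad (l s) i * rad (l s) j) =
  (fun s => 1 * chr (l s) i * chr (l s) j) + (fun s => eta [set i; j]%SET * rad (l s) i * rad (l s) j).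
  by apply/funext => s; rewrite -[X in X * chr _ j]mul1r.
apply: is_derive_eq (is_deriveD (is_derive_scaled_mul 1 Ci Cj) (is_derive_scaled_mul _ Ri Rj)) _.
by ring.
Qed.

Lemma is_derive_face_angle i j k : good (l t) -> [set i; j; k]%SET \in F ->
  is_derive t 1 (fun s : R => acos (cos_num g (side_at (l s) i j) (side_at (l s) k i) (side_at (l s) j k)
    / Num.sqrt (cos_den g (side_at (l s) i j) (side_at (l s) k i)))) (face_deriv (l t) i j k x).
Proof.
move=> gl f1; have f3 := f1; rewrite -2!face_rot in f3.
have D := @is_derive_angle R g (fun s => side_at (l s) i j) (fun s => side_at (l s) k i)
  (fun s => side_at (l s) j k) t _ _ _ (side_at_gt dl f1) (side_at_gt dl f3) (area2_at_gt0 gl f1)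
  (is_derive_side_at i j) (is_derive_side_at k i) (is_derive_side_at j k).
apply: is_derive_eq D _; rewrite /face_deriv; congr (_ / _).
rewrite /face_angle_deriv /angle_deriv /side_at.
rewrite [side g (weight i) (weight k) _ _ _ _ _]side_sym.
by congr (_ - _ - _); rewrite [X in _ * X]addrC.
Qed.

End Line.

Lemma good_near_domain u : in_domain u -> near_fro u in_domain.
Proof.
move=> du; apply: near_fro_forall => i; apply: near_fro_implies => gi.
exact: loc_lip_lt (loc_lip_coord u i) (loc_lip_cst u 0) (du i gi).
Qed.

Lemma near_fro_line (P : E -> Prop) u x (t : R) : near_fro (u + t *: x) P ->
  exists r : R, 0 < r /\ forall s, `|s - t| < r -> P (u + s *: x).
Proof.
move=> [r [r0 H]]; have k0 : 0 < fro x + 1 by rewrite ltr_wpDl ?fro_ge0.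
exists (r / (fro x + 1)); split; first by rewrite divr_gt0.
move=> s; rewrite ltr_pdivlMr // => sr; apply: H.
rewrite opprD addrACA subrr add0r -scalerBl froZ; apply: le_lt_trans sr.
by rewrite ler_wpM2l // lerDl.
Qed.

Lemma is_derive_curvature u x (t : R) i : good (u + t *: x) ->
  is_derive t 1 (fun s : R => curvature g F eps eta (u + s *: x) i 0)
    (curvature_deriv (u + t *: x) x i).
Proof.
move=> gl; have dl : in_domain (u + t *: x) by case: gl.
(* The closed formula for the angles is known on [in_domain]; this set is open, so the formula holds
   for all parameters near t. *)
have [r [r0 dr]] := near_fro_line (good_near_domain dl).
pose theta j k (s : R) := if (j < k)%N && ([set i; j; k]%SET \in F) then
  acos (cos_num g (side_at (u + s *: x) i j) (side_at (u + s *: x) k i) (side_at (u + s *: x) j k)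
    / Num.sqrt (cos_den g (side_at (u + s *: x) i j) (side_at (u + s *: x) k i))) else 0.
pose theta' j k := if (j < k)%N && ([set i; j; k]%SET \in F) then
  face_deriv (u + t *: x) i j k x else 0.
have D : is_derive t 1 ((fun=> 2 * pi) - \sum_(j < N) \sum_(k < N) theta j k)
    (0 - \sum_(j < N) \sum_(k < N) theta' j k).
  apply: is_deriveB; apply: is_derive_sum => j; apply: is_derive_sum => k.
  rewrite /theta /theta'; case: ifP => [/andP[_ f]|_]; last exact: is_derive_cst.
  exact: is_derive_face_angle.
have E' : 0 - \sum_(j < N) \sum_(k < N) theta' j k = curvature_deriv (u + t *: x) x i.
  rewrite sub0r /curvature_deriv; congr (- _); apply: eq_bigr => j _.
  by rewrite [RHS]big_mkcond.
rewrite -E'; apply: (is_derive1_near r0 _ D) => s sr.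
rewrite /curvature mxE /=; congr (_ - _).
rewrite fct_sumE; apply: eq_bigr => j _; rewrite fct_sumE [RHS]big_mkcond.
apply: eq_bigr => k _; rewrite /theta; case: ifP => // /andP[_ f].
by rewrite inner_angleE //; exact: dr.
Qed.

End Coordinates.

(** * Openness of nondegeneracy and local Lipschitz dependence *)

Section Regularity.
Context {R : realType} (N : nat) (g : background) (F : {set {set 'I_N}}).
Variables (eps : 'I_N -> bool) (eta : {set 'I_N} -> R).
Hypothesis Hsurf : connected_closed_surface F.
Hypothesis Hstr : structure_condition F eps eta.
Local Notation E := 'cV[R]_N.
Local Notation r_ := (rad g eps).
Local Notation c_ := (chr g eps).
Local Notation in_domain := (in_domain g eps).
Local Notation l_ := (side_at g eps eta).
Local Notation good := (good g F eps eta).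
Implicit Types (u x : E) (i j k : 'I_N).

Lemma loc_lip_sqr x (f : E -> R) : loc_lip x f -> loc_lip x (fun u => f u ^+ 2).
Proof. by move=> Hf; exact: loc_lipM. Qed.

Lemma loc_lip_exp2 u i : loc_lip u (fun v => expR (2 * v i 0)).
Proof. by apply: loc_lip_expR; apply: loc_lipM (loc_lip_cst _ _) (loc_lip_coord _ _). Qed.

Lemma loc_lip_rad u i : in_domain u -> loc_lip u (fun v => r_ v i).
Proof.
move=> /(_ i); rewrite /rad; case: (if g is Hyperbolic then eps i else false) => [/(_ isT) u0|_].
  apply: loc_lipM; first by apply: loc_lipM (loc_lip_cst _ _) (loc_lip_expR (loc_lip_coord _ _)).
  apply: loc_lipV; first by rewrite gt_eqF // one_sub_exp2_gt0.
  exact: loc_lipB (loc_lip_cst _ _) (loc_lip_exp2 _ _).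
exact: loc_lip_expR (loc_lip_coord _ _).
Qed.

Lemma loc_lip_chr u i : in_domain u -> loc_lip u (fun v => c_ v i).
Proof.
move=> /(_ i); rewrite /chr; case: (if g is Hyperbolic then eps i else false) => [/(_ isT) u0|_]; last exact: loc_lip_cst.
apply: loc_lipM; first exact: loc_lipD (loc_lip_cst _ _) (loc_lip_exp2 _ _).
apply: loc_lipV; first by rewrite gt_eqF // one_sub_exp2_gt0.
exact: loc_lipB (loc_lip_cst _ _) (loc_lip_exp2 _ _).
Qed.

Lemma loc_lip_side_at u i j : in_domain u -> loc_lip u (fun v => l_ v i j).
Proof.
move=> du; have ri := loc_lip_rad i du; have rj := loc_lip_rad j du.
have ci := loc_lip_chr i du; have cj := loc_lip_chr j du.
rewrite /side_at /side; case: g ri rj ci cj => ri rj ci cj.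
  by do ![exact: loc_lip_cst | assumption | apply: loc_lip_sqr | apply: loc_lipD | apply: loc_lipM].
by do ![exact: loc_lip_cst | assumption | apply: loc_lip_sqr | apply: loc_lipD | apply: loc_lipM].
Qed.

Lemma loc_lip_dside u i j : in_domain u ->
  loc_lip u (fun v => dside g (weight eps i) (eta [set i; j]%SET) (r_ v i) (r_ v j) (c_ v i) (c_ v j)).
Proof.
move=> du; have ri := loc_lip_rad i du; have rj := loc_lip_rad j du.
have ci := loc_lip_chr i du; have cj := loc_lip_chr j du.
rewrite /dside; case: g ri rj ci cj => ri rj ci cj.
  by do ![exact: loc_lip_cst | assumption | apply: loc_lip_sqr | apply: loc_lipD | apply: loc_lipM].
by do ![exact: loc_lip_cst | assumption | apply: loc_lip_sqr | apply: loc_lipD | apply: loc_lipM].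
Qed.

Lemma loc_lip_length x (f : E -> R) : side_min g < f x -> loc_lip x f ->
  loc_lip x (fun u => length g (f u)).
Proof.
rewrite /side_min /length; case: g => f0 Hf; first exact: loc_lip_sqrt.
have Hs : loc_lip x (fun u => Num.sqrt (f u ^+ 2 - 1)).
  apply: loc_lip_sqrt; first by rewrite subr_gt0 exprn_egt1.
  exact: loc_lipB (loc_lip_sqr Hf) (loc_lip_cst _ _).
apply: loc_lip_ln; last exact: loc_lipD.
by rewrite ltr_pwDl ?sqrtr_ge0 // (lt_trans ltr01).
Qed.

Lemma loc_lip_side_coef x (a b c : E -> R) : side_min g < a x ->
  loc_lip x a -> loc_lip x b -> loc_lip x c -> loc_lip x (fun u => side_coef g (a u) (b u) (c u)).
Proof.
rewrite /side_min /side_coef; case: g => a0 Ha Hb Hc.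
  apply: loc_lipM; first exact: loc_lipB (loc_lipD Ha Hc) Hb.
  by apply: loc_lipV; [rewrite mulf_neq0 // gt_eqF|exact: loc_lipM (loc_lip_cst _ _) Ha].
apply: loc_lipM; first exact: loc_lipB (loc_lipM Ha Hc) Hb.
apply: loc_lipV; first by rewrite subr_eq0 gt_eqF // exprn_egt1.
exact: loc_lipB (loc_lip_sqr Ha) (loc_lip_cst _ _).
Qed.

Lemma loc_lip_area2 x (a b c : E -> R) :
  loc_lip x a -> loc_lip x b -> loc_lip x c -> loc_lip x (fun u => area2 g (a u) (b u) (c u)).
Proof.
rewrite /area2; case: g => Ha Hb Hc.
  apply: loc_lipB; first exact: loc_lipM (loc_lipM (loc_lip_cst _ _) Ha) Hb.
  exact: loc_lip_sqr (loc_lipB (loc_lipD Ha Hb) Hc).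
do 3![apply: loc_lipB; last exact: loc_lip_sqr].
by do ![exact: loc_lip_cst | assumption | apply: loc_lipD | apply: loc_lipM].
Qed.

Lemma loc_lip_face_deriv u i j k x : good u -> [set i; j; k]%SET \in F ->
  loc_lip u (fun v => face_deriv g eps eta v i j k x).
Proof.
move=> gu f1; have [du _] := gu; have f3 := f1; rewrite -2!face_rot in f3.
have sij := loc_lip_side_at i j du; have ski := loc_lip_side_at k i du.
have sjk := loc_lip_side_at j k du; have A0 := area2_at_gt0 Hsurf Hstr gu f1.
have gij := side_at_gt Hsurf Hstr du f1; have gki := side_at_gt Hsurf Hstr du f3.
apply: loc_lipM; last first.
  apply: loc_lipV; first by rewrite gt_eqF // sqrtr_gt0.
  by apply: loc_lip_sqrt => //; exact: loc_lip_area2.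
have -> : (fun v => face_angle_deriv g (weight eps i) (weight eps j) (weight eps k)
    (eta [set j; k]%SET) (eta [set k; i]%SET) (eta [set i; j]%SET)
    (r_ v i) (r_ v j) (r_ v k) (c_ v i) (c_ v j) (c_ v k) (x i 0) (x j 0) (x k 0)) =
  (fun v => angle_deriv g (l_ v i j) (l_ v k i) (l_ v j k)
    (dside g (weight eps i) (eta [set i; j]%SET) (r_ v i) (r_ v j) (c_ v i) (c_ v j) * x i 0 +
     dside g (weight eps j) (eta [set j; i]%SET) (r_ v j) (r_ v i) (c_ v j) (c_ v i) * x j 0)
    (dside g (weight eps i) (eta [set i; k]%SET) (r_ v i) (r_ v k) (c_ v i) (c_ v k) * x i 0 +
     dside g (weight eps k) (eta [set k; i]%SET) (r_ v k) (r_ v i) (c_ v k) (c_ v i) * x k 0)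
    (dside g (weight eps j) (eta [set j; k]%SET) (r_ v j) (r_ v k) (c_ v j) (c_ v k) * x j 0 +
     dside g (weight eps k) (eta [set k; j]%SET) (r_ v k) (r_ v j) (c_ v k) (c_ v j) * x k 0)).
  apply/funext => v; rewrite /face_angle_deriv (finset.setUC [set j]%SET [set i]%SET).
  rewrite (finset.setUC [set i]%SET [set k]%SET) (finset.setUC [set k]%SET [set j]%SET).
  by rewrite [side g (weight eps i) (weight eps k) _ _ _ _ _]side_sym.
have L (i' j' : 'I_N) := loc_lipM (loc_lip_dside i' j' du) (loc_lip_cst _ (x i' 0)).
rewrite /angle_deriv; apply: loc_lipB; first apply: loc_lipB.
- exact: loc_lipD (L j k) (L k j).
- by apply: loc_lipM (loc_lipD (L i j) (L j i)); exact: loc_lip_side_coef.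
- by apply: loc_lipM (loc_lipD (L i k) (L k i)); exact: loc_lip_side_coef.
Qed.

Lemma loc_lip_curvature_deriv u x i : good u ->
  loc_lip u (fun v => curvature_deriv g F eps eta v x i).
Proof.
move=> gu; apply: loc_lipN; apply: loc_lip_sum => j _; apply: loc_lip_sum => k /andP[_ f].
exact: loc_lip_face_deriv.
Qed.

Lemma good_near u : good u -> near_fro u good.
Proof.
move=> gu; have [du tu] := gu; apply: near_fro_and; first exact: good_near_domain.
apply: near_fro_forall => i; apply: near_fro_forall => j; apply: near_fro_forall => k.
apply: near_fro_implies => f1; have f2 := f1; rewrite -face_rot in f2.
have f3 := f2; rewrite -face_rot in f3.
have Lij : loc_lip u (fun v => length g (l_ v i j)).
  by apply: loc_lip_length (loc_lip_side_at _ _ du); exact: side_at_gt f1.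
have Lik : loc_lip u (fun v => length g (l_ v i k)).
  apply: loc_lip_length (loc_lip_side_at _ _ du); rewrite side_atC; exact: side_at_gt f3.
have Lkj : loc_lip u (fun v => length g (l_ v k j)).
  apply: loc_lip_length (loc_lip_side_at _ _ du); rewrite side_atC; exact: side_at_gt f2.
have := loc_lip_lt Lij (loc_lipD Lik Lkj); rewrite -!edge_lengthE // => /(_ (tu i j k f1)) H.
apply: near_fro_imp (near_fro_and (good_near_domain du) H) => v [dv].
by rewrite !edge_lengthE.
Qed.

End Regularity.

(** * The Laplacian *)

Lemma is_derive_line (R : realType) (N : nat) (f : 'cV[R]_N -> R) (u v : 'cV[R]_N) (d : R) :
  is_derive (0 : R) 1 (fun s : R => f (u + s *: v)) d -> 'D_v f u = d.
Proof.
move=> [_ <-]; rewrite /derive.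
suff -> : (fun h : R => h^-1 *: (f (h *: v + u) - f u)) =
  (fun h : R => h^-1 *: (f (u + (h *: 1 + 0) *: v) - f (u + 0 *: v))) by [].
apply/funext => h; rewrite scale0r !addr0 [u + _]addrC; congr (_ *: (f (_ *: _ + _) - _)).
by rewrite /GRing.scale /= mulr1.
Qed.

Section OrderedTriples.
Context {R : realType} (N : nat) (F : {set {set 'I_N}}).
Hypothesis Hsurf : connected_closed_surface F.
Implicit Types (i j k : 'I_N) (f : 'I_N -> 'I_N -> 'I_N -> R).

(** Summing over ordered triples counts every face six times but makes the sum invariant under
    relabelling. *)
Definition face_sum f : R := \sum_i \sum_j \sum_(k | [set i; j; k]%SET \in F) f i j k.

Lemma face_sum_rot f : face_sum f = face_sum (fun i j k => f j k i).
Proof.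
pose T i j k := if [set i; j; k]%SET \in F then f i j k else 0.
have -> : face_sum f = \sum_i \sum_j \sum_k T i j k.
  by apply: eq_bigr => i _; apply: eq_bigr => j _; rewrite big_mkcond.
have -> : face_sum (fun i j k => f j k i) = \sum_i \sum_j \sum_k T j k i.
  apply: eq_bigr => i _; apply: eq_bigr => j _; rewrite big_mkcond; apply: eq_bigr => k _.
  by rewrite /T face_rot.
rewrite [RHS]exchange_big /=; apply: eq_bigr => i _.
by rewrite [RHS]exchange_big.
Qed.

Lemma face_sumD f h : face_sum (fun i j k => f i j k + h i j k) = face_sum f + face_sum h.
Proof.
rewrite -big_split /=; apply: eq_bigr => i _; rewrite -big_split /=; apply: eq_bigr => j _.
by rewrite -big_split.
Qed.

Lemma eq_face_sum f h : (forall i j k, [set i; j; k]%SET \in F -> f i j k = h i j k) ->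
  face_sum f = face_sum h.
Proof. by move=> fh; do 2!apply: eq_bigr => ? _; apply: eq_bigr => k; exact: fh. Qed.

Lemma face_sum_cycle f :
  face_sum f = 3^-1 * face_sum (fun i j k => f i j k + f j k i + f k i j).
Proof.
have h1 := face_sum_rot f; have h2 := face_sum_rot (fun i j k => f j k i).
by rewrite !face_sumD -h2 -h1; field.
Qed.

Lemma face_sum_le0 f : (forall i j k, [set i; j; k]%SET \in F -> f i j k <= 0) -> face_sum f <= 0.
Proof. by move=> f0; do 3!apply: sumr_le0 => ? ?; exact: f0. Qed.

Lemma face_sum_eq0 f : (forall i j k, [set i; j; k]%SET \in F -> f i j k <= 0) -> face_sum f = 0 ->
  forall i j k, [set i; j; k]%SET \in F -> f i j k = 0.
Proof.
move=> f0 s0 i j k Fijk; apply/eqP; rewrite eq_le f0 //= -s0.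
rewrite /face_sum (bigD1 i) //=; apply: ler_wnDr; first by do 3!apply: sumr_le0 => ? ?; exact: f0.
rewrite (bigD1 j) //=; apply: ler_wnDr; first by do 2!apply: sumr_le0 => ? ?; exact: f0.
by rewrite (bigD1 k) //=; apply: ler_wnDr => //; apply: sumr_le0 => c /andP[fc _]; exact: f0.
Qed.

(* Each face at i is met once with j < k and twice without this constraint. *)
Lemma face_sum_ordered f : (forall i j k, [set i; j; k]%SET \in F -> f i j k = f i k j) ->
  \sum_i \sum_(j < N) \sum_(k < N | (j < k)%N && ([set i; j; k]%SET \in F)) f i j k =
  2^-1 * face_sum f.
Proof.
move=> fC; rewrite mulr_sumr; apply: eq_bigr => i _.
set S := LHS; suff -> : \sum_j \sum_(k | [set i; j; k]%SET \in F) f i j k = S + S by field.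
have S' : S = \sum_(j < N) \sum_(k < N | (k < j)%N && ([set i; j; k]%SET \in F)) f i j k.
  rewrite /S; under eq_bigr => j _ do rewrite big_mkcond /=.
  rewrite exchange_big /=; apply: eq_bigr => j _; rewrite [RHS]big_mkcond; apply: eq_bigr => k _.
  by rewrite face_swap; case: ifP => // /andP[_]; rewrite -face_swap => /fC.
rewrite {2}S' /S -big_split /=; apply: eq_bigr => j _.
rewrite (bigID (fun k : 'I_N => (j < k)%N)) /=; congr (_ + _).
  by apply: eq_bigl => k; rewrite andbC.
apply: eq_bigl => k; rewrite andbC -leqNgt leq_eqVlt.
case: eqP => [/val_inj <-|//] /=; rewrite ltnn /=.
by apply/negP => /(face_neq Hsurf); rewrite eqxx.
Qed.

End OrderedTriples.

Section LaplacianMatrix.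
Context {R : realType} (N : nat) (g : background) (F : {set {set 'I_N}}).
Variables (eps : 'I_N -> bool) (eta : {set 'I_N} -> R).
Hypothesis Hsurf : connected_closed_surface F.
Hypothesis Hstr : structure_condition F eps eta.
Local Notation E := 'cV[R]_N.
Local Notation side_at := (side_at g eps eta).
Local Notation good := (good g F eps eta).
Local Notation dtheta := (face_deriv g eps eta).
Local Notation dK := (curvature_deriv g F eps eta).
Local Notation L := (laplacian g F eps eta).
Implicit Types (u x y : E) (i j k : 'I_N).

Lemma face_deriv_linear u i j k a x y :
  dtheta u i j k (a *: x + y) = a * dtheta u i j k x + dtheta u i j k y.
Proof. by rewrite /face_deriv /face_angle_deriv /angle_deriv !mxE; ring. Qed.

Lemma curvature_deriv_linear u i a x y :
  dK u (a *: x + y) i = a * dK u x i + dK u y i.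
Proof.
rewrite /curvature_deriv mulrN -opprD; congr (- _).
rewrite mulr_sumr -big_split /=; apply: eq_bigr => j _.
rewrite mulr_sumr -big_split /=; apply: eq_bigr => k _; exact: face_deriv_linear.
Qed.

Lemma curvature_deriv0 u i : dK u 0 i = 0.
Proof. by have := curvature_deriv_linear u i (-1) 0 0; rewrite scaler0 addr0 mulN1r addNr. Qed.

Lemma laplacianE u i j : good u -> L u i j = dK u (delta_mx j 0) i.
Proof.
move=> gu; rewrite mxE; apply: is_derive_line.
have := @is_derive_curvature _ _ _ _ _ _ Hsurf Hstr u (delta_mx j 0) 0 i.
by rewrite scale0r addr0; apply.
Qed.

(** The explicit derivative is linear in the direction, so the matrix of partial derivatives
    represents every directional derivative. *)
Lemma laplacian_mul u x i : good u -> (L u *m x) i 0 = dK u x i.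
Proof.
move=> gu; rewrite mxE; under eq_bigr => j _ do rewrite laplacianE //.
have -> : dK u x i = dK u (\sum_j x j 0 *: delta_mx j 0) i.
  congr (dK _ _ _); rewrite {1}[x]matrix_sum_delta; apply: eq_bigr => j _.
  by rewrite big_ord1.
elim: (index_enum _) => [|j s IH]; first by rewrite !big_nil curvature_deriv0.
by rewrite !big_cons curvature_deriv_linear -IH mulrC.
Qed.

Lemma face_deriv_swap u i j k x : dtheta u i j k x = dtheta u i k j x.
Proof.
rewrite /face_deriv; congr (_ / Num.sqrt _).
  rewrite /face_angle_deriv /angle_deriv.
  rewrite (finset.setUC [set k]%SET [set j]%SET) (finset.setUC [set i]%SET [set k]%SET).
  rewrite (finset.setUC [set j]%SET [set i]%SET).
  by rewrite [side g (weight eps k) (weight eps j) _ _ _ _ _]side_sym; ring.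
by rewrite area2_swap (side_atC _ _ _ u k i) (side_atC _ _ _ u i j) (side_atC _ _ _ u k j).
Qed.

Definition face_form u i j k x y : R :=
  y i 0 * dtheta u i j k x + y j 0 * dtheta u j k i x + y k 0 * dtheta u k i j x.

Lemma face_formE u i j k x y : face_form u i j k x y =
  face_bilinear g (weight eps i) (weight eps j) (weight eps k)
    (eta [set j; k]%SET) (eta [set k; i]%SET) (eta [set i; j]%SET)
    (rad g eps u i) (rad g eps u j) (rad g eps u k) (chr g eps u i) (chr g eps u j) (chr g eps u k)
    (x i 0) (x j 0) (x k 0) (y i 0) (y j 0) (y k 0) /
  Num.sqrt (area2 g (side_at u i j) (side_at u k i) (side_at u j k)).
Proof.
rewrite /face_form /face_deriv /face_bilinear.
rewrite [area2 g (side_at u j k) _ _]area2_rot [area2 g (side_at u k i) _ _]area2_rot.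
by rewrite [area2 g (side_at u j k) _ _]area2_rot !mulrA -!mulrDl.
Qed.

Section Face.
Variables (u : E) (i j k : 'I_N).
Hypotheses (gu : good u) (ijk : [set i; j; k]%SET \in F).

Lemma face_form_sym x y : face_form u i j k x y = face_form u i j k y x.
Proof.
have du := gu.1; rewrite !face_formE; congr (_ / _).
apply: face_bilinear_sym; rewrite ?rad_gt0 ?chr_gt0 //; try exact: chr_vertex_rel.
exact: (face_weights Hsurf Hstr ijk).
Qed.

Lemma face_form_lt0 x :
  match g with
  | Euclidean => ~~ ((x i 0 == x j 0) && (x j 0 == x k 0))
  | Hyperbolic => ~~ [&& x i 0 == 0, x j 0 == 0 & x k 0 == 0]
  end -> face_form u i j k x x < 0.
Proof.
have du := gu.1; have A := area2_at_gt0 Hsurf Hstr gu ijk.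
move=> xn; rewrite face_formE pmulr_llt0 ?invr_gt0 ?sqrtr_gt0 //.
apply: face_bilinear_neg xn => //; rewrite ?rad_gt0 ?chr_gt0 //; try exact: chr_vertex_rel.
exact: (face_weights Hsurf Hstr ijk).
Qed.

Lemma face_form_const y : g = Euclidean -> face_form u i j k (const_mx 1) y = 0.
Proof.
have du := gu.1; move=> gE; rewrite face_formE !mxE.
rewrite face_bilinear_const ?mul0r //; rewrite ?rad_gt0 ?chr_gt0 //; try exact: chr_vertex_rel.
exact: (face_weights Hsurf Hstr ijk).
Qed.

Lemma face_form_le0 x : face_form u i j k x x <= 0.
Proof.
case: (boolP (match g with
  | Euclidean => ~~ ((x i 0 == x j 0) && (x j 0 == x k 0))
  | Hyperbolic => ~~ [&& x i 0 == 0, x j 0 == 0 & x k 0 == 0] end)).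
  by move/face_form_lt0/ltW.
have := face_form_const; case gE: g => Hc; rewrite negbK.
  move=> /andP[/eqP xij /eqP xjk].
  have -> : face_form u i j k x x = face_form u i j k (x j 0 *: const_mx 1) x.
    by rewrite !face_formE !mxE xij xjk mulr1.
  rewrite face_form_sym /face_form !mxE mulr1.
  have := Hc x erefl; rewrite face_form_sym /face_form !mxE !mul1r.
  by rewrite -!mulrDr => ->; rewrite mulr0.
move=> /and3P[/eqP xi /eqP xj /eqP xk].
by rewrite /face_form xi xj xk !mul0r !addr0.
Qed.

End Face.

(** The factor 1/6 undoes the ordering of the vertices: 1/2 for the two orders at a vertex
    ([face_sum_ordered]) and 1/3 for the cyclic rotations ([face_sum_cycle]). *)
Lemma laplacian_form u x y : good u ->
  (y^T *m (L u *m x)) 0 0 = - (6^-1 * face_sum F (fun i j k => face_form u i j k x y)).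
Proof.
move=> gu; rewrite mxE.
under eq_bigr => i _ do rewrite laplacian_mul // mxE /curvature_deriv mulrN mulr_sumr.
under eq_bigr => i _ do under eq_bigr => j _ do rewrite mulr_sumr.
rewrite sumrN; congr (- _).
rewrite (face_sum_ordered Hsurf (f := fun i j k => y i 0 * dtheta u i j k x)); last first.
  by move=> i j k _; rewrite face_deriv_swap.
by rewrite face_sum_cycle mulrA; congr (_ * _); field.
Qed.

Lemma laplacian_sym u : good u -> (L u)^T = L u.
Proof.
move=> gu; apply/matrixP => i j; rewrite mxE.
have E a b : L u a b = ((delta_mx a 0)^T *m (L u *m delta_mx b 0) : 'M[R]_1) 0 0.
  by rewrite trmx_delta -rowE -colE !mxE.
rewrite !E !laplacian_form //; congr (- (_ * _)).
by apply: eq_face_sum => a b c f; exact: (face_form_sym gu f).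
Qed.

Lemma laplacian_ge0 u x : good u -> 0 <= (x^T *m (L u *m x)) 0 0.
Proof.
move=> gu; rewrite laplacian_form // oppr_ge0 pmulr_rle0 ?invr_gt0 //.
by apply: face_sum_le0 => i j k f; exact: (face_form_le0 gu f).
Qed.

(* The kernel of the Laplacian is spanned by this vector. *)
Definition laplacian_null : E := if g is Euclidean then const_mx 1 else 0.

Lemma laplacian_null_mul u : good u -> L u *m laplacian_null = 0.
Proof.
move=> gu; rewrite /laplacian_null; case gE: g; last by rewrite mulmx0.
apply/colP => i; rewrite [RHS]mxE -gE.
have -> : (L u *m (const_mx 1 : E)) i 0 = ((delta_mx i 0 : E)^T *m (L u *m (const_mx 1 : E))) 0 0.
  by rewrite trmx_delta -rowE [RHS]mxE.
rewrite laplacian_form // /face_sum !big1 ?mulr0 ?oppr0 // => a _; rewrite big1 // => b _.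
by rewrite big1 // => c f; exact: (face_form_const gu f).
Qed.

Lemma vertex_face i : exists j k, [set i; j; k]%SET \in F.
Proof.
have [f Ff fi] := surf_vertex Hsurf i.
have := surf_face Hsurf Ff; rewrite (cardsD1 i) fi add1n => /eqP; rewrite eqSS => /cards2P[j [k [_ fE]]].
by exists j, k; rewrite -finset.setUA -fE finset.setD1K.
Qed.

Lemma edge_face i j : [set i; j]%SET \in edges F -> exists k, [set i; j; k]%SET \in F.
Proof.
rewrite inE cards2 => /andP[ij /existsP[f /andP[Ff sf]]].
have ij' : i != j by case: (i != j) ij.
have := surf_face Hsurf Ff; have fi : i \in f by rewrite (fintype.subsetP sf) // !inE eqxx.
have fj : j \in f :\ i by rewrite !inE eq_sym ij' (fintype.subsetP sf) // !inE eqxx orbT.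
rewrite (cardsD1 i) fi (cardsD1 j) fj !add1n => /eqP; rewrite !eqSS => /cards1P[k fE].
by exists k; rewrite -finset.setUA -fE finset.setD1K ?finset.setD1K.
Qed.

(** A vanishing sum of nonpositive face forms vanishes face by face. Then x is 0 on each face, or
    constant on each face and hence, along paths of edges, everywhere; in that case orthogonality to
    the constants gives 0. *)
Lemma laplacian_gt0 u x : good u -> (laplacian_null^T *m x) 0 0 = 0 -> x != 0 ->
  0 < (x^T *m (L u *m x)) 0 0.
Proof.
move=> gu qx; rewrite lt0r laplacian_ge0 // andbT; apply: contraNN => /eqP.
rewrite laplacian_form // => /eqP; rewrite oppr_eq0 mulf_eq0 invr_eq0 pnatr_eq0 /= => /eqP S0.
have F0 : forall i j k, [set i; j; k]%SET \in F -> face_form u i j k x x = 0.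
  apply: face_sum_eq0 S0 => i j k f; exact: (face_form_le0 gu f).
have Fx i j k : [set i; j; k]%SET \in F ->
  match g with
  | Euclidean => ((x i 0 == x j 0) && (x j 0 == x k 0))
  | Hyperbolic => [&& x i 0 == 0, x j 0 == 0 & x k 0 == 0]
  end.
  move=> f; have := @face_form_lt0 u i j k gu f x; rewrite F0 // ltxx.
  by case: g => H; apply: contraT => /H.
apply/eqP/colP => i; rewrite [RHS]mxE.
move: Fx qx; rewrite /laplacian_null; case gE: g => Fx.
  have Ex a b : x a 0 = x b 0.
    have /connectP[p] := surf_connected Hsurf a b; elim: p a => [|c p IH] a /=; first by move=> _ ->.
    by move=> /andP[/edge_face[d /Fx/andP[/eqP -> _]] pc bl]; exact: IH.
  rewrite mxE; under eq_bigr => a _ do rewrite !mxE mul1r (Ex a i).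
  rewrite sumr_const card_ord => /eqP; rewrite mulrn_eq0 => /orP[/eqP N0|/eqP //].
  by exfalso; have := leq_ltn_trans (leq0n i) (ltn_ord i); rewrite lt0n N0.
by move=> _; have [j [k /Fx/and3P[/eqP]]] := vertex_face i.
Qed.

End LaplacianMatrix.

(** * Fractional flows near an equilibrium *)

Section FractionalFlow.
Context {R : realType} (N : nat).
Local Notation E := 'cV[R]_N.
Variables (K : E -> E) (L : E -> 'M[R]_N) (q ubar : E) (s a b k r0 : R).
Hypotheses (r0_gt0 : 0 < r0) (a_gt0 : 0 < a) (k_ge0 : 0 <= k).
Hypothesis L_gap : forall u, fro (u - ubar) <= r0 -> spectral_gap q a b (L u).
Hypothesis L_lip : forall u v, fro (u - ubar) <= r0 -> fro (v - ubar) <= r0 ->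
  fro (L u - L v) <= k * fro (u - v).
Hypothesis K_derive : forall u x (t : R) i, fro (u + t *: x - ubar) <= r0 ->
  is_derive t 1 (fun t : R => K (u + t *: x) i 0) ((L (u + t *: x) *m x) i 0).

Lemma segment_ball u v (t rho : R) : 0 <= t <= 1 -> fro (u - ubar) <= rho ->
  fro (v - ubar) <= rho -> fro (u + t *: (v - u) - ubar) <= rho.
Proof.
move=> /andP[t0 t1] ur vr.
have -> : u + t *: (v - u) - ubar = (1 - t) *: (u - ubar) + t *: (v - ubar).
  by apply/matrixP => i j; rewrite !mxE; ring.
apply: le_trans (froD _ _) _; rewrite !froZ ger0_norm ?subr_ge0 // ger0_norm //.
have -> : rho = (1 - t) * rho + t * rho by ring.
by apply: lerD; apply: ler_wpM2l => //; rewrite subr_ge0.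
Qed.

(** Taken with M = 0 it bounds the variation of K, and with M = L(ubar) it bounds the Taylor
    remainder. *)
Lemma mean_value_le (M : 'M[R]_N) (e : R) u v : fro (u - ubar) <= r0 -> fro (v - ubar) <= r0 ->
  (forall t, 0 <= t <= 1 -> fro (L (u + t *: (v - u)) - M) <= e) ->
  fro (K v - K u - M *m (v - u)) <= e * fro (v - u).
Proof.
move=> ur vr Le; set x := v - u; set d := K v - K u - M *m x.
have e0 : 0 <= e by apply: le_trans (fro_ge0 _) (Le 0 _); rewrite lexx ler01.
(* Pairing with the error [d] itself reduces the vector inequality to a scalar one: phi 1 <= phi 0
   says |d|^2 <= |d| e |x|. *)
pose phi (t : R) := \sum_i d i 0 * K (u + t *: x) i 0 - t * ((d^T *m (M *m x)) 0 0 + fro d * (e * fro x)).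
have D (t : R) : 0 <= t <= 1 -> is_derive t 1 phi
    ((d^T *m (L (u + t *: x) *m x)) 0 0 - ((d^T *m (M *m x)) 0 0 + fro d * (e * fro x))).
  move=> t01.
  have D1 : is_derive t 1 (\sum_i (fun t : R => d i 0 * K (u + t *: x) i 0))
      (\sum_i d i 0 * (L (u + t *: x) *m x) i 0).
    apply: is_derive_sum => i; apply: is_derive_eq (is_deriveZ (d i 0) (K_derive _ _)) _ => //.
    exact: segment_ball.
  have D2 := is_deriveM (is_derive_id t (1:R))
    (is_derive_cst ((d^T *m (M *m x)) 0 0 + fro d * (e * fro x)) t (1:R)).
  have -> : phi = (\sum_i (fun t : R => d i 0 * K (u + t *: x) i 0)) -
      (fun t : R => t * ((d^T *m (M *m x)) 0 0 + fro d * (e * fro x))).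
    by apply/funext => p; rewrite /phi -[RHS]/(_ p - _) fct_sumE.
  apply: is_derive_eq (is_deriveB D1 D2) _; congr (_ - _).
    by rewrite [RHS]mxE; apply: eq_bigr => i _; rewrite [d^T 0 i]mxE.
  by rewrite /GRing.scale /= mulr0 add0r mulr1.
have : phi 1 <= phi 0.
  apply: (@le_of_derive_le0 R phi _ 0 1 ler01 D) => t /andP[t0 /ltW t1].
  have -> : (d^T *m (L (u + t *: x) *m x)) 0 0 - ((d^T *m (M *m x)) 0 0 + fro d * (e * fro x)) =
     (d^T *m ((L (u + t *: x) - M) *m x)) 0 0 - fro d * (e * fro x).
    have EB (A B : 'M[R]_1) : (A - B) 0 0 = A 0 0 - B 0 0 by rewrite !mxE.
    by rewrite mulmxBl (mulmxBr d^T) EB; ring.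
  rewrite subr_le0; apply: le_trans (ler_norm _) _; apply: le_trans (fro_dot _ _) _.
  rewrite ler_wpM2l ?fro_ge0 //; apply: le_trans (fro_mul _ _) _.
  by rewrite ler_wpM2r ?fro_ge0 // Le // t0.
rewrite /phi scale1r scale0r addr0 mul0r subr0 mul1r [u + x]addrC subrK => H.
have : fro d * fro d <= fro d * (e * fro x).
  rewrite -expr2 fro_sqr -dot_fro2 mxE.
  have -> : \sum_i d^T 0 i * d i 0 = \sum_i d i 0 * K v i 0 - \sum_i d i 0 * K u i 0
      - (d^T *m (M *m x)) 0 0.
    rewrite [(d^T *m _) 0 0]mxE -!sumrB; apply: eq_bigr => i _.
    rewrite [d^T 0 i]mxE; have -> : d i 0 = K v i 0 - K u i 0 - (M *m x) i 0 by rewrite !mxE.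
    by ring.
  by lra.
have := fro_ge0 d; rewrite le_eqVlt => /predU1P[<- _|d0]; first by rewrite mulr_ge0 ?fro_ge0.
by rewrite ler_pM2l.
Qed.

Let ubar_ball : fro (ubar - ubar) <= r0. Proof. by rewrite subrr fro0 ltW. Qed.

Lemma L_bound_ge0 : 0 <= b.
Proof. exact: le_trans (fro_ge0 _) (gap_upper (L_gap ubar_ball)). Qed.

Lemma K_lipschitz u v : fro (u - ubar) <= r0 -> fro (v - ubar) <= r0 ->
  fro (K v - K u) <= b * fro (v - u).
Proof.
move=> ur vr; have := @mean_value_le 0 b u v ur vr; rewrite mul0mx subr0; apply=> t t01.
by rewrite subr0; apply: gap_upper (L_gap (segment_ball _ _ _)).
Qed.

Lemma K_taylor u : fro (u - ubar) <= r0 ->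
  fro (K u - K ubar - L ubar *m (u - ubar)) <= k * fro2 (u - ubar).
Proof.
move=> ur; rewrite -fro_sqr expr2 mulrA; apply: mean_value_le => // t /andP[t0 t1].
apply: le_trans (L_lip _ _) _ => //; first by apply: segment_ball => //; rewrite t0.
by rewrite addrAC subrr add0r froZ ger0_norm // mulrCA ler_piMl // mulr_ge0 ?fro_ge0.
Qed.

Definition frac_field u : E := - frac_pow s (L u) *m (K u - K ubar).

Lemma frac_field_dissipative : exists r l c : R, [/\ 0 < r, r <= r0, 0 <= l, 0 < c &
  [/\ forall u v, fro (u - ubar) <= r -> fro (v - ubar) <= r ->
        fro (frac_field u - frac_field v) <= l * fro (u - v),
      forall u, fro (u - ubar) <= r -> (q^T *m frac_field u) 0 0 = 0 &
      forall u, fro (u - ubar) <= r -> (q^T *m (u - ubar)) 0 0 = 0 ->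
        ((u - ubar)^T *m frac_field u) 0 0 <= - c * fro2 (u - ubar)]].
Proof.
have [p [p0 Hp]] := @frac_pow_lipschitz _ _ q s a b a_gt0.
have [c [c0 Hc]] := @frac_pow_coercive _ _ q s a b a_gt0.
have b0 := L_bound_ge0; set P := fun u => frac_pow s (L u).
have Plip u v : fro (u - ubar) <= r0 -> fro (v - ubar) <= r0 ->
    fro (P u - P v) <= p * k * fro (u - v).
  move=> ur vr; apply: le_trans (Hp _ _ (L_gap ur) (L_gap vr)) _.
  by rewrite -mulrA ler_wpM2l // L_lip.
(* [C] bounds the quadratic error: the variation of the fractional power times that of K, plus the
   power at the equilibrium times the Taylor remainder. The radius [r] is chosen with C r <= c / 2,
   so that half of the coercivity survives; C + 1 avoids a zero denominator. *)
pose C := p * k * b + fro (P ubar) * k.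
have pk0 : 0 <= p * k by rewrite mulr_ge0.
have C0 : 0 <= C by rewrite addr_ge0 ?mulr_ge0 ?fro_ge0.
have C1 : 0 < C + 1 by rewrite ltr_wpDl.
pose r := Num.min r0 (c / 2 / (C + 1)).
have rr0 : r <= r0 by rewrite ge_min lexx.
have r_gt0 : 0 < r by rewrite lt_min r0_gt0 !divr_gt0.
have Cr : C * r <= c / 2.
  apply: le_trans (_ : (C + 1) * r <= _); first by rewrite ler_wpM2r ?(ltW r_gt0) // lerDl.
  by rewrite mulrC -ler_pdivlMr // ge_min lexx orbT.
pose l := p * k * (b * r) + (fro (P ubar) + p * k * r) * b.
have l0 : 0 <= l.
  have := ltW r_gt0 => rg0.
  by rewrite addr_ge0 // mulr_ge0 ?addr_ge0 ?fro_ge0 // ?mulr_ge0.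
have in0 u : fro (u - ubar) <= r -> fro (u - ubar) <= r0 by move=> /le_trans; exact.
exists r, l, (c / 2); split=> //; first by rewrite divr_gt0.
split.
- move=> u v ur vr; have ur0 := in0 _ ur; have vr0 := in0 _ vr.
  have -> : frac_field u - frac_field v =
      - ((P u - P v) *m (K u - K ubar) + P v *m (K u - K v)).
    by rewrite /frac_field !mulNmx -opprB opprK mulmxBl !mulmxBr; apply/matrixP => i j; rewrite !mxE; ring.
  rewrite froN; apply: le_trans (froD _ _) _; rewrite mulrDl; apply: lerD.
    apply: le_trans (fro_mul _ _) _; rewrite mulrAC.
    apply: ler_pM; rewrite ?fro_ge0 ?Plip //.
    by apply: le_trans (K_lipschitz _ _) _ => //; rewrite ler_wpM2l.
  apply: le_trans (fro_mul _ _) _; rewrite -mulrA.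
  apply: ler_pM; rewrite ?fro_ge0 ?K_lipschitz //.
  have -> : P v = P ubar + (P v - P ubar) by rewrite addrC subrK.
  apply: le_trans (froD _ _) _; rewrite lerD2l; apply: le_trans (Plip _ _ _ _) _ => //.
  by rewrite ler_wpM2l.
- move=> u /in0 ur; rewrite /frac_field mulmxA mulmxN (frac_pow_ker s a_gt0 (L_gap ur)).
  by rewrite oppr0 mul0mx mxE.
- move=> u ur qu; have ur0 := in0 _ ur; set w := u - ubar in ur qu ur0 *.
  have coer := Hc _ (L_gap ubar_ball) w qu; rewrite mulmxA in coer.
  set err := (P u - P ubar) *m (K u - K ubar) + P ubar *m (K u - K ubar - L ubar *m w).
  have -> : (w^T *m frac_field u) 0 0 =
      - (w^T *m P ubar *m L ubar *m w) 0 0 - (w^T *m err) 0 0.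
    have -> : frac_field u = - (P ubar *m (L ubar *m w)) - err.
      rewrite /frac_field /err mulNmx mulmxBl !mulmxBr.
      by apply/matrixP => i j; rewrite !mxE; ring.
    have EB (A B : 'M[R]_1) : (- A - B) 0 0 = - A 0 0 - B 0 0 by rewrite !mxE.
    by rewrite mulmxBr mulmxN EB !mulmxA.
  have errC : fro err <= C * fro2 w.
    apply: le_trans (froD _ _) _; rewrite mulrDl; apply: lerD.
      apply: le_trans (fro_mul _ _) _; rewrite -fro_sqr expr2 mulrACA.
      by apply: ler_pM; rewrite ?fro_ge0 ?Plip ?K_lipschitz.
    apply: le_trans (fro_mul _ _) _; rewrite -mulrA ler_wpM2l ?fro_ge0 //.
    exact: K_taylor.
  have H : `|(w^T *m err) 0 0| <= c / 2 * fro2 w.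
    apply: le_trans (fro_dot _ _) _; apply: le_trans (ler_wpM2l (fro_ge0 _) errC) _.
    rewrite mulrA ler_wpM2r ?fro2_ge0 //; apply: le_trans Cr.
    by rewrite mulrC ler_wpM2l.
  have := le_trans (ler_norm _) H; move: H => /ler_normlP[H _] _.
  rewrite mulNr; lra.
Qed.

End FractionalFlow.

Lemma loc_lip_family (R : realType) (n : nat) (I : finType) (x : 'cV[R]_n) (f : I -> 'cV[R]_n -> R) :
  (forall i, loc_lip x (f i)) -> exists k : R, 0 <= k /\ exists r : R, 0 < r /\
    forall i u v, fro (u - x) < r -> fro (v - x) < r -> `|f i u - f i v| <= k * fro (u - v).
Proof.
move=> H; suff [k [k0 [r [r0 K]]]] : exists k : R, 0 <= k /\ exists r : R, 0 < r /\
    forall i, i \in enum I -> forall u v, fro (u - x) < r -> fro (v - x) < r ->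
      `|f i u - f i v| <= k * fro (u - v).
  by exists k; split=> //; exists r; split=> // i; apply: K; rewrite mem_enum.
elim: (enum I) => [|i s [k [k0 [r [r0 K]]]]]; first by exists 0; split=> //; exists 1; split.
have [l [l0 [p [p0 L]]]] := H i.
exists (Num.max k l); split; first by rewrite le_max k0.
exists (Num.min r p); split; first by rewrite lt_min r0.
move=> j; rewrite inE => js u v; rewrite !lt_min => /andP[ur up] /andP[vr vp].
case/orP: js => [/eqP ->|js].
  by apply: le_trans (L u v up vp) _; rewrite ler_wpM2r ?fro_ge0 // le_max lexx orbT.
by apply: le_trans (K j js u v ur vr) _; rewrite ler_wpM2r ?fro_ge0 // le_max lexx.
Qed.

Section LocalGap.
Context {R : realType} (N : nat) (g : background) (F : {set {set 'I_N}}).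
Variables (eps : 'I_N -> bool) (eta : {set 'I_N} -> R).
Hypothesis Hsurf : connected_closed_surface F.
Hypothesis Hstr : structure_condition F eps eta.
Local Notation E := 'cV[R]_N.
Local Notation good := (good g F eps eta).
Local Notation L := (laplacian g F eps eta).
Local Notation q := (@laplacian_null R N g).
Implicit Types (u x : E).

Lemma laplacian_lipschitz u : good u -> exists k : R, 0 <= k /\ exists r : R, 0 < r /\
  forall v w, fro (v - u) < r -> fro (w - u) < r -> fro (L v - L w) <= k * fro (v - w).
Proof.
move=> gu; have Lij (ij : 'I_N * 'I_N) : loc_lip u (fun v => L v ij.1 ij.2).
  (* The explicit formula represents the Laplacian at nondegenerate structures, hence only near
     u. *)
  apply: loc_lip_eq (loc_lip_curvature_deriv Hsurf Hstr (delta_mx ij.2 0) ij.1 gu).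
  by apply: near_fro_imp (good_near Hsurf Hstr gu) => v gv; rewrite laplacianE.
have [k [k0 [r [r0 H]]]] := loc_lip_family Lij.
exists (k *+ N *+ N); split; first by rewrite !mulrn_wge0.
exists r; split=> // v w vr wr; apply: le_trans (fro_le_sum _) _.
apply: (@le_trans _ _ (\sum_(i < N) \sum_(j < N) k * fro (v - w))); last first.
  by rewrite !sumr_const !card_ord !mulrnAl.
apply: ler_sum => i _; apply: ler_sum => j _.
have -> : (L v - L w) i j = L v i j - L w i j by move: (L v) (L w) => A B; rewrite !mxE.
exact: H (i, j) v w vr wr.
Qed.

Lemma laplacian_gap u : good u -> exists a b k r : R, [/\ 0 < a, 0 <= k, 0 < r &
  [/\ forall v, fro (v - u) <= r -> good v,
      forall v, fro (v - u) <= r -> spectral_gap q a b (L v) &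
      forall v w, fro (v - u) <= r -> fro (w - u) <= r -> fro (L v - L w) <= k * fro (v - w)]].
Proof.
move=> gu; have [k [k0 [r1 [r10 Llip]]]] := laplacian_lipschitz gu.
have [r2 [r20 gr]] := good_near Hsurf Hstr gu.
have [a [a0 gap]] : exists a, 0 < a /\ spectral_gap q a (fro (L u)) (L u).
  apply: spectral_gap_exists => [|| v qv v0|v].
  - exact: laplacian_sym.
  - exact: laplacian_null_mul.
  - by rewrite -mulmxA; apply: laplacian_gt0.
  - by rewrite -mulmxA; apply: laplacian_ge0.
have k1 : 0 < k + 1 by rewrite ltr_wpDl.
(* [e] combines the two smallness conditions of [spectral_gap_perturb]; halving [r1] and [r2] in the
   radius turns open balls into closed ones. *)
pose e := Num.min (a / 2) 1.
have e0 : 0 < e by rewrite lt_min ltr01 divr_gt0.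
pose r := Num.min (Num.min (r1 / 2) (r2 / 2)) (e / (k + 1)).
have r0 : 0 < r by rewrite !lt_min !divr_gt0.
have in1 v : fro (v - u) <= r -> fro (v - u) < r1.
  by rewrite !le_min -andbA => /and3P[+ _ _]; lra.
have in2 v : fro (v - u) <= r -> fro (v - u) < r2.
  by rewrite !le_min -andbA => /and3P[_ + _]; lra.
exists (a / 2), (fro (L u) + 1), k, r; split; [by rewrite divr_gt0|exact: k0|exact: r0|split].
- by move=> v /in2; exact: gr.
- move=> v vr; have gv := gr v (in2 v vr).
  have Le : fro (L v - L u) <= e.
    have ur1 : fro (u - u) < r1 by rewrite subrr fro0.
    apply: le_trans (Llip v u (in1 v vr) ur1) _.
    move: vr; rewrite le_min ler_pdivlMr // => /andP[_]; apply: le_trans.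
    by rewrite mulrC ler_wpM2l ?fro_ge0 // lerDl.
  move: Le; rewrite le_min => /andP[La L1].
  apply: spectral_gap_perturb gap _ _ La L1; first exact: laplacian_sym.
  exact: laplacian_null_mul.
- by move=> v w /in1 vr /in1 wr; exact: Llip.
Qed.

End LocalGap.

Theorem theorem1p1 (R : realType) (N : nat) (F : {set {set 'I_N}})
    (eps : 'I_N -> bool) (eta : {set 'I_N} -> R) (g : background) :
  connected_closed_surface F ->
  structure_condition F eps eta ->
  forall ubar Kbar : 'cV[R]_N,
  nondegenerate_structure g F eps eta ubar ->
  curvature g F eps eta ubar = Kbar ->
  forall s : R, exists delta : R, 0 < delta /\
  forall u0 : 'cV[R]_N,
  l2norm (u0 - ubar) < delta ->
  (g = Euclidean -> \sum_i u0 i 0 = \sum_i ubar i 0) ->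
  exists u : R -> 'cV[R]_N,
    [/\ u 0 = u0,
        calabi_flow_on g F eps eta s Kbar `[0, +oo[ u,
        (forall (T : R) (v : R -> 'cV[R]_N), 0 < T -> v 0 = u0 ->
           calabi_flow_on g F eps eta s Kbar `[0, T[ v ->
           forall t : R, 0 <= t < T -> v t = u t)
      & exists C c : R, [/\ 0 < C, 0 < c &
          forall t : R, 0 <= t -> l2norm (u t - ubar) <= C * expR (- c * t)]].
Proof.
move=> Hsurf Hstr ubar Kbar nd KE s; have gu := goodP nd.
have [a [b [k [r0 [a0 k0 r00 [gr gap Llip]]]]]] := laplacian_gap Hsurf Hstr gu.
set K := curvature g F eps eta in KE.
have KD (u x : 'cV[R]_N) (t : R) i : fro (u + t *: x - ubar) <= r0 ->
    is_derive t 1 (fun t : R => K (u + t *: x) i 0) ((laplacian g F eps eta (u + t *: x) *m x) i 0).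
  move=> /gr gx; rewrite laplacian_mul //; exact: is_derive_curvature.
have [r [l [c [r_gt0 rr0 l0 c0 [Glip Gtan Gdis]]]]] :=
  frac_field_dissipative s r00 a0 k0 gap Llip KD.
exists r; split=> // u0; rewrite l2normE => u0r su0.
(* In the Euclidean case the normalization of the sums is exactly orthogonality to the constants; in
   the hyperbolic case the null vector is 0. *)
have qu0 : ((laplacian_null N g)^T *m (u0 - ubar)) 0 0 = 0 :> R.
  rewrite /laplacian_null; case gE: g su0 => su0; last by rewrite trmx0 mul0mx mxE.
  rewrite mxE; under eq_bigr => i _ do rewrite !mxE mul1r.
  by rewrite sumrB su0 // subrr.
have [z [z0 dz zr uniq_z]] := dissipative_flow r_gt0 l0 c0 Glip Gtan Gdis u0r qu0.
have fieldE u : frac_laplacian g F eps eta s u *m (K u - Kbar) =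
  frac_field K (laplacian g F eps eta) ubar s u by rewrite /frac_field KE.
exists z; split=> //.
- move=> t; rewrite /= in_itv /= andbT => t0; split.
    by apply/good_nondegenerate/gr; apply: le_trans rr0; case: (zr t t0).
  by move=> i; rewrite fieldE; apply: is_derive1_within; exact: dz.
- move=> T v T0 v0 vflow; apply: uniq_z => // t i tT.
  have [_ /(_ i)] := vflow t tT; rewrite fieldE; exact.
- exists r, c; split=> // t t0; rewrite l2normE; by case: (zr t t0).
Qed.
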